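(* Let $G$ be a graph with $\Delta(G)\geq 5$ such that the subgraph $G_{\geq 5}$ of $G$ induced by the set of vertices of degree at least $5$ is acyclic. Then all proper $(\chi'(G)+1)$-edge colorings of $G$ are Kempe equivalent.
   Context: All graphs are finite, without loops and multiple edges. $\Delta(G)$ is the maximum degree of $G$. A proper $t$-edge coloring of $G$ is a map $f:E(G)\to\{1,\dots,t\}$ with $f(e)\neq f(e')$ for adjacent edges $e,e'$. The chromatic index $\chi'(G)$ is the least $k$ for which a proper $k$-edge coloring exists. For a proper edge coloring $f$ and colors $a,b$, $G_f(a,b)$ is the subgraph induced by the edges colored $a$ or $b$. An interchange (Kempe change) consists of swapping colors $a$ and $b$ on one connected component of $G_f(a,b)$. Two proper edge colorings are Kempe equivalent if one can be obtained from the other by a sequence of interchanges. *)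

(* Defs.v *)
From mathcomp Require Import all_boot.
Set Implicit Arguments. Unset Strict Implicit. Unset Printing Implicit Defensive.

(* A finite simple graph: vertex type T : finType, adjacency e : rel T,
   assumed symmetric and irreflexive (hypotheses of the theorem). *)

Section Graph.
Variables (T : finType) (e : rel T).

Definition edgeset : {set {set T}} :=
  [set A : {set T} | [exists x : T, exists y : T, e x y && (A == [set x; y])]].

Definition deg (x : T) : nat := #|[set y | e x y]|.

Definition maxdeg : nat := \max_(x : T) deg x.

Definition e_ge5 : rel T := fun x y => [&& e x y, 5 <= deg x & 5 <= deg y].

Definition acyclic (r : rel T) : Prop :=
  forall s : seq T, uniq s -> 2 < size s -> ~~ cycle r s.

(* Edge colorings are maps from 2-subsets of T to colors (nat);
   we normalise them to take value 0 outside the edge set. *)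
Definition coloring := {ffun {set T} -> nat}.

Definition proper_coloring (t : nat) (f : coloring) : Prop :=
  [/\ forall A, A \in edgeset -> 1 <= f A <= t,
      forall A, A \notin edgeset -> f A = 0
    & forall A B, A \in edgeset -> B \in edgeset -> A != B ->
        A :&: B != set0 -> f A != f B].

Definition chromatic_index (k : nat) : Prop :=
  (exists f, proper_coloring k f) /\
  (forall j, j < k -> forall f, ~ proper_coloring j f).

Definition kadj (f : coloring) (a b : nat) : rel {set T} :=
  fun A B => [&& A \in edgeset, B \in edgeset, (f A == a) || (f A == b),
                 (f B == a) || (f B == b) & A :&: B != set0].

Definition swap_col (a b c : nat) : nat :=
  if c == a then b else if c == b then a else c.

Definition interchange (f : coloring) (a b : nat) (A0 : {set T}) : coloring :=
  [ffun A => if connect (kadj f a b) A0 A then swap_col a b (f A) else f A].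

Definition kempe_step (t : nat) (f g : coloring) : Prop :=
  exists a b A0, [/\ 1 <= a <= t, 1 <= b <= t, A0 \in edgeset,
                     (f A0 == a) || (f A0 == b) & g = interchange f a b A0].

Inductive kempe_equiv (t : nat) : coloring -> coloring -> Prop :=
| kempe_refl f : kempe_equiv t f f
| kempe_trans f g h : kempe_step t f g -> kempe_equiv t g h -> kempe_equiv t f h.

End Graph.

(* Main.v *)
Require Import Defs.
From mathcomp Require Import all_boot zify.
From Stdlib Require Import Classical.
Set Implicit Arguments. Unset Strict Implicit. Unset Printing Implicit Defensive.

(* Let h be an optimal coloring with k colors and f any coloring with k + 1 colors. It
   suffices to transform f so that its color class 1 becomes the color class M of h with
   color 1: then M is removed and one uses induction on k.

   Among the colorings reachable from f, take those in which as many edges of M as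
   possible have color 1. If some edge v-v' of M does not have color 1, one can arrange
   (by removing other edges from the class 1 by a fan argument) that v' is not covered by
   color 1 and that the edge u-v covers v. Among these colorings take one with as few
   weak vertices as possible, where a vertex is weak if color 1 is the only one that it
   misses; a weak vertex has degree k. For k < 4 there are too few colors. For k = 4 a
   chase of alternating chains finds all nine edges of a K5 minus an edge, which has no
   proper 4-edge-coloring, against the existence of h. For k > 4 weak vertices have
   degree at least 5, and multi-fans at the ends of the edges of color 1 give these ends
   so many weak neighbors that the vertices of degree at least 5 cannot span a forest. *)

(** * Kempe chains *)

(** Degrees are at most k because h has k colors. So with k + 1 colors every vertex misses a color,
    and a vertex that is not weak misses one other than 1. Weak vertices are therefore the only
    obstacle to fan arguments that leave color 1 alone. For this reason fans are taken relative to a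
    palette: the colors outside it, above all 1, stay where they are, and with the class 1 also the
    set of weak vertices stays the same.

    If k is at least 5, weak vertices belong to the forest, and a fan at an end of an edge of color
    1 has to contain weak neighbors of that end. A forest has fewer edges than vertices; writing
    this for the hubs and the weak vertices and collecting the terms of one hub gives its charge,
    twice the number of weak neighbors plus the number of hub neighbors minus 2.

    If k = 4, weak vertices have degree 4 and acyclicity says nothing about them. Here the colors
    are so few that one knows almost exactly which of them the vertices around u, v and v' miss; a
    missing color is moved along a chain until it gives a chain with three ends. *)

Section RelPaths.
Variables (T : finType) (r : rel T).

Lemma closed_connect_mem (S : pred T) x y :
  (forall s s', S s -> r s s' -> S s') -> S x -> connect r x y -> S y.
Proof.
move=> clS Sx /connectP[p]; elim: p x Sx => [|z p IH] x Sx /=; first by move=> _ ->.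
by case/andP=> rxz pzp lasty; apply: IH pzp lasty; apply: clS rxz.
Qed.

Hypothesis r_sym : symmetric r.
Hypothesis r_deg2 : forall x y1 y2 y3, r x y1 -> r x y2 -> r x y3 ->
  [|| y1 == y2, y1 == y3 | y2 == y3].

Definition endpt x := forall y1 y2, r x y1 -> r x y2 -> y1 = y2.

(** A component of a relation of degree at most 2 is a path or a cycle. The vertices of a path
    without repetition from [x] to [y] form a closed set, so [z] is among them, and an inner vertex
    has two distinct neighbors. *)
Lemma endpt_unique x y z : endpt x -> endpt y -> endpt z ->
  x != y -> x != z -> connect r x y -> connect r x z -> y = z.
Proof.
move=> ex ey ez nxy nxz cxy cxz; case/connectP: cxy => p0 pp0 ly0.
have [p [pp up _ ly]] : exists p, [/\ path r x p, uniq (x :: p), true & y = last x p].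
  by case: (shortenP pp0) ly0 => p ? ? ? ?; exists p.
have clp : forall s s', s \in x :: p -> r s s' -> s' \in x :: p.
  move=> s s'; rewrite inE => /orP[/eqP->|].
    case: p pp ly {up} => [|w p] /=; first by move=> _ yx; rewrite yx eqxx in nxy.
    by case/andP=> rxw _ _ rxs'; rewrite (ex _ _ rxs' rxw) !inE eqxx orbT.
  move=> sp rss'; case/splitPr: sp pp up ly => p1 p2.
  rewrite cat_path /= last_cat /= => /and3P[_ rls ps2] up ly.
  have lin : last x p1 \in x :: p1 ++ s :: p2 by rewrite -cat_cons mem_cat mem_last.
  have: uniq ((x :: p1) ++ s :: p2) by [].
  rewrite cat_uniq => /and3P[_ /hasPn nin _].
  case: p2 {up} ps2 ly nin lin => [|w p2] /=.
    move=> _ ys _; subst s; rewrite r_sym in rls.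
    by rewrite (ey _ _ rss' rls).
  case/andP=> rsw _ _; rewrite r_sym in rls.
  case/or3P: (r_deg2 rss' rls rsw) => /eqP E nin lin.
  - by rewrite E.
  - by rewrite E !inE mem_cat !inE eqxx !orbT.
  by have := nin w; rewrite !inE eqxx orbT -E => /(_ isT); rewrite -[_ || _]/(_ \in _ :: _) mem_last.
have: z \in x :: p.
  exact: (@closed_connect_mem (fun s => s \in x :: p)) clp (mem_head x p) cxz.
rewrite inE eq_sym (negbTE nxz) /= => zp.
case/splitPr: zp pp up ly => p1 p2.
rewrite cat_path /= last_cat /= => /and3P[_ rlz pz2] up ly.
have: uniq ((x :: p1) ++ z :: p2) by [].
rewrite cat_uniq => /and3P[_ /hasPn nin _].
case: p2 {up} pz2 ly nin => [|w p2] /=; first by move=> _ yz.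
case/andP=> rzw _ _; rewrite r_sym in rlz => nin.
by have := nin w; rewrite !inE eqxx orbT -(ez _ _ rlz rzw) => /(_ isT); rewrite -[_ || _]/(_ \in _ :: _) mem_last.
Qed.

End RelPaths.

(** * Colors at a vertex, alternating chains and their swaps *)

Section Colors.
Variables (T : finType) (e : rel T).
Hypotheses (e_sym : symmetric e) (e_irr : irreflexive e).
Implicit Types (f g : coloring T) (x y z s v u w : T).

Definition col f x y := f [set x; y].
(** Chains are followed from vertex to vertex, whereas [kadj] links edges: the ends of a chain are
    the vertices that miss [a] or [b]. *)
Definition kr f a b : rel T := fun x y => (col f x y == a) || (col f x y == b).
Definition mis f x c := [forall y, col f x y != c].

Lemma colC f x y : col f x y = col f y x.
Proof. by rewrite /col setUC. Qed.

Lemma mem_edgeset x y : ([set x; y] \in edgeset e) = e x y.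
Proof.
rewrite inE; apply/existsP/idP => [[a /existsP[b /andP[eab /eqP E]]]|exy]; last first.
  by exists x; apply/existsP; exists y; rewrite exy eqxx.
have nab : a != b by apply: contraTneq eab => ->; rewrite e_irr.
have: a \in [set x; y] by rewrite E set21.
have: b \in [set x; y] by rewrite E set22.
rewrite !inE; case/orP=> /eqP Eb /orP[] /eqP Ea; subst => //.
- by rewrite eqxx in nab.
- by rewrite e_sym.
- by rewrite eqxx in nab.
Qed.

Lemma edgesetP A : reflect (exists x y, e x y /\ A = [set x; y]) (A \in edgeset e).
Proof.
rewrite inE; apply: (iffP existsP) => [[x /existsP[y /andP[exy /eqP->]]]|[x [y [exy ->]]]].
  by exists x, y.
by exists x; apply/existsP; exists y; rewrite exy eqxx.
Qed.

Section Proper.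
Variables (t : nat) (f : coloring T).
Hypothesis pf : proper_coloring e t f.

Lemma col_edge x y : (0 < col f x y) = e x y.
Proof.
case: pf => p1 p0 _; rewrite /col -mem_edgeset; case: (boolP (_ \in _)) => [/p1/andP[]|/p0 ->] //.
Qed.

Lemma col_le x y : col f x y <= t.
Proof.
case: pf => p1 p0 _; rewrite /col.
by case: (boolP ([set x; y] \in edgeset e)) => [/p1/andP[]|/p0 ->].
Qed.

Lemma colxx x : col f x x = 0.
Proof. by apply/eqP; rewrite -leqn0 leqNgt col_edge e_irr. Qed.

Lemma col_inj x y z c : 0 < c -> col f x y = c -> col f x z = c -> y = z.
Proof.
move=> c0 xy xz; apply/eqP/negPn/negP => nyz.
case: pf => _ _ p2; have := p2 [set x; y] [set x; z].
rewrite !mem_edgeset -!col_edge xy xz c0 => /(_ isT isT).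
have nxy : x != y by apply: contraTneq c0 => E; rewrite -xy E colxx.
case/(_ _ _)/negP.
- apply/eqP => /setP /(_ y); rewrite !inE eqxx orbT.
  by rewrite (eq_sym y x) (negbTE nxy) (negbTE nyz).
- by apply/set0Pn; exists x; rewrite !inE eqxx.
- by rewrite -/(col f x y) -/(col f x z) xy xz.
Qed.

Lemma misPn x c : reflect (exists y, col f x y = c) (~~ mis f x c).
Proof.
rewrite negb_forall; apply: (iffP existsP) => [[y /negPn /eqP]|[y <-]]; exists y => //.
by rewrite negbK.
Qed.

Lemma kr_sym a b : symmetric (kr f a b).
Proof. by move=> x y; rewrite /kr colC. Qed.

Lemma kr_deg2 a b x y1 y2 y3 : 0 < a -> 0 < b ->
  kr f a b x y1 -> kr f a b x y2 -> kr f a b x y3 ->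
  [|| y1 == y2, y1 == y3 | y2 == y3].
Proof.
move=> a0 b0; rewrite /kr.
by do 3![case/orP=> /eqP ?]; apply/or3P;
  first [apply: Or31; apply/eqP; eapply col_inj; [|eassumption|eassumption]; done
        |apply: Or32; apply/eqP; eapply col_inj; [|eassumption|eassumption]; done
        |apply: Or33; apply/eqP; eapply col_inj; [|eassumption|eassumption]; done].
Qed.

Lemma kr_endpt a b x : 0 < a -> 0 < b -> mis f x a || mis f x b -> endpt (kr f a b) x.
Proof.
move=> a0 b0 m y1 y2; rewrite /kr => H1 H2.
case/orP: m => /forallP m.
  move: H1 H2; rewrite !(negbTE (m _)) /= => /eqP H1 /eqP H2; exact: col_inj b0 H1 H2.
move: H1 H2; rewrite !(negbTE (m _)) /= !orbF => /eqP H1 /eqP H2; exact: col_inj a0 H1 H2.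
Qed.

(** A vertex that misses [a] or [b] is an end of its chain. Most contradictions with chains below
    are of this form. *)
Lemma three_ends a b x y z : 0 < a -> 0 < b ->
  mis f x a || mis f x b -> mis f y a || mis f y b -> mis f z a || mis f z b ->
  x != y -> x != z -> y != z ->
  connect (kr f a b) x y -> connect (kr f a b) x z -> False.
Proof.
move=> a0 b0 mx my mz xy xz yz cy cz; case/eqP: yz.
apply: (@endpt_unique _ (kr f a b)) cy cz => //; try exact: kr_endpt.
  exact: kr_sym.
by move=> ? ? ? ?; apply: kr_deg2.
Qed.

Lemma kr_connect_sym a b : connect_sym (kr f a b).
Proof. by apply: sym_connect_sym; apply: kr_sym. Qed.
End Proper.

Lemma swap_colK a b : involutive (swap_col a b).
Proof.
move=> c; rewrite /swap_col; case: (eqVneq c a) => [->|ca].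
  by case: (eqVneq b a) => // ba; rewrite eqxx.
by case: (eqVneq c b) => [->|cb]; rewrite ?eqxx // (negbTE ca) (negbTE cb).
Qed.

Lemma swap_col_inj a b : injective (swap_col a b).
Proof. exact: inv_inj (swap_colK a b). Qed.

(** It is enough to test [s]: an edge that leaves the component of [x] has neither of the two
    colors, so [swap_col] fixes its color. *)
Definition sw f g a b x := forall s r,
  col g s r = if connect (kr f a b) x s then swap_col a b (col f s r) else col f s r.

Section Swap.
Variables (t : nat) (f : coloring T) (a b : nat).
Hypothesis pf : proper_coloring e t f.
Hypotheses (a_rng : 1 <= a <= t) (b_rng : 1 <= b <= t).

Let a0 : 0 < a. Proof. by case/andP: a_rng. Qed.
Let b0 : 0 < b. Proof. by case/andP: b_rng. Qed.

Lemma swap_col0 : swap_col a b 0 = 0.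
Proof. by rewrite /swap_col !eqn_leq; move: a0 b0; case: a; case: b. Qed.

Lemma kr_edge x y : kr f a b x y -> e x y.
Proof. by rewrite -(col_edge pf) /kr => /orP[] /eqP->. Qed.

(** Translates the components of edges in [interchange] into components of vertices. *)
Lemma connect_kadj x z s r : kr f a b x z -> e s r ->
  connect (kadj e f a b) [set x; z] [set s; r] = connect (kr f a b) x s && kr f a b s r.
Proof.
move=> xz esr; apply/idP/andP => [|[cxs ksr]].
  pose S (A : {set T}) := [&& A \in edgeset e, (f A == a) || (f A == b)
                            & [forall s in A, connect (kr f a b) x s]].
  move=> c; have: S [set s; r].
    apply: closed_connect_mem c => [A B /and3P[_ _ /forall_inP SA]|]; last first.
      rewrite /S mem_edgeset // (kr_edge xz) -/(col f x z) -/(kr f a b x z) xz.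
      by apply/forall_inP => y /set2P[]->; rewrite ?connect0 ?connect1.
    case/and5P=> _ eB _ fB /set0Pn[y /setIP[yA yB]]; rewrite /S eB fB /=.
    case/(edgesetP): eB fB yB => p [q [epq ->]] fB yB.
    have kpq : kr f a b p q by [].
    have kqp : kr f a b q p by rewrite kr_sym.
    apply/forall_inP => w; move: yB (SA y yA) => /set2P[]-> cy /set2P[]-> //;
      by apply: connect_trans cy (connect1 _).
  by case/and3P=> _ ksr /forall_inP -> //; rewrite set21.
pose S s := [forall r, kr f a b s r ==> connect (kadj e f a b) [set x; z] [set s; r]].
have: S s.
  apply: closed_connect_mem cxs => [p q /forallP Sp kpq|]; last first.
    apply/forallP => q; apply/implyP => kxq; apply: connect1; rewrite /kadj !mem_edgeset //.
    rewrite !kr_edge // -!/(col _ _ _) -!/(kr f a b _ _) xz kxq.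
    by apply/set0Pn; exists x; rewrite !inE eqxx.
  apply/forallP => w; apply/implyP => kqw.
  have := Sp q; rewrite kpq /= => c; apply: connect_trans c (connect1 _).
  rewrite /kadj !mem_edgeset // !kr_edge // -!/(col _ _ _) -!/(kr f a b _ _) kpq kqw.
  by apply/set0Pn; exists q; rewrite !inE eqxx orbT.
by move/forallP/(_ r); rewrite ksr.
Qed.

Lemma swap_col_other c : (c == a) || (c == b) = false -> swap_col a b c = c.
Proof. by rewrite /swap_col; case: (c == a); case: (c == b). Qed.

Lemma swap_col_rng c : (1 <= swap_col a b c <= t) = (1 <= c <= t).
Proof.
rewrite /swap_col; case: eqP => [->|_]; first by rewrite a_rng b_rng.
by case: eqP => [->|_]; rewrite ?a_rng ?b_rng.
Qed.

Lemma sw_proper g x : (forall A, A \notin edgeset e -> g A = 0) -> sw f g a b x ->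
  proper_coloring e t g.
Proof.
move=> g0 swg; case: (pf) => p1 p0 p2; split => // [A eA|A B eA eB nAB /set0Pn[s /setIP[sA sB]]].
  have := p1 A eA; case/edgesetP: eA => s [r [esr ->]].
  rewrite -/(col g s r) swg; case: ifP => _; rewrite ?swap_col_rng //.
have decomp A' : A' \in edgeset e -> s \in A' -> exists r, A' = [set s; r].
  case/edgesetP=> p [q [_ ->]] /set2P[]->; first by exists q.
  by exists p; rewrite setUC.
have := p2 _ _ eA eB nAB; case: (decomp _ eA sA) (decomp _ eB sB) => r EA [r' EB].
rewrite EA EB -!/(col _ _ _) !swg => H.
have: col f s r != col f s r'.
  by apply: H; apply/set0Pn; exists s; rewrite !inE eqxx.
by case: ifP => // _; rewrite (inj_eq (@swap_col_inj a b)).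
Qed.

(** If [x] misses both colors, its component is [x] alone, and [f] itself serves as [g] without any
    interchange. *)
Lemma kempe_swap x :
  exists g, [/\ proper_coloring e t g, kempe_equiv e t f g & sw f g a b x].
Proof.
have f0 A : A \notin edgeset e -> f A = 0 by case: pf => _ + _; apply.
case: (pickP (kr f a b x)) => [z xz|nox]; last first.
  have swf : sw f f a b x.
    move=> s r; case: ifP => // cxs; rewrite swap_col_other //.
    have -> : s = x; last by exact: nox.
    apply/eqP; apply: (closed_connect_mem (S := pred1 x)) cxs; rewrite /= ?eqxx //.
    by move=> p q /= /eqP->; rewrite nox.
  by exists f; split => //; constructor.
have exz := kr_edge xz.
have swg : sw f (Defs.interchange e f a b [set x; z]) a b x.
  move=> s r; rewrite {1}/col ffunE.
  case: (boolP (e s r)) => esr.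
    rewrite connect_kadj // -/(col f s r) /kr; case: (connect _ _ _) => //=.
    by case: ifP => // /swap_col_other.
  have c0 : col f s r = 0 by apply: f0; rewrite mem_edgeset.
  by rewrite -/(col f s r) c0 swap_col0 !if_same.
exists (Defs.interchange e f a b [set x; z]); split => //.
  by apply: sw_proper swg => A nA; rewrite ffunE f0 // swap_col0 if_same.
apply: kempe_trans (kempe_refl _ _ _); exists a, b, [set x; z]; split => //.
by rewrite mem_edgeset.
Qed.
End Swap.

Section Sw.
Variables (t : nat) (f g : coloring T) (a b : nat) (x : T).
Hypothesis (swg : sw f g a b x).

Lemma sw_out s r : ~~ connect (kr f a b) x s -> col g s r = col f s r.
Proof. by rewrite swg => /negbTE->. Qed.

Lemma sw_in s r : connect (kr f a b) x s -> col g s r = swap_col a b (col f s r).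
Proof. by rewrite swg => ->. Qed.

Lemma swap_col_eq_other c k : k != a -> k != b -> (swap_col a b c == k) = (c == k).
Proof.
rewrite /swap_col => ka kb; case: (eqVneq c a) => [->|ca].
  by rewrite (eq_sym b) (eq_sym a) (negbTE ka) (negbTE kb).
by case: (eqVneq c b) => [->|//]; rewrite (eq_sym b) (eq_sym a) (negbTE ka) (negbTE kb).
Qed.

Lemma sw_other s r k : k != a -> k != b -> (col g s r == k) = (col f s r == k).
Proof. by move=> ka kb; rewrite swg; case: ifP => // _; apply: swap_col_eq_other. Qed.

Lemma sw_mis_other s k : k != a -> k != b -> mis g s k = mis f s k.
Proof. by move=> ka kb; apply: eq_forallb => r; rewrite sw_other. Qed.

Lemma sw_mis_out s k : ~~ connect (kr f a b) x s -> mis g s k = mis f s k.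
Proof. by move=> nc; apply: eq_forallb => r; rewrite sw_out. Qed.

Lemma sw_mis_in s k : connect (kr f a b) x s -> mis g s (swap_col a b k) = mis f s k.
Proof.
by move=> c; apply: eq_forallb => r; rewrite sw_in // (inj_eq (@swap_col_inj a b)).
Qed.
End Sw.

End Colors.

(** * Missing colors *)

Section Degrees.
Variables (T : finType) (e : rel T).
Hypotheses (e_sym : symmetric e) (e_irr : irreflexive e).

Lemma deg_seen t (f : coloring T) x : proper_coloring e t f ->
  deg e x = #|[set c : 'I_t.+1 | (0 < c) && ~~ mis f x c]|.
Proof.
move=> pf; rewrite /deg -(card_in_imset (f := fun y => inord (col f x y) : 'I_t.+1)).
  apply: eq_card => c; rewrite inE; apply/imsetP/andP => [[y]|[c0]].
    rewrite inE -(col_edge e_sym e_irr pf) => xy ->.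
    rewrite inordK ?ltnS ?(col_le pf) //; split => //.
    by apply/misPn; exists y.
  case/misPn=> y xy; exists y; last by rewrite xy inord_val.
  by rewrite inE -(col_edge e_sym e_irr pf) xy.
move=> y z; rewrite !inE -!(col_edge e_sym e_irr pf) => xy xz /(congr1 val) /=.
rewrite !inordK ?ltnS ?(col_le pf) // => E.
exact: (col_inj e_sym e_irr pf xy erefl (esym E)).
Qed.

Definition ms t (f : coloring T) x := [set c : 'I_t.+1 | (1 < c) && mis f x c].

(** The [t] colors are those seen at [x], one for each edge, then color 1 if it is missing, then the
    missing colors above 1. *)
Lemma card_ms t (f : coloring T) x : 0 < t -> proper_coloring e t f ->
  #|ms t f x| + mis f x 1 + deg e x = t.
Proof.
move=> t0 pf; rewrite (deg_seen x pf).
have E : #|[set c : 'I_t.+1 | 0 < c]| = t.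
  transitivity #|[set~ (ord0 : 'I_t.+1)]|; last by rewrite cardsC1 card_ord.
  by apply: eq_card => c; rewrite !inE -val_eqE lt0n.
apply: etrans E.
rewrite -(cardsID [set c : 'I_t.+1 | mis f x c] [set c : 'I_t.+1 | 0 < c]); congr (_ + _); last first.
  by apply: eq_card => c; rewrite !inE andbC.
pose o1 : 'I_t.+1 := inord 1.
have vo : val o1 = 1 by rewrite /= inordK.
rewrite (cardsD1 o1 (_ :&: _)) !inE vo /= addnC; congr (_ + _).
apply: eq_card => c; rewrite !inE -val_eqE vo /=.
by case: (val c) => [|[|n]] //=.
Qed.

Lemma mis_of_ms t (f : coloring T) x : ms t f x != set0 -> exists2 c, 1 < c <= t & mis f x c.
Proof.
case/set0Pn=> c; rewrite inE => /andP[c1 mc]; exists (val c) => //.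
by rewrite c1 -ltnS /=.
Qed.

Lemma ms_of_mis t (f : coloring T) x c : 1 < c <= t -> mis f x c -> ms t f x != set0.
Proof.
case/andP=> c1 ct mc; apply/set0Pn; exists (inord c); rewrite inE inordK ?ltnS //.
by rewrite c1.
Qed.

Lemma kequiv_trans t (f g h : coloring T) :
  kempe_equiv e t f g -> kempe_equiv e t g h -> kempe_equiv e t f h.
Proof.
move=> fg; elim: fg h => // f1 g1 h1 st _ IH h gh; apply: kempe_trans st _; exact: IH.
Qed.

Lemma deg_le t (f : coloring T) x : proper_coloring e t f -> deg e x <= t.
Proof.
move=> pf; case: t pf => [|t] pf.
  rewrite (deg_seen x pf) (_ : [set c : 'I_1 | _] = set0) ?cards0 //.
  by apply/setP=> c; rewrite !inE; case: c => [[]].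
by have := card_ms x (ltn0Sn t) pf; lia.
Qed.
End Degrees.

(** * Reachable colorings, swaps of short chains, weak vertices *)

Section State.
Variables (T : finType) (e : rel T).
Hypotheses (e_sym : symmetric e) (e_irr : irreflexive e).
Variables (k : nat) (f0 h : coloring T).
Hypothesis ph : proper_coloring e k h.
Notation t := k.+1.
Implicit Types (f g : coloring T) (x y z s r v u w : T).

Definition reachable f := proper_coloring e t f /\ kempe_equiv e t f0 f.

Lemma reach_swap f a b x : reachable f -> 1 <= a <= t -> 1 <= b <= t ->
  exists2 g, reachable g & sw f g a b x.
Proof.
case=> pf f0f a0 b0; have [g [pg fg swg]] := kempe_swap e_sym e_irr pf a0 b0 x.
by exists g => //; split => //; apply: kequiv_trans fg.
Qed.

Lemma reach_swap_set f a b x (S : pred T) : reachable f -> 1 <= a <= t -> 1 <= b <= t ->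
  S x -> (forall s r, S s -> kr f a b s r -> S r) ->
  (forall s, S s -> connect (kr f a b) x s) ->
  exists2 g, reachable g &
    forall s r, col g s r = if S s then swap_col a b (col f s r) else col f s r.
Proof.
move=> Cf ha hb Sx clS conS; have [g Cg swg] := reach_swap x Cf ha hb.
exists g => // s r; rewrite swg; congr (if _ then _ else _).
apply/idP/idP; last exact: conS.
by apply: closed_connect_mem Sx => s1 s2; apply: clS.
Qed.

Lemma col_lt f x y : reachable f -> col f x y <= t.
Proof. by case=> pf _; apply: (col_le pf). Qed.

Lemma reach_inj f x y z c : reachable f -> 0 < c -> col f x y = c -> col f x z = c -> y = z.
Proof. by case=> pf _; apply: (col_inj e_sym e_irr pf). Qed.

Lemma reach_neq f x y c : reachable f -> 0 < c -> col f x y = c -> x != y.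
Proof. by case=> pf _ c0 E; apply: contraTneq c0 => xy; rewrite -E xy (colxx e_sym e_irr pf). Qed.

Lemma misF f x y c : col f x y = c -> mis f x c -> False.
Proof. by move=> E /forallP/(_ y); rewrite E eqxx. Qed.

Lemma swapL a b : swap_col a b a = b. Proof. by rewrite /swap_col eqxx. Qed.
Lemma swapR a b : swap_col a b b = a.
Proof. by rewrite /swap_col eqxx; case: eqP. Qed.

Definition edg x y s r := (s == x) && (r == y) || (s == y) && (r == x).

Lemma edgC x y s r : edg x y s r = edg x y r s.
Proof. by rewrite /edg orbC (andbC (s == y)) (andbC (s == x)). Qed.

Lemma edgE x y s r : edg x y s r -> [set s; r] = [set x; y].
Proof. by case/orP=> /andP[/eqP-> /eqP->] //; rewrite setUC. Qed.

Lemma edg_col f x y s r : edg x y s r -> col f s r = col f x y.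
Proof. by rewrite /col => /edgE->. Qed.

Lemma edgN1 x y s r : s != x -> s != y -> edg x y s r = false.
Proof. by rewrite /edg => /negbTE-> /negbTE->. Qed.
Lemma edgN2 x y s r : r != x -> r != y -> edg x y s r = false.
Proof. by rewrite /edg => /negbTE-> /negbTE->; rewrite !andbF. Qed.
Lemma edgN0 x y s r : s != x -> r != x -> edg x y s r = false.
Proof. by rewrite /edg => /negbTE-> /negbTE->; rewrite andbF. Qed.

Lemma edg1 x y : edg x y x y. Proof. by rewrite /edg !eqxx. Qed.
Lemma edg2 x y : edg x y y x. Proof. by rewrite /edg !eqxx orbT. Qed.

(* In this and the next two lemmas the component whose colors are swapped is a path
   with one, two or three edges. *)
Lemma recolor f w x c0 c : reachable f -> 1 <= c <= t -> 0 < c0 -> col f w x = c0 ->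
  mis f w c -> mis f x c ->
  exists2 g, reachable g & forall s r, col g s r = if edg w x s r then c else col f s r.
Proof.
move=> Cf hc c00 wx mw mx; have hc0 : 1 <= c0 <= t by rewrite c00 -wx col_lt.
have xw : col f x w = c0 by rewrite colC.
have [|s r /orP[]/eqP-> |s|g Cg Eg] := @reach_swap_set f c0 c w (pred2 w x) Cf hc0 hc.
- by rewrite /= eqxx.
- case/orP=> /eqP E; last by case: (misF E mw).
  by rewrite /= (reach_inj Cf c00 E wx) eqxx orbT.
- case/orP=> /eqP E; last by case: (misF E mx).
  by rewrite /= (reach_inj Cf c00 E xw) eqxx.
- case/orP=> /eqP->; rewrite ?connect0 //; apply: connect1; by rewrite /kr wx eqxx.
exists g => // s r; rewrite Eg /=.
case: (boolP (edg w x s r)) => [E|n].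
  rewrite (edg_col _ E) wx swapL; case/orP: E => /andP[-> _] //; by rewrite orbT.
case: ifP => // Ss; rewrite swap_col_other //; apply/negbTE; rewrite negb_or.
case/orP: Ss n => /eqP-> n; apply/andP; split; apply/eqP => E.
- by case/negP: n; rewrite (reach_inj Cf c00 E wx) edg1.
- by case: (misF E mw).
- by case/negP: n; rewrite (reach_inj Cf c00 E xw) edg2.
- by case: (misF E mx).
Qed.

Lemma rotate2 f w1 w2 w3 a b : reachable f -> 1 <= a <= t -> 1 <= b <= t ->
  col f w1 w2 = a -> col f w2 w3 = b -> mis f w1 b -> mis f w3 a ->
  exists2 g, reachable g & forall s r, col g s r =
    if edg w1 w2 s r then b else if edg w2 w3 s r then a else col f s r.
Proof.
move=> Cf ha hb c12 c23 m1 m3.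
have [a0 _] := andP ha; have [b0 _] := andP hb.
have c21 : col f w2 w1 = a by rewrite colC.
have c32 : col f w3 w2 = b by rewrite colC.
have [|s r|s|g Cg Eg] := @reach_swap_set f a b w1 (pred3 w1 w2 w3) Cf ha hb.
- by rewrite /= eqxx.
- case/or3P=> /eqP-> /orP[]/eqP E; rewrite /=; do 1?[by case: (misF E m1)];
    do 1?[by case: (misF E m3)].
  + by rewrite (reach_inj Cf a0 E c12) eqxx orbT.
  + by rewrite (reach_inj Cf a0 E c21) eqxx.
  + by rewrite (reach_inj Cf b0 E c23) eqxx !orbT.
  + by rewrite (reach_inj Cf b0 E c32) eqxx orbT.
- have k12 : connect (kr f a b) w1 w2 by apply: connect1; rewrite /kr c12 eqxx.
  have k23 : connect (kr f a b) w2 w3 by apply: connect1; rewrite /kr c23 eqxx orbT.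
  by case/or3P=> /eqP->; rewrite ?connect0 //; apply: connect_trans k12 k23.
exists g => // s r; rewrite Eg /=.
case: (boolP (edg w1 w2 s r)) => [E|n12].
  rewrite (edg_col _ E) c12 swapL; case/orP: E => /andP[-> _] //; by rewrite orbT.
case: (boolP (edg w2 w3 s r)) => [E|n23].
  rewrite (edg_col _ E) c23 swapR; case/orP: E => /andP[-> _] //; by rewrite !orbT.
case: ifP => // Ss; rewrite swap_col_other //; apply/negbTE; rewrite negb_or.
case/or3P: Ss n12 n23 => /eqP-> n12 n23; apply/andP; split; apply/eqP => E;
  do 1?[by case: (misF E m1)]; do 1?[by case: (misF E m3)].
- by case/negP: n12; rewrite (reach_inj Cf a0 E c12) edg1.
- by case/negP: n12; rewrite (reach_inj Cf a0 E c21) edg2.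
- by case/negP: n23; rewrite (reach_inj Cf b0 E c23) edg1.
- by case/negP: n23; rewrite (reach_inj Cf b0 E c32) edg2.
Qed.

Lemma rotate3 f w1 w2 w3 w4 a b : reachable f -> 1 <= a <= t -> 1 <= b <= t ->
  col f w1 w2 = a -> col f w2 w3 = b -> col f w3 w4 = a -> mis f w1 b -> mis f w4 b ->
  exists2 g, reachable g & forall s r, col g s r =
    if edg w1 w2 s r || edg w3 w4 s r then b else if edg w2 w3 s r then a else col f s r.
Proof.
move=> Cf ha hb c12 c23 c34 m1 m4.
have [a0 _] := andP ha; have [b0 _] := andP hb.
have c21 : col f w2 w1 = a by rewrite colC.
have c32 : col f w3 w2 = b by rewrite colC.
have c43 : col f w4 w3 = a by rewrite colC.
have [|s r|s|g Cg Eg] := @reach_swap_set f a b w1 (pred4 w1 w2 w3 w4) Cf ha hb.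
- by rewrite /= eqxx.
- case/or4P=> /eqP-> /orP[]/eqP E; rewrite /=; do 1?[by case: (misF E m1)];
    do 1?[by case: (misF E m4)].
  + by rewrite (reach_inj Cf a0 E c12) eqxx orbT.
  + by rewrite (reach_inj Cf a0 E c21) eqxx.
  + by rewrite (reach_inj Cf b0 E c23) eqxx !orbT.
  + by rewrite (reach_inj Cf a0 E c34) eqxx !orbT.
  + by rewrite (reach_inj Cf b0 E c32) eqxx orbT.
  + by rewrite (reach_inj Cf a0 E c43) eqxx !orbT.
- have k12 : connect (kr f a b) w1 w2 by apply: connect1; rewrite /kr c12 eqxx.
  have k23 : connect (kr f a b) w2 w3 by apply: connect1; rewrite /kr c23 eqxx orbT.
  have k34 : connect (kr f a b) w3 w4 by apply: connect1; rewrite /kr c34 eqxx.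
  have k13 := connect_trans k12 k23.
  by case/or4P=> /eqP->; rewrite ?connect0 //; apply: connect_trans k13 k34.
exists g => // s r; rewrite Eg /=.
case: (boolP (edg w1 w2 s r)) => [E|n12] /=.
  rewrite (edg_col _ E) c12 swapL; case/orP: E => /andP[-> _] //; by rewrite orbT.
case: (boolP (edg w3 w4 s r)) => [E|n34].
  rewrite (edg_col _ E) c34 swapL; case/orP: E => /andP[-> _] //; by rewrite !orbT.
case: (boolP (edg w2 w3 s r)) => [E|n23].
  rewrite (edg_col _ E) c23 swapR; case/orP: E => /andP[-> _] //; by rewrite !orbT.
case: ifP => // Ss; rewrite swap_col_other //; apply/negbTE; rewrite negb_or.
case/or4P: Ss n12 n23 n34 => /eqP-> n12 n23 n34; apply/andP; split; apply/eqP => E;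
  do 1?[by case: (misF E m1)]; do 1?[by case: (misF E m4)].
- by case/negP: n12; rewrite (reach_inj Cf a0 E c12) edg1.
- by case/negP: n12; rewrite (reach_inj Cf a0 E c21) edg2.
- by case/negP: n23; rewrite (reach_inj Cf b0 E c23) edg1.
- by case/negP: n34; rewrite (reach_inj Cf a0 E c34) edg1.
- by case/negP: n23; rewrite (reach_inj Cf b0 E c32) edg2.
- by case/negP: n34; rewrite (reach_inj Cf a0 E c43) edg2.
Qed.

(* Let M be the color class 1 of h. num_good counts the (ordered) edges of M that have
   color 1; weak_at says that x misses no color but 1; in a ready state the edge u-v is
   the only reason why the edge v-v' of M cannot be recolored with 1. *)
Definition num_good f := #|[set p : T * T | (col h p.1 p.2 == 1) && (col f p.1 p.2 == 1)]|.
Definition weak_at f x := mis f x 1 && (deg e x == k).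
Definition num_weak f := #|[set x | weak_at f x]|.
Definition ready_at f v u v' := [/\ col f u v = 1, col h v v' = 1 & mis f v' 1].

Lemma deg_lek x : deg e x <= k.
Proof. exact: deg_le e_sym e_irr _ _ _ ph. Qed.

(** By [card_ms] and the degree bound [k], a vertex that misses no color above 1 must miss 1 and
    have degree [k]; conversely these two use up all [k + 1] colors. *)
Lemma wkP f x : reachable f -> reflect (forall c, 1 < c <= t -> ~~ mis f x c) (weak_at f x).
Proof.
case=> pf _; have E := card_ms e_sym e_irr x (ltn0Sn k) pf; have dk := deg_lek x.
apply: (iffP idP) => [/andP[m1 /eqP dx] c hc|H].
  apply/negP => /(ms_of_mis hc); rewrite -card_gt0; move: E; rewrite m1 dx; lia.
have: #|ms t f x| = 0.
  apply/eqP; rewrite cards_eq0; apply/negPn/negP => /mis_of_ms[c hc mc].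
  by have := H c hc; rewrite mc.
rewrite /weak_at; move: E; case: (mis f x 1) => /=; lia.
Qed.

Lemma covered_mis f x : reachable f -> ~~ mis f x 1 -> exists2 c, 1 < c <= t & mis f x c.
Proof.
case=> pf _; have E := card_ms e_sym e_irr x (ltn0Sn k) pf; have dk := deg_lek x.
by move=> c1; apply: mis_of_ms; rewrite -card_gt0; move: E; rewrite (negbTE c1); lia.
Qed.

(** With degree [k] a vertex sees every color of [h]. *)
Lemma wk_partner f w : 0 < k -> weak_at f w -> exists w', col h w w' = 1.
Proof.
move=> k0 /andP[_ /eqP dw]; have E := card_ms e_sym e_irr w k0 ph.
by apply/misPn; move: E; rewrite dw; case: (mis h w 1) => //=; lia.
Qed.

Lemma sw_keep f g a b x s r c : sw f g a b x -> c != a -> c != b ->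
  col f s r = c -> col g s r = c.
Proof. by move=> swg ca cb E; apply/eqP; rewrite (sw_other swg) ?E. Qed.

Lemma sw_wk f g a b x s : sw f g a b x -> a != 1 -> b != 1 -> weak_at g s = weak_at f s.
Proof. by move=> swg na nb; rewrite /weak_at (sw_mis_other swg) // eq_sym. Qed.

Lemma sw_mis_start f g a b x : sw f g a b x -> mis f x a -> mis g x b.
Proof. by move=> swg m; rewrite -(swapL a b) (sw_mis_in swg) ?connect0. Qed.

Lemma sw_mis_start' f g a b x : sw f g a b x -> mis f x b -> mis g x a.
Proof. by move=> swg m; rewrite -(swapR a b) (sw_mis_in swg) ?connect0. Qed.

Lemma kr_l f a b x y : col f x y = a -> kr f a b x y.
Proof. by rewrite /kr => ->; rewrite eqxx. Qed.
Lemma kr_r f a b x y : col f x y = b -> kr f a b x y.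
Proof. by rewrite /kr => ->; rewrite eqxx orbT. Qed.

Lemma cnl f a b x y z : connect (kr f a b) x y -> col f y z = a -> connect (kr f a b) x z.
Proof. by move=> c E; apply: connect_trans c (connect1 (kr_l b E)). Qed.
Lemma cnr f a b x y z : connect (kr f a b) x y -> col f y z = b -> connect (kr f a b) x z.
Proof. by move=> c E; apply: connect_trans c (connect1 (kr_r a E)). Qed.

Lemma mis_neq f x y c : mis f x c -> ~~ mis f y c -> x != y.
Proof. by move=> mx; apply: contraNneq => <-. Qed.

Lemma col_mis f x y c : col f x y = c -> ~~ mis f x c.
Proof. by move=> E; apply/negP; apply: misF E. Qed.

Lemma col_neq f x p q c d : c != d -> col f x p = c -> col f x q = d -> p != q.
Proof. by move=> ncd xp xq; apply: contraNneq ncd => E; rewrite -xp -xq E. Qed.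

End State.

(** * Extremal colorings *)

Section Extremal.
Variables (T : finType) (e : rel T).
Hypotheses (e_sym : symmetric e) (e_irr : irreflexive e).
Variables (k : nat) (f0 h : coloring T).
Hypothesis ph : proper_coloring e k h.
Notation t := k.+1.
Notation reach := (reachable e k f0).
Notation good := (num_good h).
Notation wk := (weak_at e k).
Notation weak := (num_weak e k).
Notation ready := (ready_at h).
Implicit Types (f g : coloring T) (x y z s r v u w p q : T).

Variable G : nat.
Hypothesis good_max : forall f, reach f -> good f <= G.

Definition keeps f g := forall s r, col h s r = 1 -> col f s r = 1 -> col g s r = 1.
Definition same1 f g := forall s r, (col g s r == 1) = (col f s r == 1).

Lemma same1_keeps f g : same1 f g -> keeps f g.
Proof. by move=> S s r _ /eqP; rewrite -S => /eqP. Qed.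

Lemma same1_mis f g s : same1 f g -> mis g s 1 = mis f s 1.
Proof. by move=> S; apply: eq_forallb => r; rewrite S. Qed.

Lemma same1_weak f g : same1 f g -> weak g = weak f.
Proof. by move=> S; apply: eq_card => x; rewrite !inE /weak_at (same1_mis _ S). Qed.

Lemma keeps_good f g : keeps f g -> good f <= good g.
Proof.
move=> K; apply: subset_leq_card; apply/subsetP => -[s r]; rewrite !inE /=.
by case/andP=> /eqP hs /eqP fs; rewrite hs K ?eqxx.
Qed.

Lemma keeps_goodG f g : reach g -> good f = G -> keeps f g -> good g = G.
Proof.
by move=> Cg Gf K; apply/eqP; rewrite eqn_leq good_max // -Gf keeps_good.
Qed.

Lemma no_gain f g v v' : good f = G -> reach g -> keeps f g ->
  col h v v' = 1 -> col f v v' <> 1 -> col g v v' = 1 -> False.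
Proof.
move=> Gf Cg K hv fv gv; have := good_max Cg; rewrite leqNgt => /negP; apply.
rewrite -Gf; apply: proper_card; apply/properP; split.
  apply/subsetP => -[s r]; rewrite !inE /=.
  by case/andP=> /eqP hs /eqP fs; rewrite hs K ?eqxx.
by exists (v, v'); rewrite !inE /= hv ?gv //; apply/negP => /eqP.
Qed.

Lemma col_h_edge g x y : reach g -> col h x y = 1 -> 0 < col g x y.
Proof. by case=> pg _ hxy; rewrite (col_edge e_sym e_irr pg) -(col_edge e_sym e_irr ph) hxy. Qed.

Lemma no_gain2 f g v v' : good f = G -> reach g -> keeps f g ->
  col h v v' = 1 -> mis g v 1 -> mis g v' 1 -> col f v v' <> 1 -> False.
Proof.
move=> Gf Cg K hv mv mv' nf.
have [g2 Cg2 E] := recolor e_sym e_irr Cg (isT : 1 <= 1 <= t) (col_h_edge Cg hv) erefl mv mv'.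
apply: (no_gain Gf Cg2) hv nf _; last by rewrite E edg1.
by move=> s r hs fs; rewrite E; case: ifP => // _; apply: K.
Qed.

Lemma rng_gt c : 1 < c <= t -> [/\ 1 <= c <= t, 0 < c & c != 1].
Proof. by case/andP=> c1 ct; rewrite ct (ltnW c1) gtn_eqF. Qed.

Section Ready.
Variable mu : nat.
Hypothesis weak_min : forall f v u v',
  reach f -> good f = G -> ready f v u v' -> mu <= weak f.

Definition St f v u v' := [/\ reach f, good f = G, weak f = mu & ready f v u v'].

(** Colors above 1 only: neither the class 1 nor, the degrees being fixed, the set of weak vertices
    changes. *)
Lemma St_swap f v u v' a b x : St f v u v' -> 1 < a <= t -> 1 < b <= t ->
  exists2 g, St g v u v' & sw f g a b x.
Proof.
case=> Cf Gf Wf [uv hv mv'] ha hb.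
have [ha' _ na] := rng_gt ha; have [hb' _ nb] := rng_gt hb.
have [g Cg swg] := reach_swap e_sym e_irr x Cf ha' hb'; exists g => //.
have S : same1 f g by move=> s r; rewrite (sw_other swg) // eq_sym.
split; rewrite ?(same1_weak S) //; first exact: keeps_goodG Gf (same1_keeps S).
by split; rewrite ?(same1_mis _ S) //; apply/eqP; rewrite S uv.
Qed.

Lemma St_recolor f v u v' c0 c w x : St f v u v' -> 1 < c <= t -> 1 < c0 ->
  col f w x = c0 -> mis f w c -> mis f x c ->
  exists2 g, St g v u v' & forall s r, col g s r = if edg w x s r then c else col f s r.
Proof.
case=> Cf Gf Wf [uv hv mv'] hc hc0 wx mw mx.
have [hc' _ nc] := rng_gt hc.
have [g Cg Eg] := recolor e_sym e_irr Cf hc' (ltnW hc0) wx mw mx; exists g => //.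
have S : same1 f g.
  move=> s r; rewrite Eg; case: ifP => // /(edg_col f) ->.
  by rewrite wx (negbTE nc) gtn_eqF.
split; rewrite ?(same1_weak S) //; first exact: keeps_goodG Gf (same1_keeps S).
by split; rewrite ?(same1_mis _ S) //; apply/eqP; rewrite S uv.
Qed.

Section Rules.
Variables (f : coloring T) (v u v' : T).
Hypothesis Sf : St f v u v'.

Lemma St_reach : reach f. Proof. by case: Sf. Qed.
Lemma St_good : good f = G. Proof. by case: Sf. Qed.
Lemma St_uv : col f u v = 1. Proof. by case: Sf => _ _ _ []. Qed.
Lemma St_vu : col f v u = 1. Proof. by rewrite colC St_uv. Qed.
Lemma St_h : col h v v' = 1. Proof. by case: Sf => _ _ _ []. Qed.
Lemma St_mis : mis f v' 1. Proof. by case: Sf => _ _ _ []. Qed.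

Lemma St_nu : u != v'.
Proof. by apply/eqP => E; case: (misF St_uv); rewrite E St_mis. Qed.

Lemma St_nv : v != v'.
Proof. by apply/eqP => E; case: (misF St_vu); rewrite E St_mis. Qed.

Lemma St_nuv : u != v.
Proof. exact (reach_neq e_sym e_irr St_reach (ltn0Sn 0) St_uv). Qed.

Lemma St_hvu : col h v u <> 1.
Proof. by move=> E; have /eqP := col_inj e_sym e_irr ph (ltn0Sn 0) E St_h; rewrite (negbTE St_nu). Qed.

Lemma St_vv' : col f v v' <> 1.
Proof. by rewrite colC => /misF; apply; apply: St_mis. Qed.

Lemma St_k : 0 < k.
Proof. by rewrite -St_h; apply: (col_le ph). Qed.

Lemma St_vv'_gt : 1 < col f v v' <= t.
Proof.
rewrite (col_lt _ _ St_reach) andbT; have := col_h_edge St_reach St_h; have := St_vv'.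
by case: (col f v v') => [|[|n]].
Qed.

(** Recoloring [u]-[v] with [a] would uncover [v], and then [v]-[v'] could get color 1. The edge
    [u]-[v] lost from the class 1 is not in M. *)
Lemma St_disj a : 1 < a <= t -> mis f u a -> mis f v a -> False.
Proof.
move=> ha mu_ mv; have [ha' a0 na] := rng_gt ha.
have [g Cg Eg] := recolor e_sym e_irr St_reach ha' (ltn0Sn 0) St_uv mu_ mv.
apply: (no_gain2 St_good Cg _ St_h) _ _ St_vv'.
- move=> s r hs fs; rewrite Eg; case: ifP => // E; case: St_hvu.
  by rewrite colC -(edg_col h E).
- apply/forallP => s; rewrite Eg; case: ifP => // /negbT n; apply/eqP => E.
  by case/negP: n; rewrite (reach_inj e_sym e_irr St_reach (ltn0Sn 0) E St_vu) edg2.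
apply/forallP => s; rewrite Eg; case: ifP => // _; exact: (forallP St_mis).
Qed.

(* Otherwise u-v-v' is a component in the colors 1 and [col f v v'], and swapping
   it would give v-v' color 1. *)
Lemma St_sees_c : ~~ mis f u (col f v v').
Proof.
apply/negP => mu_; have [hc c0 nc] := rng_gt St_vv'_gt.
have [g Cg Eg] := rotate2 e_sym e_irr St_reach (isT : 1 <= 1 <= t) hc St_uv erefl mu_ St_mis.
have nE : edg u v v v' = false.
  by rewrite /edg [v' == v]eq_sym (negbTE St_nv) [v' == u]eq_sym (negbTE St_nu) !andbF.
apply: (no_gain St_good Cg _ St_h St_vv'); last by rewrite Eg nE edg1.
move=> s r hs fs; rewrite Eg; case: ifP => [E|_]; last by case: ifP.
by case: St_hvu; rewrite colC -(edg_col h E).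
Qed.

(** Otherwise [v']-[v]-[u]-[y] is a whole chain in the colors [col f v v'] and 1, and its swap gives
    [v]-[v'] color 1. *)
Lemma St_y_covered y : col f u y = col f v v' -> ~~ mis f y 1.
Proof.
move=> uy; apply/negP => my; have [hc c0 nc] := rng_gt St_vv'_gt.
have v'v : col f v' v = col f v v' by rewrite colC.
have [g Cg Eg] := rotate3 e_sym e_irr St_reach hc (isT : 1 <= 1 <= t) v'v St_vu uy St_mis my.
apply: (no_gain St_good Cg _ St_h St_vv'); last by rewrite Eg edg2.
move=> s r hs fs; rewrite Eg; case: ifP => // _; case: ifP => // E.
by case: St_hvu; rewrite -(edg_col h E).
Qed.

(** Otherwise [v]-[u]-[p] is a whole chain in the colors 1 and [a], and its swap uncovers [v] while
    [v'] stays uncovered. *)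
Lemma St_p_uncovered a p : 1 < a <= t -> mis f v a -> col f u p = a -> mis f p 1 -> p = v'.
Proof.
move=> ha mv up mp; apply/eqP/negPn/negP => npv'.
have [ha' a0 na] := rng_gt ha.
have [g Cg Eg] := rotate2 e_sym e_irr St_reach (isT : 1 <= 1 <= t) ha' St_vu up mv mp.
apply: (no_gain2 St_good Cg _ St_h) _ _ St_vv'.
- move=> s r hs fs; rewrite Eg; case: ifP => [E|_]; last by case: ifP.
  by case: St_hvu; rewrite -(edg_col h E).
- have nvp : v != p by apply/eqP => E; move: up; rewrite -E St_uv => E1; rewrite -E1 in na.
  apply/forallP => s; rewrite Eg; case: ifP => // /negbT n; case: ifP => [E|_].
    case/orP: E => /andP[/eqP E _]; first by move: St_nuv; rewrite E eqxx.
    by rewrite E eqxx in nvp.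
  apply/eqP => E.
  by case/negP: n; rewrite (reach_inj e_sym e_irr St_reach (ltn0Sn 0) E St_vu) edg1.
apply/forallP => s; rewrite Eg; case: ifP => // _; case: ifP => [E|_]; last exact: (forallP St_mis).
case/orP: E => /andP[/eqP E _]; first by move: St_nu; rewrite E eqxx.
by rewrite E eqxx in npv'.
Qed.

End Rules.

(** Otherwise a swap at [u] would make [a] missing at both [u] and [v], against [St_disj]. *)
Lemma St_linked f v u v' a b : St f v u v' -> 1 < a <= t -> 1 < b <= t ->
  mis f v a -> mis f u b -> connect (kr f a b) u v.
Proof.
move=> Sf ha hb mv mu_; apply/negPn/negP => nc.
have [g Sg swg] := St_swap u Sf ha hb.
apply: (St_disj Sg ha); last by rewrite (sw_mis_out swg).
by rewrite -(swapR a b) (sw_mis_in swg) ?connect0.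
Qed.

Lemma St_y_b f v u v' b y : St f v u v' -> 1 < b <= t -> mis f u b ->
  col f u y = col f v v' -> ~~ mis f y b.
Proof.
move=> Sf hb mu_ uy; apply/negP => my; have hc := St_vv'_gt Sf.
have hc1 : 1 < col f v v' by case/andP: hc.
have [g Sg Eg] := St_recolor Sf hb hc1 uy mu_ my.
have vv' : col g v v' = col f v v'.
  by rewrite Eg /edg (eq_sym v) (negbTE (St_nuv Sf)) [v' == u]eq_sym (negbTE (St_nu Sf)) andbF.
case/negP: (St_sees_c Sg); rewrite vv'; apply/forallP => s; rewrite Eg; case: ifP => [_|/negbT n].
  by apply/eqP => E; case: (misF uy); rewrite -E.
by apply/eqP => E; case/negP: n; rewrite (reach_inj e_sym e_irr (St_reach Sf) (ltnW hc1) E uy) edg1.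
Qed.

Lemma St_y_a f v u v' a b y : St f v u v' -> 1 < a <= t -> 1 < b <= t ->
  mis f v a -> mis f u b -> col f u y = col f v v' -> ~~ mis f y a.
Proof.
move=> Sf ha hb mv mu_ uy; apply/negP => my.
have luv := St_linked Sf ha hb mv mu_; have Cf := St_reach Sf.
have [_ a0 _] := rng_gt ha; have [_ b0 _] := rng_gt hb.
have [hc c0 _] := rng_gt (St_vv'_gt Sf).
have nuy := reach_neq e_sym e_irr Cf c0 uy.
have nvy : v != y.
  by apply/eqP => E; move: (St_vv'_gt Sf); rewrite -uy -E (St_uv Sf).
have nc : ~~ connect (kr f a b) y u.
  apply/negP => cyu; apply: (three_ends e_sym e_irr (proj1 Cf) a0 b0 (x := u) (y := v) (z := y)) => //.
  - by rewrite mu_ orbT.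
  - by rewrite mv.
  - by rewrite my.
  - exact: St_nuv Sf.
  - by rewrite kr_connect_sym.
have ncv : ~~ connect (kr f a b) y v.
  by apply: contra nc => c; apply: connect_trans c _; rewrite kr_connect_sym.
have [g Sg swg] := St_swap y Sf ha hb.
have mu' : mis g u b by rewrite (sw_mis_out swg).
have uy' : col g u y = col g v v' by rewrite (sw_out swg _ nc) (sw_out swg _ ncv).
case/negP: (St_y_b Sg hb mu' uy').
by rewrite -(swapL a b) (sw_mis_in swg) ?connect0.
Qed.

Lemma add_mis f g w x s : (forall s r, col g s r = if edg w x s r then 1 else col f s r) ->
  mis g s 1 = [&& mis f s 1, s != w & s != x].
Proof.
move=> Eg; case: (eqVneq s w) => [->|nsw] /=.
  by rewrite andbF; apply/negbTE/misPn; exists x; rewrite Eg edg1.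
case: (eqVneq s x) => [->|nsx] /=.
  by rewrite andbF; apply/negbTE/misPn; exists w; rewrite Eg edg2.
rewrite andbT; apply: eq_forallb => r; rewrite Eg ifN //.
by rewrite /edg (negbTE nsw) (negbTE nsx).
Qed.

Lemma add_edge f w x : reach f -> good f = G -> mis f w 1 -> mis f x 1 -> 0 < col f w x ->
  exists g, [/\ reach g, good g = G,
    forall s r, col g s r = if edg w x s r then 1 else col f s r &
    forall s, wk g s = [&& wk f s, s != w & s != x]].
Proof.
move=> Cf Gf mw mx wx0.
have [g Cg Eg] := recolor e_sym e_irr Cf (isT : 1 <= 1 <= t) wx0 erefl mw mx.
exists g; split=> //; last by move=> s; rewrite /weak_at (add_mis _ Eg) -!andbA; do !bool_congr.
by apply: (keeps_goodG Cg Gf) => s r hs fs; rewrite Eg; case: ifP.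
Qed.

(** The partner of [w] in M is covered, since otherwise the edge between them could get color 1. *)
Lemma weak_ready f w : 0 < k -> reach f -> good f = G -> wk f w ->
  exists w' u, ready f w' u w.
Proof.
move=> k0 Cf Gf ww; have [w' hw] := wk_partner e_sym e_irr ph k0 ww.
have [mw _] := andP ww.
have hw' : col h w' w = 1 by rewrite colC.
have: ~~ mis f w' 1.
  apply/negP => mw'; apply: (no_gain2 Gf Cf _ hw mw mw') => // E; exact: misF E mw.
by case/misPn=> u w'u; exists w', u; split; rewrite // colC.
Qed.

(** Giving [w]-[x] color 1 would keep the state ready and make [w] covered, so that fewer vertices
    are weak. *)
Lemma St_weak_nbr f v u v' w x : St f v u v' -> wk f w -> w != v' ->
  0 < col f w x -> x != v' -> ~~ mis f x 1.
Proof.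
move=> Sf ww nwv' wx0 nxv'; apply/negP => mx; have [mw _] := andP ww.
have [g [Cg Gg Eg wg]] := add_edge (St_reach Sf) (St_good Sf) mw mx wx0.
have: mu <= weak g.
  apply: (weak_min (v := v) (u := u) (v' := v')) => //; split; rewrite ?(St_h Sf) //.
    by rewrite Eg (St_uv Sf) if_same.
  by rewrite (add_mis _ Eg) (St_mis Sf) !(eq_sym v') nwv' nxv'.
rewrite leqNgt => /negP; apply; case: Sf => _ _ <- _; apply: proper_card; apply/properP; split.
  by apply/subsetP => s; rewrite !inE wg => /and3P[].
by exists w; rewrite !inE ?wg ?eqxx ?andbF.
Qed.

(** Giving [v']-[x] color 1 spoils the state at [v]. But [w] stays weak and provides another ready
    state by [weak_ready], in which [x] is no longer weak. *)
Lemma St_weak_pair f v u v' w x : St f v u v' -> wk f w -> w != v' ->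
  0 < col f v' x -> wk f x -> w != x -> False.
Proof.
move=> Sf ww nwv' vx wx nwx; have [mx _] := andP wx.
have [g [Cg Gg Eg wg]] := add_edge (St_reach Sf) (St_good Sf) (St_mis Sf) mx vx.
have [|p [q rg]] := weak_ready (St_k Sf) Cg Gg (w := w).
  by rewrite wg ww nwv' nwx.
have := weak_min Cg Gg rg.
rewrite leqNgt => /negP; apply; case: Sf => _ _ <- _; apply: proper_card; apply/properP; split.
  by apply/subsetP => s; rewrite !inE wg => /and3P[].
by exists x; rewrite !inE ?wg ?eqxx ?andbF.
Qed.

Lemma not_linked f a b x y s : reach f -> 0 < a -> 0 < b ->
  mis f x a || mis f x b -> mis f y a || mis f y b -> mis f s a || mis f s b ->
  x != y -> x != s -> y != s -> connect (kr f a b) x y ->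
  forall w, connect (kr f a b) x w -> ~~ connect (kr f a b) s w.
Proof.
move=> [pf _] a0 b0 mx my ms_ nxy nxs nys cxy w cxw; apply/negP => csw.
apply: (three_ends e_sym e_irr pf a0 b0 mx my ms_ nxy nxs nys cxy).
by apply: connect_trans cxw _; rewrite kr_connect_sym.
Qed.

(** * Five colors *)

Section FiveColors.
Hypothesis k4 : k = 4.

Record cols a b c d : Prop := Cols {
  _ : 1 < a <= t; _ : 1 < b <= t; _ : 1 < c <= t; _ : 1 < d <= t;
  _ : 0 < a; _ : 0 < b; _ : 0 < c; _ : 0 < d;
  _ : a != 1; _ : b != 1; _ : c != 1; _ : d != 1;
  _ : a != b; _ : a != c; _ : a != d; _ : b != a; _ : b != c; _ : b != d;
  _ : c != a; _ : c != b; _ : c != d; _ : d != a; _ : d != b; _ : d != c }.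

Lemma mk_cols a b c d : 1 < a <= t -> 1 < b <= t -> 1 < c <= t -> 1 < d <= t ->
  uniq [:: a; b; c; d] -> cols a b c d.
Proof. by rewrite /= !inE => ha hb hc hd U; constructor=> //; clear k4; lia. Qed.

Lemma colsP a b c d n : cols a b c d -> 1 < n <= t -> [\/ n = a, n = b, n = c | n = d].
Proof.
case=> ha hb hc hd _ _ _ _ _ _ _ _ nab nac nad _ nbc nbd _ _ ncd _ _ _ hx.
have: [|| n == a, n == b, n == c | n == d] by lia.
by case/or4P=> /eqP->; [apply: Or41|apply: Or42|apply: Or43|apply: Or44].
Qed.

(** Here [d] is the fifth color, besides 1, [a], [b], [c]. Throughout, [p] and [z] are the neighbors
    of [u] along [a] and [d], and [q] and [x] those of [v] along [b] and [d]. *)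
Definition cfg f v u v' y a b c d :=
  [/\ St f v u v', cols a b c d, mis f v a, mis f u b & col f v v' = c /\ col f u y = c].

Record cfg_facts f v u v' y a b c d : Prop := CfgFacts {
  _ : St f v u v'; _ : cols a b c d; _ : reach f;
  _ : mis f v a; _ : mis f u b; _ : col f v v' = c; _ : col f u y = c;
  _ : 1 < a <= t; _ : 1 < b <= t; _ : 1 < c <= t; _ : 1 < d <= t;
  _ : 0 < a; _ : 0 < b; _ : 0 < c; _ : 0 < d;
  _ : a != 1; _ : b != 1; _ : c != 1; _ : d != 1;
  _ : a != b; _ : a != c; _ : a != d; _ : b != a; _ : b != c; _ : b != d;
  _ : c != a; _ : c != b; _ : c != d; _ : d != a; _ : d != b; _ : d != c }.

Lemma cfgP f v u v' y a b c d : cfg f v u v' y a b c d -> cfg_facts f v u v' y a b c d.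
Proof. by case=> Sf Cs ? ? [? ?]; case: (Cs) => *; constructor=> //; apply: St_reach Sf. Qed.

Ltac open_cfg H :=
  case: (cfgP H) => Sf Cs Rf mva mub vv' uy ha hb hc hd a0 b0 c0 d0 na nb nc nd
    nab nac nad nba nbc nbd nca ncb ncd nda ndb ndc.

Section Cfg.
Variables (f : coloring T) (v u v' y : T) (a b c d : nat).
Hypothesis H : cfg f v u v' y a b c d.

Lemma cfg_wk s : ~~ mis f s a -> ~~ mis f s b -> ~~ mis f s c -> ~~ mis f s d -> wk f s.
Proof.
open_cfg H => ma mb mc md; apply/(wkP e_sym e_irr ph _ Rf) => x hx.
by case: (colsP Cs hx) => ->.
Qed.

Lemma cfg_uy : col f u y = col f v v'. Proof. by open_cfg H; rewrite uy vv'. Qed.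

(** Being covered, [y] misses a color above 1; [a], [b] and [c] are excluded by [St_y_a], [St_y_b]
    and the edge [u]-[y]. *)
Lemma cfg_y : mis f y d.
Proof.
open_cfg H; have [x hx mx] := covered_mis e_sym e_irr ph Rf (St_y_covered Sf cfg_uy).
case: (colsP Cs hx) => E; rewrite E in mx => //.
- by case/negP: (St_y_a Sf ha hb mva mub cfg_uy).
- by case/negP: (St_y_b Sf hb mub cfg_uy).
by case: (misF _ mx (y := u)); rewrite colC.
Qed.

Lemma cfg_ud : ~~ mis f u d.
Proof.
open_cfg H; apply/negP => m; by case/negP: (St_y_b Sf hd m cfg_uy); apply: cfg_y.
Qed.

Lemma cfg_ua : ~~ mis f u a.
Proof. open_cfg H; apply/negP => m; exact (St_disj Sf ha m mva). Qed.

Lemma cfg_vd : ~~ mis f v d.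
Proof.
open_cfg H; apply/negP => m; by case/negP: (St_y_a Sf hd hb m mub cfg_uy); apply: cfg_y.
Qed.

Lemma cfg_vb : ~~ mis f v b.
Proof. open_cfg H; apply/negP => m; exact (St_disj Sf hb mub m). Qed.

Lemma cfg_ab : connect (kr f a b) u v.
Proof. open_cfg H; exact: St_linked Sf ha hb mva mub. Qed.

Lemma cfg_nuv : u != v. Proof. by open_cfg H; apply: St_nuv Sf. Qed.
Lemma cfg_nuv' : u != v'. Proof. by open_cfg H; apply: St_nu Sf. Qed.
Lemma cfg_nvv' : v != v'. Proof. by open_cfg H; apply: St_nv Sf. Qed.
Lemma cfg_nuy : u != y. Proof. open_cfg H; exact (reach_neq e_sym e_irr Rf c0 uy). Qed.
Lemma cfg_nvy : v != y.
Proof. by open_cfg H; rewrite eq_sym; apply: mis_neq cfg_y cfg_vd. Qed.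

(** Otherwise a swap at [y] makes it miss [a] and leaves [v] alone, against [St_y_a]. *)
Lemma cfg_ad : connect (kr f a d) v y.
Proof.
open_cfg H; apply/negPn/negP => nc'.
have nyv : ~~ connect (kr f a d) y v by rewrite kr_connect_sym.
have [g Sg swg] := St_swap y Sf ha hd.
have mva' : mis g v a by rewrite (sw_mis_out swg).
have mub' : mis g u b by rewrite (sw_mis_other swg).
have uy' : col g u y = col g v v' by rewrite !(sw_keep swg nca ncd _) //.
case/negP: (St_y_a Sg ha hb mva' mub' uy').
exact: sw_mis_start' swg cfg_y.
Qed.

Lemma cfg_bd : connect (kr f b d) u y.
Proof.
open_cfg H; apply/negPn/negP => nc'.
have nyu : ~~ connect (kr f b d) y u by rewrite kr_connect_sym.
have [g Sg swg] := St_swap y Sf hb hd.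
have mub' : mis g u b by rewrite (sw_mis_out swg).
have uy' : col g u y = col g v v' by rewrite !(sw_keep swg ncb ncd _) //.
case/negP: (St_y_b Sg hb mub' uy').
exact: sw_mis_start' swg cfg_y.
Qed.

Lemma cfg_out g a' b' s : sw f g a' b' s -> St g v u v' ->
  ~~ connect (kr f a' b') s v -> ~~ connect (kr f a' b') s u -> cfg g v u v' y a b c d.
Proof.
open_cfg H => swg Sg nv nu; split=> //; rewrite ?(sw_mis_out swg) //.
by rewrite !(sw_out swg).
Qed.

(** Recoloring [u]-[z] with [b] would free [d] at [u], and [y] still misses [d], against
    [St_y_b]. *)
Lemma cfg_z_b z : col f u z = d -> ~~ mis f z b.
Proof.
open_cfg H => uz; apply/negP => mz.
have hd1 : 1 < d by case/andP: hd.
have [g Sg Eg] := St_recolor Sf hb hd1 uz mub mz.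
have nyz : y != z := mis_neq cfg_y (col_mis (etrans (colC _ _ _) uz)).
have uy' : col g u y = col g v v'.
  rewrite !Eg edgN2 1?(eq_sym y u) ?cfg_nuy //.
  by rewrite edgN0 1?(eq_sym v u) 1?(eq_sym v' u) ?cfg_nuv ?cfg_nuv' // uy.
have mud : mis g u d.
  apply/forallP => s; rewrite Eg; case: ifP => // /negbT n; apply/eqP => E.
  by case/negP: n; rewrite (reach_inj e_sym e_irr Rf d0 E uz) edg1.
case/negP: (St_y_b Sg hd mud uy'); apply/forallP => s; rewrite Eg ifN; last first.
  by rewrite /edg (negbTE nyz) (eq_sym y) (negbTE cfg_nuy).
exact: (forallP cfg_y).
Qed.

Lemma cfg_p_b p : col f u p = a -> ~~ mis f p b.
Proof.
open_cfg H => up; apply/negP => mp.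
have ha1 : 1 < a by case/andP: ha.
have [g Sg Eg] := St_recolor Sf hb ha1 up mub mp.
apply: (St_disj Sg ha).
  apply/forallP => s; rewrite Eg; case: ifP => // /negbT n; apply/eqP => E.
  by case/negP: n; rewrite (reach_inj e_sym e_irr Rf a0 E up) edg1.
apply/forallP => s; rewrite Eg ifN; first exact: (forallP mva).
rewrite /edg (eq_sym v) (negbTE cfg_nuv) /= negb_and.
by rewrite (mis_neq mva (col_mis (etrans (colC _ _ _) up))).
Qed.

Lemma cfg_q_a q : col f v q = b -> ~~ mis f q a.
Proof.
open_cfg H => vq; apply/negP => mq.
have hb1 : 1 < b by case/andP: hb.
have [g Sg Eg] := St_recolor Sf ha hb1 vq mva mq.
apply: (St_disj Sg hb); last first.
  apply/forallP => s; rewrite Eg; case: ifP => // /negbT n; apply/eqP => E.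
  by case/negP: n; rewrite (reach_inj e_sym e_irr Rf b0 E vq) edg1.
apply/forallP => s; rewrite Eg ifN; first exact: (forallP mub).
rewrite /edg (negbTE cfg_nuv) /= negb_and.
by rewrite (mis_neq mub (col_mis (etrans (colC _ _ _) vq))).
Qed.

Lemma cfg_x_a x : col f v x = d -> ~~ mis f x a.
Proof.
open_cfg H => vx; apply/negP => mx.
have hd1 : 1 < d by case/andP: hd.
have [g Sg Eg] := St_recolor Sf ha hd1 vx mva mx.
have nyx : y != x := mis_neq cfg_y (col_mis (etrans (colC _ _ _) vx)).
have nv'x : v' != x := col_neq ncd vv' vx.
have nux : u != x by rewrite eq_sym; apply: col_neq nd vx (St_vu Sf).
have uy' : col g u y = col g v v'.
  rewrite !Eg edgN1 ?cfg_nuv // edgN2 1?(eq_sym v' v) ?cfg_nvv' //; by rewrite uy.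
have mvd : mis g v d.
  apply/forallP => s; rewrite Eg; case: ifP => // /negbT n; apply/eqP => E.
  by case/negP: n; rewrite (reach_inj e_sym e_irr Rf d0 E vx) edg1.
have mub' : mis g u b.
  apply/forallP => s; rewrite Eg ifN; first exact: (forallP mub).
  by rewrite /edg (negbTE cfg_nuv) (negbTE nux).
case/negP: (St_y_a Sg hd hb mvd mub' uy'); apply/forallP => s; rewrite Eg ifN; last first.
  by rewrite /edg (negbTE nyx) (eq_sym y) (negbTE cfg_nvy).
exact: (forallP cfg_y).
Qed.

(* A vertex other than u and v that misses b can be made to miss a instead,
   and conversely, since u and v are the ends of an (a,b)-chain. *)
Lemma cfg_flip_ab s : s != u -> s != v -> mis f s a || mis f s b ->
  exists g, [/\ cfg g v u v' y a b c d, sw f g a b s,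
    forall w, connect (kr f a b) u w -> ~~ connect (kr f a b) s w &
    (mis f s a -> mis g s b) /\ (mis f s b -> mis g s a)].
Proof.
open_cfg H => nsu nsv ms_; have [g Sg swg] := St_swap s Sf ha hb.
have out w : connect (kr f a b) u w -> ~~ connect (kr f a b) s w.
  apply: (not_linked Rf a0 b0 _ _ ms_ cfg_nuv _ _ cfg_ab); rewrite ?mub ?mva ?orbT //;
  by rewrite eq_sym.
exists g; split => //; first by apply: cfg_out swg Sg _ _; apply: out; rewrite ?connect0 ?cfg_ab.
by split; [apply: sw_mis_start swg|apply: sw_mis_start' swg].
Qed.

Lemma out_ad s : s != v -> s != y -> mis f s a || mis f s d ->
  forall w, connect (kr f a d) v w -> ~~ connect (kr f a d) s w.
Proof.
open_cfg H => nsv nsy ms_.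
apply: (not_linked Rf a0 d0 _ _ ms_ cfg_nvy _ _ cfg_ad); rewrite ?mva ?cfg_y ?orbT //;
by rewrite eq_sym.
Qed.

Lemma out_bd s : s != u -> s != y -> mis f s b || mis f s d ->
  forall w, connect (kr f b d) u w -> ~~ connect (kr f b d) s w.
Proof.
open_cfg H => nsv nsy ms_.
apply: (not_linked Rf b0 d0 _ _ ms_ cfg_nuy _ _ cfg_bd); rewrite ?mub ?cfg_y ?orbT //;
by rewrite eq_sym.
Qed.

(** As [v] misses [a], it is one end of its chain, which leaves room for a single other one. *)
Lemma ac_end s1 s2 : s1 != v -> s2 != v -> mis f s1 c -> mis f s2 c ->
  connect (kr f a c) v s1 -> connect (kr f a c) v s2 -> s1 = s2.
Proof.
open_cfg H => n1 n2 m1 m2 c1 c2; apply/eqP/negPn/negP => n12.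
have [pf _] := Rf.
apply: (three_ends e_sym e_irr pf a0 c0 (x := v) (y := s1) (z := s2)) => //;
  rewrite ?mva ?m1 ?m2 ?orbT //; by rewrite eq_sym.
Qed.

End Cfg.

Section Flips.
Variables (f : coloring T) (v u v' y : T) (a b c d : nat).
Hypothesis H : cfg f v u v' y a b c d.

Lemma cfg_flip_ad s : s != v -> s != y -> mis f s a || mis f s d ->
  exists g, [/\ cfg g v u v' y a b c d, sw f g a d s,
    forall w, connect (kr f a d) v w -> ~~ connect (kr f a d) s w &
    (mis f s a -> mis g s d) /\ (mis f s d -> mis g s a)].
Proof.
move=> nsv nsy ms_; have out := out_ad H nsv nsy ms_; open_cfg H.
have [g Sg swg] := St_swap s Sf ha hd; exists g; split => //.
  split=> //; [|by rewrite (sw_mis_other swg)|by rewrite !(sw_keep swg nca ncd _)].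
  by rewrite (sw_mis_out swg) ?out ?connect0.
by split; [apply: sw_mis_start swg|apply: sw_mis_start' swg].
Qed.

Lemma cfg_flip_bd s : s != u -> s != y -> mis f s b || mis f s d ->
  exists g, [/\ cfg g v u v' y a b c d, sw f g b d s,
    forall w, connect (kr f b d) u w -> ~~ connect (kr f b d) s w &
    (mis f s b -> mis g s d) /\ (mis f s d -> mis g s b)].
Proof.
move=> nsv nsy ms_; have out := out_bd H nsv nsy ms_; open_cfg H.
have [g Sg swg] := St_swap s Sf hb hd; exists g; split => //.
  split=> //; [by rewrite (sw_mis_other swg)| |by rewrite !(sw_keep swg ncb ncd _)].
  by rewrite (sw_mis_out swg) ?out ?connect0.
by split; [apply: sw_mis_start swg|apply: sw_mis_start' swg].
Qed.

(** The neighbor of [u] along [c] may change in this swap, so a new [y'] is taken from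
    [St_sees_c]. *)
Lemma cfg_flip_ac s : ~~ connect (kr f a c) v s -> mis f s c ->
  exists g y', [/\ cfg g v u v' y' a b c d, sw f g a c s & mis g s a].
Proof.
rewrite kr_connect_sym => ns ms_; open_cfg H.
have [g Sg swg] := St_swap s Sf ha hc.
have /misPn[y' uy'] := St_sees_c Sg.
have vv2 : col g v v' = c by rewrite (sw_out swg).
exists g, y'; split=> //; last exact: sw_mis_start' swg ms_.
by split; rewrite ?uy' ?vv2 //; [rewrite (sw_mis_out swg)|rewrite (sw_mis_other swg)].
Qed.

Lemma cfg_z_a z : col f u z = d -> ~~ mis f z a.
Proof.
open_cfg H => uz; apply/negP => mz.
have nzu : z != u by rewrite eq_sym (reach_neq e_sym e_irr Rf d0 uz).
have nzv : z != v := col_neq nd uz (St_uv Sf).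
have [|g [Hg swg _ [/(_ mz) mzb _]]] := cfg_flip_ab H nzu nzv; first by rewrite mz.
by case/negP: (cfg_z_b Hg (sw_keep swg nda ndb uz)).
Qed.
End Flips.

Section Neighbors.
Variables (f : coloring T) (v u v' y : T) (a b c d : nat).
Hypothesis H : cfg f v u v' y a b c d.

(** A swap of [a] and [d] at [p] would turn [p] into a neighbor of [u] along [d] that misses [a],
    against [cfg_z_a]. *)
Lemma cfg_p_d p : col f u p = a -> ~~ mis f p d.
Proof.
open_cfg H => up; apply/negP => mp.
have npv : p != v := col_neq na up (St_uv Sf).
have npy : p != y := col_neq nac up uy.
have [|g [Hg swg _ [_ /(_ mp) mpa]]] := cfg_flip_ad H npv npy; first by rewrite mp orbT.
have gup : col g u p = d.
  by rewrite (sw_in swg) ?up ?swapL //; apply: connect1; apply: kr_l; rewrite colC.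
by case/negP: (cfg_z_a Hg gup).
Qed.

(** Otherwise a swap at [p] gives [u]-[p] the color [c]; then [p] takes the place of [y] but misses
    [a], against [St_y_a]. *)
Lemma cfg_p_c p : col f u p = a -> mis f p c -> connect (kr f a c) v p.
Proof.
open_cfg H => up mp; apply/negPn/negP; rewrite kr_connect_sym => npv.
have [g Sg swg] := St_swap p Sf ha hc.
have mva' : mis g v a by rewrite (sw_mis_out swg).
have mub' : mis g u b by rewrite (sw_mis_other swg).
have gup : col g u p = col g v v'.
  rewrite (sw_in swg) ?up ?swapL ?(sw_out swg) //.
  by apply: connect1; apply: kr_l; rewrite colC.
by case/negP: (St_y_a Sg ha hb mva' mub' gup); apply: sw_mis_start' swg mp.
Qed.

Lemma cfg_z_c z : col f u z = d -> mis f z c -> connect (kr f a c) v z.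
Proof.
move=> uz mz; apply/negPn/negP => nvz.
have [g [y' [Hg swg mza]]] := cfg_flip_ac H nvz mz; open_cfg H.
by case/negP: (cfg_z_a Hg (sw_keep swg nda ndc uz)).
Qed.

Lemma cfg_x_b x : col f v x = d -> ~~ mis f x b.
Proof.
open_cfg H => vx; apply/negP => mx.
have nxv : x != v by rewrite eq_sym (reach_neq e_sym e_irr Rf d0 vx).
have nxu : x != u := col_neq nd vx (St_vu Sf).
have [|g [Hg swg _ [_ /(_ mx) mxa]]] := cfg_flip_ab H nxu nxv; first by rewrite mx orbT.
by case/negP: (cfg_x_a Hg (sw_keep swg nda ndb vx)).
Qed.

Lemma cfg_x_c x : col f v x = d -> mis f x c -> connect (kr f a c) v x.
Proof.
move=> vx mx; apply/negPn/negP => nvx.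
have [g [y' [Hg swg mxa]]] := cfg_flip_ac H nvx mx; open_cfg H.
by case/negP: (cfg_x_a Hg (sw_keep swg nda ndc vx)).
Qed.

Lemma cfg_q_d q : col f v q = b -> mis f q d -> q = y.
Proof.
open_cfg H => vq mq; apply/eqP/negPn/negP => nqy.
have nqv : q != v by rewrite eq_sym (reach_neq e_sym e_irr Rf b0 vq).
have [|g [Hg swg _ [_ /(_ mq) mqa]]] := cfg_flip_ad H nqv nqy; first by rewrite mq orbT.
by case/negP: (cfg_q_a Hg (sw_keep swg nba nbd vq)).
Qed.

Lemma cfg_q_c q : col f v q = b -> mis f q c -> connect (kr f a c) v q.
Proof.
move=> vq mq; apply/negPn/negP => nvq.
have [g [y' [Hg swg mqa]]] := cfg_flip_ac H nvq mq; open_cfg H.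
by case/negP: (cfg_q_a Hg (sw_keep swg nba nbc vq)).
Qed.

Lemma cfg_nwk_v' s : wk f s -> s != v' -> forall r, 0 < col f s r -> r != v' ->
  exists2 n, mis f r n & [\/ n = a, n = b, n = c | n = d].
Proof.
open_cfg H => ws nsv' r sr nrv'.
have [n hn mn] := covered_mis e_sym e_irr ph Rf (St_weak_nbr Sf ws nsv' sr nrv').
by exists n => //; apply: colsP Cs hn.
Qed.
End Neighbors.

(** * The neighbor z of u along d is weak *)

Section CaseA.
Variables (f : coloring T) (v u v' y : T) (a b c d : nat).
Hypothesis H : cfg f v u v' y a b c d.
Variables (z r : T).
Hypotheses (uz : col f u z = d) (wz : wk f z) (nzv' : z != v') (zr : col f z r = c).

Let mz1 : mis f z 1. Proof. by case/andP: wz. Qed.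

(** Otherwise a swap at [u] gives [u]-[z] the color [c]; then [z] takes the place of [y] and has to
    be covered, which a weak vertex is not. *)
Lemma caseA_cd : connect (kr f c d) u v.
Proof.
open_cfg H; apply/negPn/negP => nuv; have [g Sg swg] := St_swap u Sf hc hd.
have guz : col g u z = col g v v' by rewrite (sw_in swg) ?connect0 ?(sw_out swg) ?uz ?vv' ?swapR.
case/negP: (St_y_covered Sg guz); by rewrite (sw_mis_other swg) // eq_sym.
Qed.

(** Otherwise a swap at [u] gives [u]-[z] the color [a], and [St_p_uncovered] identifies the
    uncovered vertex [z] with [v']. *)
Lemma caseA_ad : connect (kr f a d) v u.
Proof.
open_cfg H; rewrite kr_connect_sym; apply/negPn/negP => nuv; have [g Sg swg] := St_swap u Sf ha hd.
have guz : col g u z = a by rewrite (sw_in swg) ?connect0 ?uz ?swapR.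
have mva' : mis g v a by rewrite (sw_mis_out swg).
have E := St_p_uncovered Sg ha mva' guz; case/eqP: nzv'; apply: E.
by rewrite (sw_mis_other swg) // eq_sym.
Qed.

Lemma caseA_neq : [/\ r != u, r != v, r != y & z != v].
Proof.
open_cfg H; have rz : col f r z = c by rewrite colC.
have zv : z != v := col_neq nd uz (St_uv Sf).
split=> //.
- by apply: contraNneq ncd => E; rewrite E uz in rz; rewrite rz.
- by apply: contraNneq nzv' => E; rewrite E in rz; rewrite (reach_inj e_sym e_irr Rf c0 rz vv').
apply: contraNneq (cfg_nuy H) => E; rewrite -E; rewrite E in rz.
have zu : z = u by apply: (reach_inj e_sym e_irr Rf c0 rz); rewrite colC.
by have := reach_neq e_sym e_irr Rf d0 uz; rewrite zu eqxx.
Qed.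

(** The chain of [u] in [c] and [d] is then [y]-[u]-[z]-[r], with both ends missing [d]. It avoids
    [v], against [caseA_cd]. *)
Lemma caseA_d : mis f r d -> False.
Proof.
move=> mr; have my := cfg_y H; have cuv := caseA_cd; have [nru nrv nry nzv] := caseA_neq.
have nuv := cfg_nuv H; have nvy := cfg_nvy H; open_cfg H.
have: pred4 y u z r v.
  apply: closed_connect_mem cuv; last by rewrite /= eqxx orbT.
  move=> s s' /or4P[]/eqP-> /orP[]/eqP E /=.
  - by rewrite (reach_inj e_sym e_irr Rf c0 E (etrans (colC _ _ _) uy)) eqxx orbT.
  - by case: (misF E my).
  - by rewrite (reach_inj e_sym e_irr Rf c0 E uy) eqxx.
  - by rewrite (reach_inj e_sym e_irr Rf d0 E uz) eqxx !orbT.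
  - by rewrite (reach_inj e_sym e_irr Rf c0 E zr) eqxx !orbT.
  - by rewrite (reach_inj e_sym e_irr Rf d0 E (etrans (colC _ _ _) uz)) eqxx orbT.
  - by rewrite (reach_inj e_sym e_irr Rf c0 E (etrans (colC _ _ _) zr)) eqxx !orbT.
  by case: (misF E mr).
by rewrite /= (negbTE nvy) (eq_sym v u) (negbTE nuv) (eq_sym v z) (negbTE nzv) (eq_sym v r) (negbTE nrv).
Qed.
End CaseA.

(** The neighbor [r] of [z] along [c] is covered by [St_weak_nbr], so it misses a color above 1. A
    missing [b] is flipped to [a], a missing [a] to [d], and [caseA_d] excludes [d]. *)
Lemma caseA f v u v' y a b c d z : cfg f v u v' y a b c d ->
  col f u z = d -> wk f z -> z = v'.
Proof.
move=> H uz wz; apply/eqP/negPn/negP => nzv'; open_cfg H.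
have [mz1 _] := andP wz.
have /misPn[r zr] : ~~ mis f z c by apply: (wkP e_sym e_irr ph z Rf wz).
have step_a g : cfg g v u v' y a b c d -> col g u z = d -> wk g z -> col g z r = c ->
    mis g r a -> False.
  move=> Hg guz gwz gzr mr; have [nru nrv nry nzv] := caseA_neq Hg guz nzv' gzr.
  have cvu := caseA_ad Hg guz gwz nzv'.
  have [|g' [Hg' swg out [/(_ mr) mr' _]]] := cfg_flip_ad Hg nrv nry; first by rewrite mr.
  apply: (caseA_d Hg' (z := z) (r := r)) => //.
  - by rewrite (sw_out swg) ?out.
  - by rewrite (sw_wk _ _ _ swg).
  by apply: sw_keep swg nca ncd gzr.
have [nru nrv nry nzv] := caseA_neq H uz nzv' zr.
have nrv' : r != v'.
  apply: contraNneq nzv => E; rewrite E colC in zr.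
  by rewrite (reach_inj e_sym e_irr Rf c0 zr (etrans (colC _ _ _) vv')).
have zr0 : 0 < col f z r by rewrite zr.
have [n mr [] En] := cfg_nwk_v' H wz nzv' zr0 nrv'; rewrite En in mr.
- exact: step_a mr.
- have [|g [Hg swg _ [_ /(_ mr) mr']]] := cfg_flip_ab H nru nrv; first by rewrite mr orbT.
  apply: step_a mr' => //; rewrite ?(sw_wk _ _ _ swg) //; by apply: sw_keep swg _ _ _.
- by case: (misF _ mr (y := z)); rewrite colC.
exact (caseA_d H uz wz nzv' zr mr).
Qed.

(** Above 1, [p] and [z] can miss only [c], and a vertex that does is the second end of the ([a],
    [c])-chain of [v]. So one of the two is weak, and a weak one must be [v']. *)
Lemma cfg_dichotomy f v u v' y a b c d p z : cfg f v u v' y a b c d ->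
  col f u p = a -> col f u z = d -> wk f v' /\ (p = v' \/ z = v').
Proof.
move=> H up uz; open_cfg H.
have pu : col f p u = a by rewrite colC.
have zu : col f z u = d by rewrite colC.
case: (boolP (mis f p c)) => [mp|sp].
  have wz : wk f z.
    apply: (cfg_wk H); rewrite ?(cfg_z_a H uz) ?(cfg_z_b H uz) ?(col_mis zu) //.
    apply/negP => mz; case/eqP: (col_neq nad up uz).
    have npv := col_neq na up (St_uv Sf); have nzv := col_neq nd uz (St_uv Sf).
    exact (ac_end H npv nzv mp mz (cfg_p_c H up mp) (cfg_z_c H uz mz)).
  by have E := caseA H uz wz; rewrite -{1}E; split=> //; right.
have wp : wk f p.
  by apply: (cfg_wk H); rewrite ?(cfg_p_b H up) ?(cfg_p_d H up) ?(col_mis pu).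
have [mp1 _] := andP wp.
by have E := St_p_uncovered Sf ha mva up mp1; rewrite -{1}E; split=> //; left.
Qed.

(** Above 1, [x] can miss only [c]. As [z] is not [v'], it is not weak and misses [c]. If [x] did so
    too, both would be the second end of the ([a], [c])-chain of [v], hence equal, with two edges of
    color [d]. *)
Lemma caseN_x f v u v' y a b c d : cfg f v u v' y a b c d -> col f u v' = a ->
  exists x, [/\ col f v x = d, wk f x & x != v'].
Proof.
move=> H uv'; have /misPn[x vx] := cfg_vd H; have /misPn[z uz] := cfg_ud H; open_cfg H.
have xv : col f x v = d by rewrite colC.
have zu : col f z u = d by rewrite colC.
exists x; split=> //; last exact: col_neq ndc vx vv'.
apply: (cfg_wk H); rewrite ?(cfg_x_a H vx) ?(cfg_x_b H vx) ?(col_mis xv) //.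
apply/negP => mx.
have mz : mis f z c.
  apply/negPn/negP => sz; have := col_neq nda uz uv'; rewrite (caseA H uz) ?eqxx //.
  by apply: (cfg_wk H); rewrite ?(cfg_z_a H uz) ?(cfg_z_b H uz) ?(col_mis zu).
have nxv : x != v by rewrite eq_sym (reach_neq e_sym e_irr Rf d0 vx).
have nzv := col_neq nd uz (St_uv Sf).
have E : x = z := ac_end H nxv nzv mx mz (cfg_x_c H vx mx) (cfg_z_c H uz mz).
case/eqP: (cfg_nuv H); rewrite E in xv; exact (reach_inj e_sym e_irr Rf d0 zu xv).
Qed.

(* Moving the edge of color 1 from u-v to u-v' exchanges the roles of v and v'. *)
Lemma caseN f v u v' y a b c d : cfg f v u v' y a b c d -> col f u v' = a -> wk f v' -> False.
Proof.
move=> H uv' wv'; have [x [vx wx nxv']] := caseN_x H uv'.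
have nuv := cfg_nuv H; have nuv' := cfg_nuv' H; have nvv' := cfg_nvv' H; open_cfg H.
have [ha' _ _] := rng_gt ha; have vu := St_vu Sf.
have v'u : col f v' u = a by rewrite colC.
have [g Rg Eg] := rotate2 e_sym e_irr Rf (isT : 1 <= 1 <= t) ha' vu uv' mva (St_mis Sf).
have Kg : keeps f g.
  move=> s r hs fs; rewrite Eg; case: ifP => [E|_]; last by case: ifP.
  by case: (St_hvu Sf); rewrite -(edg_col h E).
have g_out s r : s != u -> s != v -> s != v' -> col g s r = col f s r.
  move=> nu nv nv'; by rewrite Eg !edgN1.
have g_c s r n : n != a -> n != 1 -> (col g s r == n) = (col f s r == n).
  move=> ca c1; rewrite Eg; case: ifP => [E|_].
    by rewrite (edg_col f E) vu [a == n]eq_sym (negbTE ca) [1 == n]eq_sym (negbTE c1).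
  case: ifP => // E.
  by rewrite (edg_col f E) uv' [1 == n]eq_sym (negbTE c1) [a == n]eq_sym (negbTE ca).
have gvu : col g v u = a by rewrite Eg edg1.
have guv' : col g u v' = 1.
  rewrite Eg edgN0 ?edg1 //; by rewrite eq_sym.
have mgv : mis g v 1.
  apply/forallP => r; rewrite Eg; case: ifP => [_|/negbT n]; first by rewrite na.
  rewrite edgN1 ?(eq_sym v u) //; apply/eqP => E.
  by case/negP: n; rewrite (reach_inj e_sym e_irr Rf (ltn0Sn 0) E vu) edg1.
have wg s : wk g s -> [&& s != u, s != v' & (s == v) || wk f s].
  move=> ws; have [m1 ds] := andP ws.
  case: (eqVneq s u) => [E|nsu] /=; first by case: (misF guv'); rewrite -E.
  case: (eqVneq s v') => [E|nsv'] /=.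
    by case: (misF (_ : col g v' u = 1)); rewrite ?(colC g v') // -E.
  case: (eqVneq s v) => //= nsv; rewrite /weak_at ds andbT.
  by apply/forallP => r; rewrite -g_out //; apply: (forallP m1).
have Gg : good g = G by apply: (keeps_goodG Rg (St_good Sf) Kg).
have rg : ready g v' u v.
  by split; rewrite // colC (St_h Sf).
(* [v'] is weak no longer, and [v] is the only vertex that may have become weak. *)
have Wg : weak g = mu.
  apply/eqP; rewrite eqn_leq (weak_min Rg Gg rg) andbT.
  case: Sf => _ _ <- _; rewrite /num_weak (cardsD1 v' [set x | wk f x]) inE wv'.
  apply: leq_trans (_ : #|v |: ([set x | wk f x] :\ v')| <= _).
    by apply/subset_leq_card/subsetP => s; rewrite !inE => /wg/and3P[_ -> ->].
  by rewrite cardsU1 leq_add2r leq_b1.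
have Sg : St g v' u v by [].
have Hg : cfg g v' u v y a b c d.
  split=> //.
  - apply/forallP => r; rewrite Eg; case: ifP => [E|_].
      case/orP: E => /andP[/eqP E _]; first by rewrite E eqxx in nvv'.
      by rewrite E eqxx in nuv'.
    case: ifP => [_|/negbT n]; first by rewrite eq_sym.
    by apply/eqP => E; case/negP: n; rewrite (reach_inj e_sym e_irr Rf a0 E v'u) edg2.
  - by apply/forallP => r; rewrite g_c //; apply: (forallP mub).
  by split; apply/eqP; rewrite g_c // ?uy // colC vv'.
(* By symmetry the neighbor [x'] of [v'] along [d] is weak as well as [x], which [St_weak_pair]
   forbids. *)
have [x' [gvx' wx' nx'v]] := caseN_x Hg (etrans (colC _ _ _) gvu).
have [nx'u nx'v' wx''] := and3P (wg _ wx'); rewrite (negbTE nx'v) /= in wx''.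
have vx' : col f v' x' = d by apply/eqP; rewrite -g_c ?gvx'.
apply: (St_weak_pair Sf wx nxv' _ wx''); first by rewrite vx'.
apply: contraNneq nvv' => E; rewrite -E in vx'.
apply/eqP; apply: (reach_inj e_sym e_irr Rf d0 (x := x)); by rewrite colC.
Qed.

(** * The neighbor of u along d is v' *)

Section CaseZ.
Variables (f : coloring T) (v u v' y : T) (a b c d : nat).
Hypotheses (H : cfg f v u v' y a b c d) (uv' : col f u v' = d) (wv' : wk f v').

(** Otherwise a swap at [u] gives [u]-[v'] the color [a], which [caseN] excludes. *)
Lemma caseZ_ad : connect (kr f a d) v u.
Proof.
open_cfg H; rewrite kr_connect_sym; apply/negPn/negP => nuv; have [g Sg swg] := St_swap u Sf ha hd.
have guv' : col g u v' = a by rewrite (sw_in swg) ?connect0 ?uv' ?swapR.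
have Hg : cfg g v u v' y a b c d.
  split=> //; [by rewrite (sw_mis_out swg)|by rewrite (sw_mis_other swg)|].
  by rewrite !(sw_keep swg nca ncd _).
by apply: (caseN Hg guv'); rewrite (sw_wk _ _ _ swg).
Qed.

Lemma caseZ_p p : col f u p = a -> mis f p c.
Proof.
move=> up; open_cfg H; have pu : col f p u = a by rewrite colC.
apply/negPn/negP => sp; have wp : wk f p.
  by apply: (cfg_wk H); rewrite ?(cfg_p_b H up) ?(cfg_p_d H up) ?(col_mis pu).
have [mp1 _] := andP wp; have E := St_p_uncovered Sf ha mva up mp1.
by case/eqP: nad; rewrite -up -uv' E.
Qed.

(* Swapping c and d at y exchanges the roles of c and d. *)
Lemma caseZ_cd p : col f u p = a -> connect (kr f c d) y p.
Proof.
move=> up; open_cfg H; have mp := caseZ_p up.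
apply/negPn/negP => nyp; have [g Sg swg] := St_swap y Sf hc hd.
have cu : connect (kr f c d) y u by apply: connect1; apply: kr_l; rewrite colC.
have cv' : connect (kr f c d) y v' by apply: cnr cu uv'.
have cv : connect (kr f c d) y v by apply: cnl cv' _; rewrite colC.
have Hg : cfg g v u v' y a b d c.
  split=> //; [by rewrite (sw_mis_other swg)|by rewrite (sw_mis_other swg)|].
  by rewrite !(sw_in swg) // vv' uy swapL.
case/negP: (cfg_p_d Hg (sw_keep swg nac nad up)).
by rewrite (sw_mis_out swg).
Qed.

Lemma caseZ_neq p : col f u p = a -> [/\ p != u, p != v, p != y & p != v'].
Proof.
open_cfg H => up; split.
- by rewrite eq_sym (reach_neq e_sym e_irr Rf a0 up).
- exact: col_neq na up (St_uv Sf).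
- exact: col_neq nac up uy.
exact: col_neq nad up uv'.
Qed.

(** The chain of [y] in [c] and [d] is then [y]-[u]-[v']-[v]-[x]-[r]. It avoids [p], against
    [caseZ_cd]. *)
Lemma caseZ_xd x r : col f v x = d -> wk f x -> col f x r = c -> mis f r d -> False.
Proof.
move=> vx wx xr mr; have /misPn[p up] := cfg_ua H.
have cyp := caseZ_cd up; have mp := caseZ_p up; have my := cfg_y H.
have [npu npv npy npv'] := caseZ_neq up; open_cfg H.
have rx : col f r x = c by rewrite colC.
have npx : p != x := mis_neq mp (col_mis xr).
have npr : p != r := mis_neq mp (col_mis rx).
have: p \in [:: y; u; v'; v; x; r].
  apply: (closed_connect_mem (S := [pred s | s \in [:: y; u; v'; v; x; r]])) cyp; last by rewrite !inE eqxx.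
  have uyC : col f y u = c by rewrite colC.
  have vvC : col f v' v = c by rewrite colC.
  have uvC : col f v' u = d by rewrite colC.
  have vxC : col f x v = d by rewrite colC.
  move=> s s' /=; rewrite !inE; do 5?[case/orP]; move/eqP=> -> /orP[]/eqP E;
    do 1?[by case: (misF E my)]; do 1?[by case: (misF E mr)].
  - by rewrite (reach_inj e_sym e_irr Rf c0 E uyC) eqxx !orbT.
  - by rewrite (reach_inj e_sym e_irr Rf c0 E uy) eqxx.
  - by rewrite (reach_inj e_sym e_irr Rf d0 E uv') eqxx !orbT.
  - by rewrite (reach_inj e_sym e_irr Rf c0 E vvC) eqxx !orbT.
  - by rewrite (reach_inj e_sym e_irr Rf d0 E uvC) eqxx !orbT.
  - by rewrite (reach_inj e_sym e_irr Rf c0 E vv') eqxx !orbT.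
  - by rewrite (reach_inj e_sym e_irr Rf d0 E vx) eqxx !orbT.
  - by rewrite (reach_inj e_sym e_irr Rf c0 E xr) eqxx !orbT.
  - by rewrite (reach_inj e_sym e_irr Rf d0 E vxC) eqxx !orbT.
  by rewrite (reach_inj e_sym e_irr Rf c0 E rx) eqxx !orbT.
by rewrite !inE (negbTE npu) (negbTE npv) (negbTE npy) (negbTE npv') (negbTE npx) (negbTE npr).
Qed.
End CaseZ.

Lemma caseZ_xa f v u v' y a b c d x r : cfg f v u v' y a b c d -> col f u v' = d -> wk f v' ->
  col f v x = d -> wk f x -> col f x r = c -> mis f r a -> False.
Proof.
move=> H uv' wv' vx wx xr mr; have cvu := caseZ_ad H uv' wv'; open_cfg H.
have rx : col f r x = c by rewrite colC.
have nrv : r != v by apply: contraNneq ncd => E; rewrite -rx E vx.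
have nry : r != y.
  apply: contraNneq nd => E; rewrite -vx -(St_vu Sf); apply/eqP; congr (col f v _).
  by apply: (reach_inj e_sym e_irr Rf c0 rx); rewrite E colC.
have [|g [Hg swg out [/(_ mr) mr' _]]] := cfg_flip_ad H nrv nry; first by rewrite mr.
apply: (caseZ_xd Hg _ (x := x) (r := r)) => //.
- by rewrite (sw_out swg) ?out.
- by rewrite (sw_out swg) ?out ?connect0.
- by rewrite (sw_wk _ _ _ swg).
exact: sw_keep swg nca ncd xr.
Qed.

(** If the neighbor [x] of [v] along [d] misses [c], then [x] and [p] are both the second end of the
    ([a], [c])-chain of [v]. If not, [x] is weak, and any color missing at its neighbor along [c]
    gives a contradiction. *)
Lemma caseZ_x f v u v' y a b c d p : cfg f v u v' y a b c d -> col f u v' = d -> wk f v' ->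
  col f u p = a -> col f v p = d.
Proof.
move=> H uv' wv' up; have /misPn[x vx] := cfg_vd H; open_cfg H.
have xv : col f x v = d by rewrite colC.
case: (boolP (mis f x c)) => mx.
  have mp := caseZ_p H uv' up; have [npu npv npy npv'] := caseZ_neq H uv' up.
  have nxv : x != v by rewrite eq_sym (reach_neq e_sym e_irr Rf d0 vx).
  by rewrite -(ac_end H nxv npv mx mp (cfg_x_c H vx mx) (cfg_p_c H up mp)).
exfalso; have wx : wk f x.
  by apply: (cfg_wk H); rewrite ?(cfg_x_a H vx) ?(cfg_x_b H vx) ?(col_mis xv).
have nxv' : x != v' := col_neq ndc vx vv'.
have [r xr] := misPn _ _ _ mx; have rx : col f r x = c by rewrite colC.
have nxv : x != v by rewrite eq_sym (reach_neq e_sym e_irr Rf d0 vx).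
have nrv' : r != v'.
  apply: contraNneq nxv => E; rewrite E in rx.
  by rewrite (reach_inj e_sym e_irr Rf c0 rx (etrans (colC _ _ _) vv')).
have nrv : r != v by apply: contraNneq ncd => E; rewrite -rx E vx.
have nru : r != u.
  apply/eqP => E; rewrite E in rx; have Ey := reach_inj e_sym e_irr Rf c0 rx uy.
  by rewrite Ey in xv; case: (misF xv (cfg_y H)).
have xr0 : 0 < col f x r by rewrite xr.
have [n mr [] En] := cfg_nwk_v' H wx nxv' xr0 nrv'; rewrite En in mr.
- exact (caseZ_xa H uv' wv' vx wx xr mr).
- have [|g [Hg swg _ [_ /(_ mr) mr']]] := cfg_flip_ab H nru nrv; first by rewrite mr orbT.
  apply: (caseZ_xa Hg _ _ _ _ _ mr' (x := x)); rewrite ?(sw_wk _ _ _ swg) //; by apply: sw_keep swg _ _ _.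
- by case: (misF rx).
exact (caseZ_xd H uv' vx wx xr mr).
Qed.

Section CaseZq.
Variables (f : coloring T) (v u v' y : T) (a b c d : nat).
Hypotheses (H : cfg f v u v' y a b c d) (uv' : col f u v' = d) (wv' : wk f v').
Variables (p : T).
Hypothesis up : col f u p = a.

(** Otherwise a swap at [v] gives [v]-[v'] the color [b], which [u] misses, against [St_sees_c]. *)
Lemma caseZ_bc : connect (kr f b c) u v.
Proof.
open_cfg H; apply/negPn/negP; rewrite kr_connect_sym => nuv; have [g Sg swg] := St_swap v Sf hb hc.
case/negP: (St_sees_c Sg); rewrite (sw_in swg) ?connect0 // vv' swapR.
by rewrite (sw_mis_out swg).
Qed.

Lemma caseZ_bcp : connect (kr f b c) u p.
Proof.
have cuv := caseZ_bc; have mp := caseZ_p H uv' up.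
open_cfg H; apply/negPn/negP; rewrite kr_connect_sym => npu; have [g Sg swg] := St_swap p Sf hb hc.
have npv : ~~ connect (kr f b c) p v.
  by apply: contra npu => c1; apply: connect_trans c1 _; rewrite kr_connect_sym.
have Hg : cfg g v u v' y a b c d.
  split=> //; [by rewrite (sw_mis_other swg)|by rewrite (sw_mis_out swg)|].
  by rewrite !(sw_out swg).
case/negP: (cfg_p_b Hg (sw_keep swg nab nac up)); exact: sw_mis_start' swg mp.
Qed.

(** This and the next three lemmas rest on the two known ends of a chain: [u] and [p] for the colors
    [b], [c]; [v] and [p] for [a], [c]; [v] and [y] for [a], [d]; [u] and [y] for [b], [d]. *)
Lemma bc_ends r : p != r -> u != r -> connect (kr f b c) u r -> mis f r b || mis f r c -> False.
Proof.
move=> npr nur cr mr; have cp := caseZ_bcp; have mp := caseZ_p H uv' up.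
have [npu npv npy npv'] := caseZ_neq H uv' up; open_cfg H; have [pf _] := Rf.
apply: (three_ends e_sym e_irr pf b0 c0 _ _ mr _ nur npr cp cr); rewrite ?mub ?mp ?orbT //.
by rewrite eq_sym.
Qed.

Lemma ac_ends r : p != r -> v != r -> connect (kr f a c) v r -> mis f r a || mis f r c -> False.
Proof.
move=> npr nvr cr mr; have mp := caseZ_p H uv' up; have cp := cfg_p_c H up mp.
have [npu npv npy npv'] := caseZ_neq H uv' up; open_cfg H; have [pf _] := Rf.
apply: (three_ends e_sym e_irr pf a0 c0 _ _ mr _ nvr npr cp cr); rewrite ?mva ?mp ?orbT //.
by rewrite eq_sym.
Qed.

Lemma ad_ends r : y != r -> v != r -> connect (kr f a d) v r -> mis f r a || mis f r d -> False.
Proof.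
move=> nyr nvr cr mr; have my := cfg_y H; have cy := cfg_ad H; have nvy := cfg_nvy H.
open_cfg H; have [pf _] := Rf.
by apply: (three_ends e_sym e_irr pf a0 d0 _ _ mr _ nvr nyr cy cr); rewrite ?mva ?my ?orbT.
Qed.

Lemma bd_ends r : y != r -> u != r -> connect (kr f b d) u r -> mis f r b || mis f r d -> False.
Proof.
move=> nyr nvr cr mr; have my := cfg_y H; have cy := cfg_bd H; have nuy := cfg_nuy H.
open_cfg H; have [pf _] := Rf.
by apply: (three_ends e_sym e_irr pf b0 d0 _ _ mr _ nvr nyr cy cr); rewrite ?mub ?my ?orbT.
Qed.
End CaseZq.

Lemma caseZ_q_neq f v u v' y a b c d q r : cfg f v u v' y a b c d ->
  col f v q = b -> q != y -> col f q r = c -> [/\ r != u, r != v & r != y].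
Proof.
move=> H vq nqy qr; open_cfg H; have rq : col f r q = c by rewrite colC.
split.
- apply: contraNneq nqy => E; rewrite E in rq; apply/eqP; exact (reach_inj e_sym e_irr Rf c0 rq uy).
- by apply: contraNneq nbc => E; rewrite -vq -rq E.
apply: contraNneq nb => E; rewrite -vq -(St_vu Sf); apply/eqP; congr (col f v _).
by apply: (reach_inj e_sym e_irr Rf c0 rq); rewrite E colC.
Qed.

Lemma caseZ_qb f v u v' y a b c d q r : cfg f v u v' y a b c d ->
  col f u v' = d -> col f v q = b -> q != y -> col f q r = c -> mis f r b -> False.
Proof.
move=> H uv' vq nqy qr mr; have [nru nrv nry] := caseZ_q_neq H vq nqy qr.
have /misPn[p up] := cfg_ua H; have mp := caseZ_p H uv' up; have cuv := caseZ_bc H.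
have rq : col f r q = c by rewrite colC.
have nur : u != r by rewrite eq_sym.
apply: (bc_ends H uv' up (mis_neq mp (col_mis rq)) nur); rewrite ?mr //.
exact (cnr (cnl cuv vq) qr).
Qed.

Lemma caseZ_qa f v u v' y a b c d q r : cfg f v u v' y a b c d ->
  col f u v' = d -> col f v q = b -> q != y -> col f q r = c -> mis f r a -> False.
Proof.
move=> H uv' vq nqy qr mr; have [nru nrv nry] := caseZ_q_neq H vq nqy qr.
have [|g [Hg swg out [/(_ mr) mr' _]]] := cfg_flip_ab H nru nrv; first by rewrite mr.
have cuv := cfg_ab H; open_cfg H.
apply: (caseZ_qb Hg _ _ nqy _ mr'); [exact: sw_keep swg _ _ _| |exact: sw_keep swg _ _ _].
by rewrite (sw_out swg) ?out.
Qed.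

Lemma caseZ_qd f v u v' y a b c d q r : cfg f v u v' y a b c d ->
  col f u v' = d -> wk f v' -> col f v q = b -> q != y -> col f q r = c -> mis f r d -> False.
Proof.
move=> H uv' wv' vq nqy qr mr; have [nru nrv nry] := caseZ_q_neq H vq nqy qr.
have [|g [Hg swg out [_ /(_ mr) mr']]] := cfg_flip_ad H nrv nry; first by rewrite mr orbT.
have cvu := caseZ_ad H uv' wv'; open_cfg H.
apply: (caseZ_qa Hg _ _ nqy _ mr'); [|exact: sw_keep swg _ _ _|exact: sw_keep swg _ _ _].
by rewrite (sw_out swg) ?out.
Qed.

(** If [q] is not [y], it cannot miss [c] either, since it would be [p], which is joined to [v] by
    [d]. So [q] is weak, and a color missing at its neighbor along [c] can be moved to [b], which
    gives a third end of the ([b], [c])-chain of [u]. *)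
Lemma caseZ_y f v u v' y a b c d : cfg f v u v' y a b c d -> col f u v' = d -> wk f v' ->
  col f v y = b.
Proof.
move=> H uv' wv'; have /misPn[q vq] := cfg_vb H; have /misPn[p up] := cfg_ua H.
case: (eqVneq q y) => [<- //|nqy]; exfalso; open_cfg H.
have qv : col f q v = b by rewrite colC.
have mp := caseZ_p H uv' up; have [npu npv npy npv'] := caseZ_neq H uv' up.
have nqv : q != v by rewrite eq_sym (reach_neq e_sym e_irr Rf b0 vq).
have sq : ~~ mis f q c.
  apply/negP => mq; have E := ac_end H nqv npv mq mp (cfg_q_c H vq mq) (cfg_p_c H up mp).
  by case/eqP: nbd; rewrite -vq E (caseZ_x H uv' wv' up).
have wq : wk f q.
  apply: (cfg_wk H); rewrite ?(cfg_q_a H vq) ?(col_mis qv) //.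
  by apply: contra nqy => mq; rewrite (cfg_q_d H vq mq).
have [r qr] := misPn _ _ _ sq; have rq : col f r q = c by rewrite colC.
have nqv' : q != v' := col_neq nbc vq vv'.
have nrv' : r != v'.
  apply: contraNneq nqv => E; rewrite E in rq.
  by rewrite (reach_inj e_sym e_irr Rf c0 rq (etrans (colC _ _ _) vv')).
have qr0 : 0 < col f q r by rewrite qr.
have [n mr [] En] := cfg_nwk_v' H wq nqv' qr0 nrv'; rewrite En in mr.
- exact (caseZ_qa H uv' vq nqy qr mr).
- exact (caseZ_qb H uv' vq nqy qr mr).
- by case: (misF rq).
exact (caseZ_qd H uv' wv' vq nqy qr mr).
Qed.

(** * The neighbors s and w of v' along a and b *)

Section LastEdges.
Variables (f : coloring T) (v u v' y : T) (a b c d : nat).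
Hypotheses (H : cfg f v u v' y a b c d) (uv' : col f u v' = d) (wv' : wk f v').
Variables (p s w : T).
Hypotheses (up : col f u p = a) (v's : col f v' s = a) (v'w : col f v' w = b).

Lemma last_neq : [/\ v != s, u != s, p != s & s != v'] /\
  [/\ v != w, u != w, y != w & w != v'] /\ s != w.
Proof.
have vy := caseZ_y H uv' wv'; have nvv' := cfg_nvv' H; have nuv' := cfg_nuv' H.
open_cfg H; have v'v : col f v' v = c by rewrite colC.
have v'u : col f v' u = d by rewrite colC.
have yv : col f y v = b by rewrite colC.
have pu : col f p u = a by rewrite colC.
split; last split; last by apply: col_neq nab v's v'w.
  split; [exact: col_neq nca v'v v's|exact: col_neq nda v'u v's| |].
    apply: contraNneq nuv' => E; rewrite E in pu.
    by rewrite (reach_inj e_sym e_irr Rf a0 pu (etrans (colC _ _ _) v's)).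
  by rewrite eq_sym (reach_neq e_sym e_irr Rf a0 v's).
split; [exact: col_neq ncb v'v v'w|exact: col_neq ndb v'u v'w| |].
  apply: contraNneq nvv' => E; rewrite E in yv.
  by rewrite (reach_inj e_sym e_irr Rf b0 yv (etrans (colC _ _ _) v'w)).
by rewrite eq_sym (reach_neq e_sym e_irr Rf b0 v'w).
Qed.

(** The ([a], [d])-chain of [v] runs through [u] and [v'] to [s], which would be a third end. The
    next three lemmas use other chains through [v'] in the same way. *)
Lemma last_sd : y != s -> ~~ mis f s d.
Proof.
move=> nys; have [[nvs nus nps nsv'] _] := last_neq; apply/negP => m.
apply: (ad_ends H nys nvs); last by rewrite m orbT.
exact (cnl (cnr (caseZ_ad H uv' wv') uv') v's).
Qed.

Lemma last_sc : ~~ mis f s c.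
Proof.
have [[nvs nus nps nsv'] _] := last_neq; open_cfg H; apply/negP => m.
apply: (ac_ends H uv' up nps nvs); last by rewrite m orbT.
apply: cnl v's; apply: connect1; exact: kr_r vv'.
Qed.

Lemma last_wd : ~~ mis f w d.
Proof.
have [_ [[nvs nus nyw nsv'] _]] := last_neq; apply/negP => m.
apply: (bd_ends H nyw nus); last by rewrite m orbT.
apply: cnl v'w; apply: connect1; exact: kr_r uv'.
Qed.

Lemma last_wc : p != w -> ~~ mis f w c.
Proof.
have [_ [[nvs nus nyw nsv'] _]] := last_neq; open_cfg H => npw; apply/negP => m.
apply: (bc_ends H uv' up npw nus); last by rewrite m orbT.
exact (cnl (cnr (caseZ_bc H) vv') v'w).
Qed.
End LastEdges.

Section LastEdges2.
Variables (f : coloring T) (v u v' y : T) (a b c d : nat).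
Hypotheses (H : cfg f v u v' y a b c d) (uv' : col f u v' = d) (wv' : wk f v').
Variables (p s w : T).
Hypotheses (up : col f u p = a) (v's : col f v' s = a) (v'w : col f v' w = b).

Lemma last_s : y != s -> wk f s.
Proof.
move=> nys; have [[nvs nus nps nsv'] _] := last_neq H uv' wv' up v's v'w.
open_cfg H; have sv' : col f s v' = a by rewrite colC.
apply: (cfg_wk H); rewrite ?(col_mis sv') ?(last_sc H uv' wv' up v's v'w) ?(last_sd H uv' wv' up v's v'w) //.
apply/negP => ms_; have nsu : s != u by rewrite eq_sym.
have nsy : s != y by rewrite eq_sym.
have [|g [Hg swg out [/(_ ms_) ms' _]]] := cfg_flip_bd H nsu nsy; first by rewrite ms_.
have /misPn[p' up'] := cfg_ua Hg.
have guv' : col g u v' = d by rewrite (sw_out swg) ?out ?connect0.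
have gwv' : wk g v' by rewrite (sw_wk _ _ _ swg).
have gv's := sw_keep swg nab nad v's.
have gv'w : col g v' w = b.
  rewrite (sw_out swg) // out //; apply: connect1; exact: kr_r uv'.
by case/negP: (last_sd Hg guv' gwv' up' gv's gv'w nys).
Qed.

Lemma last_w : p != w -> wk f w.
Proof.
move=> npw; have [_ [[nvs nus nyw nsv'] _]] := last_neq H uv' wv' up v's v'w.
open_cfg H; have wv2 : col f w v' = b by rewrite colC.
apply: (cfg_wk H); rewrite ?(col_mis wv2) ?(last_wc H uv' wv' up v's v'w) ?(last_wd H uv' wv' up v's v'w) //.
apply/negP => ms_; have nwv : w != v by rewrite eq_sym.
have nwy : w != y by rewrite eq_sym.
have [|g [Hg swg out [/(_ ms_) ms' _]]] := cfg_flip_ad H nwv nwy; first by rewrite ms_.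
have cvu := caseZ_ad H uv' wv'; have cvv' := cnr cvu uv'.
have gup : col g u p = a by rewrite (sw_out swg) ?out.
have guv' : col g u v' = d by rewrite (sw_out swg) ?out.
have gwv' : wk g v' by rewrite (sw_wk _ _ _ swg).
have gv's : col g v' s = a by rewrite (sw_out swg) ?out.
have gv'w := sw_keep swg nba nbd v'w.
by case/negP: (last_wd Hg guv' gwv' gup gv's gv'w).
Qed.

(** Otherwise [s] and [w] are two weak neighbors of [v'], against [St_weak_pair]. *)
Lemma last_pair : y = s \/ p = w.
Proof.
case: (eqVneq y s) => [|nys]; first by left.
case: (eqVneq p w) => [|npw]; first by right.
have [[_ _ _ nsv'] [_ nsw]] := last_neq H uv' wv' up v's v'w; open_cfg H; exfalso.
by apply: (St_weak_pair Sf (last_s nys) nsv' _ (last_w npw)); rewrite ?v'w.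
Qed.

Lemma last_nbr x r : x = s \/ x = w -> col f x r = c -> [/\ r != v & r != v'].
Proof.
have [[nvs nus nps nsv'] [[nvw nuw nyw nwv'] _]] := last_neq H uv' wv' up v's v'w.
open_cfg H => xs xr; have rx : col f r x = c by rewrite colC.
have [nvx nv'x] : v != x /\ v' != x by case: xs => ->; split=> //; rewrite eq_sym.
split.
- apply: contraNneq nv'x => E; rewrite E in rx.
  by rewrite (reach_inj e_sym e_irr Rf c0 rx vv').
apply: contraNneq nvx => E; rewrite E in rx.
by rewrite (reach_inj e_sym e_irr Rf c0 rx (etrans (colC _ _ _) vv')).
Qed.

Lemma last_nbr_u x r : y != x -> col f x r = c -> r != u.
Proof.
open_cfg H => nyx xr; apply: contraNneq nyx => E; rewrite E colC in xr.
by rewrite (reach_inj e_sym e_irr Rf c0 xr uy).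
Qed.

Lemma last_nbr_y x r : u != x -> col f x r = c -> r != y.
Proof.
open_cfg H => nux xr; apply: contraNneq nux => E; rewrite E colC in xr.
by rewrite (reach_inj e_sym e_irr Rf c0 xr (etrans (colC _ _ _) uy)).
Qed.

Lemma last_sr_a r : col f s r = c -> mis f r a -> False.
Proof.
move=> sr mr; have mp := caseZ_p H uv' up; have [nrv _] := last_nbr (or_introl erefl) sr.
open_cfg H; have rs : col f r s = c by rewrite colC.
have npr : p != r := mis_neq mp (col_mis rs).
have nvr : v != r by rewrite eq_sym.
apply: (ac_ends H uv' up npr nvr); rewrite ?mr //.
apply: cnr sr; apply: cnl v's; apply: connect1; exact: kr_r vv'.
Qed.

Lemma last_wr_b r : y != w -> col f w r = c -> mis f r b -> False.
Proof.
move=> nyw wr mr; have mp := caseZ_p H uv' up.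
have nru := last_nbr_u nyw wr.
open_cfg H; have rw : col f r w = c by rewrite colC.
have npr : p != r := mis_neq mp (col_mis rw).
have nur : u != r by rewrite eq_sym.
apply: (bc_ends H uv' up npr nur); rewrite ?mr //.
exact (cnr (cnl (cnr (caseZ_bc H) vv') v'w) wr).
Qed.
End LastEdges2.

Section LastEdges3.
Variables (f : coloring T) (v u v' y : T) (a b c d : nat).
Hypotheses (H : cfg f v u v' y a b c d) (uv' : col f u v' = d) (wv' : wk f v').
Variables (p s w : T).
Hypotheses (up : col f u p = a) (v's : col f v' s = a) (v'w : col f v' w = b).

(** With [p = w] the vertex [v'] lies on the ([a], [b])-chain of [u], so flipping [r] from [b] to
    [a] leaves the edges at [v'] unchanged. *)
Lemma last_sr_b r : p = w -> y != s -> col f s r = c -> mis f r b -> False.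
Proof.
move=> Ew nys sr mr; have [nrv nrv'] := last_nbr H uv' wv' up v's v'w (or_introl erefl) sr.
have nru := last_nbr_u H nys sr.
have [|g [Hg swg out [_ /(_ mr) mr']]] := cfg_flip_ab H nru nrv; first by rewrite mr orbT.
open_cfg H.
have cuv' : connect (kr f a b) u v'.
  apply: (@cnr _ _ _ _ _ p); first by apply: connect1; apply: kr_l.
  by rewrite colC Ew.
apply: (last_sr_a Hg (p := p) (s := s) (w := w) _ _ _ _ _ _ mr').
- exact: sw_keep swg nda ndb uv'.
- by rewrite (sw_wk _ _ _ swg).
- by rewrite (sw_out swg) ?out ?connect0.
- by rewrite (sw_out swg) ?out.
- by rewrite (sw_out swg) ?out.
exact: sw_keep swg nca ncb sr.
Qed.

Lemma last_sr_d r : p = w -> y != s -> col f s r = c -> mis f r d -> False.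
Proof.
move=> Ew nys sr mr; have [nrv nrv'] := last_nbr H uv' wv' up v's v'w (or_introl erefl) sr.
have [[nvs nus nps nsv'] _] := last_neq H uv' wv' up v's v'w.
have nry := last_nbr_y H nus sr.
have [|g [Hg swg out [_ /(_ mr) mr']]] := cfg_flip_ad H nrv nry; first by rewrite mr orbT.
have cvu := caseZ_ad H uv' wv'; have cvv' := cnr cvu uv'; open_cfg H.
apply: (last_sr_a Hg (p := p) (s := s) (w := w) _ _ _ _ _ _ mr').
- by rewrite (sw_out swg) ?out.
- by rewrite (sw_wk _ _ _ swg).
- by rewrite (sw_out swg) ?out.
- by rewrite (sw_out swg) ?out.
- exact: sw_keep swg nba nbd v'w.
exact: sw_keep swg nca ncd sr.
Qed.

Lemma last_wr_a r : y = s -> p != w -> col f w r = c -> mis f r a -> False.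
Proof.
move=> Es npw wr mr; have [nrv nrv'] := last_nbr H uv' wv' up v's v'w (or_intror erefl) wr.
have [_ [[nvw nuw nyw nwv'] _]] := last_neq H uv' wv' up v's v'w.
have nru := last_nbr_u H nyw wr; have vy := caseZ_y H uv' wv'.
have [|g [Hg swg out [/(_ mr) mr' _]]] := cfg_flip_ab H nru nrv; first by rewrite mr.
have cuv := cfg_ab H.
have cuv' : connect (kr f a b) u v' by apply: cnl (cnr cuv vy) _; rewrite colC Es.
open_cfg H.
apply: (last_wr_b Hg (p := p) (w := w) _ _ _ _ _ mr') => //.
- exact: sw_keep swg nda ndb uv'.
- by rewrite (sw_out swg) ?out ?connect0.
- by rewrite (sw_out swg) ?out.
exact: sw_keep swg nca ncb wr.
Qed.

Lemma last_wr_d r : y = s -> p != w -> col f w r = c -> mis f r d -> False.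
Proof.
move=> Es npw wr mr; have [nrv nrv'] := last_nbr H uv' wv' up v's v'w (or_intror erefl) wr.
have [_ [[nvw nuw nyw nwv'] _]] := last_neq H uv' wv' up v's v'w.
have nru := last_nbr_u H nyw wr; have nry := last_nbr_y H nuw wr.
have [|g [Hg swg out [_ /(_ mr) mr']]] := cfg_flip_bd H nru nry; first by rewrite mr orbT.
open_cfg H.
have cuv' : connect (kr f b d) u v' by apply: connect1; apply: kr_r.
apply: (last_wr_b Hg (p := p) (w := w) _ _ _ _ _ mr') => //.
- by rewrite (sw_out swg) ?out ?connect0.
- exact: sw_keep swg nab nad up.
- by rewrite (sw_out swg) ?out ?connect0.
exact: sw_keep swg ncb ncd wr.
Qed.

Lemma last_y : y = s.
Proof.
apply/eqP/negPn/negP => nys; have ws := last_s H uv' wv' up v's v'w nys.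
have [E|Ew] := last_pair H uv' wv' up v's v'w; first by rewrite E eqxx in nys.
have [[nvs nus nps nsv'] _] := last_neq H uv' wv' up v's v'w; open_cfg H.
have /misPn[r sr] : ~~ mis f s c by apply: (wkP e_sym e_irr ph s Rf ws).
have [nrv nrv'] := last_nbr H uv' wv' up v's v'w (or_introl erefl) sr.
have sr0 : 0 < col f s r by rewrite sr.
have [n mr [] En] := cfg_nwk_v' H ws nsv' sr0 nrv'; rewrite En in mr.
- exact (last_sr_a H uv' wv' up v's v'w sr mr).
- exact (last_sr_b Ew nys sr mr).
- by case: (misF _ mr (y := s)); rewrite colC.
exact (last_sr_d Ew nys sr mr).
Qed.

Lemma last_p : p = w.
Proof.
have Es := last_y; apply/eqP/negPn/negP => npw; have ww := last_w H uv' wv' up v's v'w npw.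
have [_ [[nvw nuw nyw nwv'] _]] := last_neq H uv' wv' up v's v'w; open_cfg H.
have /misPn[r wr] : ~~ mis f w c by apply: (wkP e_sym e_irr ph w Rf ww).
have [nrv nrv'] := last_nbr H uv' wv' up v's v'w (or_intror erefl) wr.
have wr0 : 0 < col f w r by rewrite wr.
have [n mr [] En] := cfg_nwk_v' H ww nwv' wr0 nrv'; rewrite En in mr.
- exact (last_wr_a Es npw wr mr).
- exact (last_wr_b H uv' up v'w nyw wr mr).
- by case: (misF _ mr (y := w)); rewrite colC.
exact (last_wr_d Es npw wr mr).
Qed.
End LastEdges3.

(** A color [q] that is not on the triangle occurs at each of its three corners on an edge to one of
    two vertices, hence twice at one of these. *)
Lemma triangle_colors (i j l uy up vy vp wy wp : nat) :
  all (mem (iota 1 4)) [:: i; j; uy; up] -> all (mem (iota 1 4)) [:: i; l; vy; vp] ->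
  all (mem (iota 1 4)) [:: j; l; wy; wp] ->
  uniq [:: i; j; uy; up] -> uniq [:: i; l; vy; vp] -> uniq [:: j; l; wy; wp] ->
  uniq [:: uy; vy; wy] -> uniq [:: up; vp; wp] -> False.
Proof.
move=> /allP Iu /allP Iv /allP Iw Uu Uv Uw Uy Up.
have [q q4 nq] : exists2 q, q \in iota 1 4 & q \notin [:: i; j; l].
  apply/hasP/negPn/negP => /hasPn n.
  have /(_ (iota_uniq 1 4)) := @uniq_leq_size _ (iota 1 4) [:: i; j; l]; rewrite size_iota => /(_ _)/negP.
  by apply=> // q /n /negPn.
have [_ Eu] := uniq_min_size Uu Iu (leqnn 4).
have [_ Ev] := uniq_min_size Uv Iv (leqnn 4).
have [_ Ew] := uniq_min_size Uw Iw (leqnn 4).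
have := Ew q; have := Ev q; have := Eu q; move: nq Uy Up; rewrite q4 /= !inE !negb_or !andbT.
case/and3P=> /negbTE-> /negbTE-> /negbTE-> /andP[/andP[uvy uwy] vwy] /andP[/andP[uvp uwp] vwp] /=.
by move=> /orP[]/eqP Eq1 /orP[]/eqP Eq2 /orP[]/eqP Eq3;
  rewrite -?Eq1 -?Eq2 -?Eq3 eqxx in uvy uwy vwy uvp uwp vwp.
Qed.

(* Each of the four colors of h would be seen by all three of u, v, w, hence be
   on an edge of the triangle u, v, w. *)
Lemma no_K5_minus_edge u v w y p : uniq [:: u; v; w; y; p] ->
  e u v -> e u w -> e v w -> e u y -> e u p -> e v y -> e v p -> e w y -> e w p -> False.
Proof.
move=> U euv euw evw euy eup evy evp ewy ewp.
have c0 := col_edge e_sym e_irr ph; have cl := col_le ph.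
have rng x z : e x z -> 0 < col h x z < 5 by rewrite -c0 => ->; rewrite -k4 ltnS cl.
have star x l : uniq l -> all (e x) l -> uniq [seq col h x z | z <- l].
  move=> Ul /allP el; rewrite map_inj_in_uniq // => z z' /el; rewrite -c0 => xz _ E.
  exact (col_inj e_sym e_irr ph xz erefl (esym E)).
have evu : e v u by rewrite e_sym.
have ewu : e w u by rewrite e_sym.
have ewv : e w v by rewrite e_sym.
have eyu : e y u by rewrite e_sym.
have epu : e p u by rewrite e_sym.
have eyv : e y v by rewrite e_sym.
have epv : e p v by rewrite e_sym.
have eyw : e y w by rewrite e_sym.
have epw : e p w by rewrite e_sym.
have all4 x l : all (e x) l -> all (mem (iota 1 4)) [seq col h x z | z <- l].
  by move=> /allP el; apply/allP => q /mapP[z /el/rng zq ->]; rewrite -[mem _ _]/(_ \in _) mem_iota.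
have Eu : all (e u) [:: v; w; y; p] by rewrite /= euv euw euy eup.
have Ev : all (e v) [:: u; w; y; p] by rewrite /= evu evw evy evp.
have Ew : all (e w) [:: u; v; y; p] by rewrite /= ewu ewv ewy ewp.
have Ey : all (e y) [:: u; v; w] by rewrite /= eyu eyv eyw.
have Ep : all (e p) [:: u; v; w] by rewrite /= epu epv epw.
move: U; rewrite /= !inE !negb_or -!andbA.
case/and5P=> nuv nuw nuy nup /and5P[nvw nvy nvp nwy /and3P[nwp nyp _]].
have Uu : uniq [:: v; w; y; p] by rewrite /= !inE !negb_or nvw nvy nvp nwy nwp nyp.
have Uv : uniq [:: u; w; y; p] by rewrite /= !inE !negb_or nuw nuy nup nwy nwp nyp.
have Uw : uniq [:: u; v; y; p] by rewrite /= !inE !negb_or nuv nuy nup nvy nvp nyp.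
have U3 : uniq [:: u; v; w] by rewrite /= !inE !negb_or nuv nuw nvw.
have [Au Av Aw] := And3 (all4 _ _ Eu) (all4 _ _ Ev) (all4 _ _ Ew).
have [Su Sv Sw] := And3 (star _ _ Uu Eu) (star _ _ Uv Ev) (star _ _ Uw Ew).
have [Sy Sp] := conj (star _ _ U3 Ey) (star _ _ U3 Ep).
rewrite /= (colC h v u) in Av Sv; rewrite /= (colC h w u) (colC h w v) in Aw Sw.
rewrite /= !(colC h y) in Sy; rewrite /= !(colC h p) in Sp.
exact (triangle_colors Au Av Aw Su Sv Sw Sy Sp).
Qed.

Lemma caseZ f v u v' y a b c d : cfg f v u v' y a b c d -> col f u v' = d -> wk f v' -> False.
Proof.
move=> H uv' wv'; have /misPn[p up] := cfg_ua H; open_cfg H.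
have /misPn[s v's] : ~~ mis f v' a by apply: (wkP e_sym e_irr ph v' Rf wv').
have /misPn[w v'w] : ~~ mis f v' b by apply: (wkP e_sym e_irr ph v' Rf wv').
have Es := last_y H uv' wv' up v's v'w; have Ew := last_p H uv' wv' up v's v'w.
subst s w; have vy := caseZ_y H uv' wv'; have vp := caseZ_x H uv' wv' up.
have [npu npv npy npv'] := caseZ_neq H uv' up.
have nv'y : v' != y := col_neq ndc uv' uy.
have [pf _] := Rf; have E := col_edge e_sym e_irr pf.
(* Only the pair [y], [p] need not be an edge. *)
apply: (@no_K5_minus_edge u v v' y p); rewrite -?E ?uv' ?vv' ?uy ?up ?vy ?vp ?v's ?v'w ?(St_uv Sf) //.
rewrite /= !inE !negb_or (cfg_nuv H) (cfg_nuv' H) (cfg_nuy H) (cfg_nvv' H) (cfg_nvy H) nv'y.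
by rewrite !(eq_sym _ p) npu npv npy npv'.
Qed.

Lemma St_cfg f v u v' : St f v u v' -> exists y a b c d, cfg f v u v' y a b c d.
Proof.
move=> Sf; have Rf := St_reach Sf.
have /misPn[y uy] := St_sees_c Sf.
have [a ha mva] : exists2 a, 1 < a <= t & mis f v a.
  apply: (covered_mis e_sym e_irr ph Rf); apply: col_mis (St_vu Sf).
have [b hb mub] : exists2 b, 1 < b <= t & mis f u b.
  apply: (covered_mis e_sym e_irr ph Rf); apply: col_mis (St_uv Sf).
have [d hd md] := covered_mis e_sym e_irr ph Rf (St_y_covered Sf uy).
have hc := St_vv'_gt Sf.
exists y, a, b, (col f v v'), d; split=> //; apply: mk_cols => //; rewrite /= !inE !negb_or andbT.
have nab : a != b by apply/eqP => E; rewrite E in mva; apply: (St_disj Sf hb).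
have nac : a != col f v v' by apply/eqP => E; rewrite E in mva; apply: (misF erefl mva).
have nad : a != d by apply/eqP => E; case/negP: (St_y_a Sf ha hb mva mub uy); rewrite E.
have nbc : b != col f v v' by apply/eqP => E; rewrite E in mub; case/negP: (St_sees_c Sf).
have nbd : b != d by apply/eqP => E; case/negP: (St_y_b Sf hb mub uy); rewrite E.
have ncd : col f v v' != d.
    by apply/eqP => E; case: (misF _ md (y := u)); rewrite colC uy.
by rewrite nab nac nad nbc nbd ncd.
Qed.

(** Four distinct colors lie between 2 and [k + 1]. *)
Lemma St_k4 f v u v' : St f v u v' -> 4 <= k.
Proof. by case/St_cfg=> y [a [b [c [d H]]]]; open_cfg H; clear k4; lia. Qed.

Lemma St_false5 f v u v' : St f v u v' -> False.
Proof.
case/St_cfg=> y [a [b [c [d H]]]].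
have /misPn[p up] := cfg_ua H; have /misPn[z uz] := cfg_ud H.
have [wv' [E|E]] := cfg_dichotomy H up uz.
  by apply: (caseN H _ wv'); rewrite -E.
by apply: (caseZ H _ wv'); rewrite -E.
Qed.

End FiveColors.

End Ready.
End Extremal.

(** * Multi-fans *)

Section Fan.
Variables (T : finType) (e : rel T).
Hypotheses (e_sym : symmetric e) (e_irr : irreflexive e).
Variables (k : nat) (f0 : coloring T).
Notation t := k.+1.
Notation reach := (reachable e k f0).
Implicit Types (f g : coloring T) (x y z s r v u w p q : T).

Section Recolored.
Variables (f g : coloring T) (w x : T) (c0 c : nat).
Hypotheses (Rf : reach f) (c00 : 0 < c0) (wx : col f w x = c0) (mw : mis f w c).
Hypothesis Eg : forall s r, col g s r = if edg w x s r then c else col f s r.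

Lemma rec_out s n : s != w -> s != x -> mis g s n = mis f s n.
Proof. by move=> nw nx; apply: eq_forallb => r; rewrite Eg edgN1. Qed.

Lemma rec_col s r n : n != c -> n != c0 -> (col g s r == n) = (col f s r == n).
Proof.
move=> nc n0; rewrite Eg; case: ifP => // E; rewrite (edg_col f E) wx.
by rewrite ![_ == n]eq_sym (negbTE nc) (negbTE n0).
Qed.

Lemma rec_other s n : n != c -> n != c0 -> mis g s n = mis f s n.
Proof. by move=> nc n0; apply: eq_forallb => r; rewrite rec_col. Qed.

Lemma rec_freed : mis g w c0 /\ mis g x c0.
Proof.
have nc : c != c0 by apply: contraTneq mw => ->; apply/misPn; exists x.
have xw : col f x w = c0 by rewrite colC.
split; apply/forallP => r; rewrite Eg; case: ifP => // /negbT n; apply/eqP => E; case/negP: n.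
  by rewrite (reach_inj e_sym e_irr Rf c00 E wx) edg1.
by rewrite (reach_inj e_sym e_irr Rf c00 E xw) edg2.
Qed.
End Recolored.

Section Palette.
Variable P : pred nat.
Hypothesis P_rng : forall c, P c -> 1 <= c <= t.

Definition keepP f g := reach g /\ forall s r n, ~~ P n -> (col g s r == n) = (col f s r == n).

(* Recoloring with the colors in P alone never frees a common one at u and v. *)
Definition stuck f u v := forall g c, keepP f g -> P c -> mis g u c -> mis g v c -> False.

Lemma keepP_refl f : reach f -> keepP f f. Proof. by []. Qed.

Lemma keepP_trans f g g' : keepP f g -> keepP g g' -> keepP f g'.
Proof. by move=> [_ E] [R E']; split=> // s r n Pn; rewrite E' ?E. Qed.

Lemma stuck_keep f g u v : keepP f g -> stuck f u v -> stuck g u v.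
Proof. by move=> K S g' c K'; apply: S; apply: keepP_trans K'. Qed.

Lemma stuck_sym f u v : stuck f u v -> stuck f v u.
Proof. by move=> S g c K Pc mu mv; apply: S K Pc mv mu. Qed.

Lemma keepP_mis f g x n : keepP f g -> ~~ P n -> mis g x n = mis f x n.
Proof. by move=> [_ E] Pn; apply: eq_forallb => r; rewrite E. Qed.

Lemma keepP_col f g x y n : keepP f g -> ~~ P n -> col f x y = n -> col g x y = n.
Proof. by move=> [_ E] Pn xy; apply/eqP; rewrite E // xy. Qed.

Lemma keepP_swap f a b x : reach f -> P a -> P b -> exists2 g, keepP f g & sw f g a b x.
Proof.
move=> Rf Pa Pb; have [g Rg swg] := reach_swap e_sym e_irr x Rf (P_rng Pa) (P_rng Pb).
exists g => //; split=> // s r n Pn; apply: (sw_other swg); by apply: contraNneq Pn => ->.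
Qed.

Lemma keepP_recolor f w x c0 c : reach f -> P c -> P c0 -> col f w x = c0 ->
  mis f w c -> mis f x c ->
  exists2 g, keepP f g & forall s r, col g s r = if edg w x s r then c else col f s r.
Proof.
move=> Rf Pc Pc0 wx mw mx; have [c00 _] := andP (P_rng Pc0).
have [g Rg Eg] := recolor e_sym e_irr Rf (P_rng Pc) c00 wx mw mx; exists g => //.
split=> // s r n Pn; rewrite Eg; case: ifP => // E; rewrite (edg_col f E) wx.
by case: (eqVneq c n) Pn => [<-|_]; rewrite ?Pc //; case: (eqVneq c0 n) => [<-|//]; rewrite Pc0.
Qed.

Section Center.
Variables (v u : T).

(* The vertices reachable from u form the multi-fan at v rooted at u. *)
Definition fr f : rel T := fun x x' => P (col f v x') && mis f x (col f v x').

Lemma fr_nv f x x' : fr f x x' -> x != v.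
Proof. by case/andP=> _; apply: contraTneq => ->; apply/misPn; exists x'. Qed.

(** Shift along the fan: if the last vertex [x] and [v] both miss [c], recoloring [v]-[x] with [c]
    frees its old color at [v]. The vertex before [x] misses that color too, and the path to it is
    shorter. *)
Lemma fan_path f (p : seq T) (c : nat) : reach f -> stuck f u v -> path (fr f) u p -> uniq (u :: p) ->
  P c -> mis f v c -> ~~ mis f (last u p) c.
Proof.
elim/last_ind: p f c => [|p x IH] f c Rf Sf pp up Pc mv; apply/negP.
  by move=> mu; exact (Sf f c (keepP_refl Rf) Pc mu mv).
rewrite last_rcons => mx; move: pp; rewrite rcons_path => /andP[pp flx].
case/andP: (flx) => Pn ml; set n := col f v x in Pn ml.
have [n0 _] := andP (P_rng Pn).
have [g Kg Eg] := keepP_recolor Rf Pc Pn (erefl n) mv mx; have [Rg _] := Kg.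
have [gv _] := rec_freed Rf n0 (erefl n) mv Eg.
move: up; rewrite -rcons_cons rcons_uniq => /andP[xp up].
have sub s s' : s != x -> s' != x -> fr f s s' -> fr g s s'.
  move=> nsx ns'x fs; have nsv := fr_nv fs; move: fs; rewrite /fr Eg ifN; last first.
    by rewrite /edg negb_or !negb_and ns'x orbT /= (eq_sym v x) (reach_neq e_sym e_irr Rf n0 (etrans (colC _ _ _) (erefl n))).
  by rewrite (rec_out Eg).
have pg : path (fr g) u p.
  apply: (sub_in_path (P := predC1 x)) pp; first by move=> s s' /=; apply: sub.
  by apply/allP => s sp /=; apply: contraNneq xp => <-.
have /negP := IH g n Rg (stuck_keep Kg Sf) pg up Pn gv; apply.
have nlx : last u p != x by apply: contraNneq xp => <-; apply: mem_last.
by rewrite (rec_out Eg) // (fr_nv flx).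
Qed.

Lemma fan1 f x c : reach f -> stuck f u v -> connect (fr f) u x ->
  P c -> mis f v c -> ~~ mis f x c.
Proof.
move=> Rf Sf /connectP[p0 pp0 ->] Pc mv; case: (shortenP pp0) => p pp up _.
exact: fan_path mv.
Qed.

(** Otherwise a swap at [x] makes [x] miss [al] and leaves the edges at [v] unchanged. Either the
    fan still reaches [x], or its first broken link starts at a vertex whose missing [c] became
    [al]; [fan1] excludes both. *)
Lemma fan_swap f al c x : reach f -> stuck f u v -> P al -> mis f v al -> P c ->
  connect (fr f) u x -> mis f x c -> connect (kr f al c) v x.
Proof.
move=> Rf Sf Pal mv Pc cx mx; apply/negPn/negP; rewrite kr_connect_sym => nxv.
have [g Kg swg] := keepP_swap x Rf Pal Pc; have [Rg _] := Kg.
have Sg := stuck_keep Kg Sf.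
have mgv : mis g v al by rewrite (sw_mis_out swg).
have mgx : mis g x al := sw_mis_start' swg mx.
have vE s : col g v s = col f v s by rewrite (sw_out swg).
suff: forall s, connect (fr f) s x -> connect (fr g) u s -> False.
  by apply; [exact: cx|exact: connect0].
move=> s /connectP[p]; elim: p s => [|s' p IH] s /=.
  by move=> _ <- cs; case/negP: (fan1 Rg Sg cs Pal mgv).
case/andP=> fs pp lp cs; case: (boolP (fr g s s')) => fgs.
  by apply: (IH s' pp lp); apply: connect_trans cs (connect1 fgs).
have [Pn mn] := andP fs; rewrite /fr vE Pn /= in fgs.
have sin : connect (kr f al c) x s.
  by apply: contraNT fgs => n; rewrite (sw_mis_out swg).
have nal : col f v s' != al by apply: contraTneq mv => E; apply/misPn; exists s'.
have Ec : col f v s' = c.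
  by apply/eqP; apply: contraNT fgs => n; rewrite (sw_mis_other swg).
rewrite Ec in mn; case/negP: (fan1 Rg Sg cs Pal mgv).
by rewrite -(swapR al c) (sw_mis_in swg).
Qed.

Lemma fan_nv f x : col f u v != 0 -> connect (fr f) u x -> reach f -> x != v.
Proof.
move=> uv /connectP[p pp ->] Rf; case/lastP: p pp => [|p s] /=.
  by move=> _; rewrite -lt0n in uv; exact (reach_neq e_sym e_irr Rf uv erefl).
rewrite last_rcons rcons_path => /andP[_ /andP[Ps _]]; have [P0 _] := andP (P_rng Ps).
by rewrite eq_sym; exact (reach_neq e_sym e_irr Rf P0 erefl).
Qed.

Lemma fan2 f al c x y : reach f -> stuck f u v -> col f u v != 0 -> P al -> mis f v al -> P c ->
  connect (fr f) u x -> connect (fr f) u y -> mis f x c -> mis f y c -> x = y.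
Proof.
move=> Rf Sf uv Pal mv Pc cx cy mx my; apply/eqP/negPn/negP => nxy.
have [a0 _] := andP (P_rng Pal); have [c0 _] := andP (P_rng Pc); have [pf _] := Rf.
have nxv := fan_nv uv cx Rf; have nyv := fan_nv uv cy Rf.
have lx := fan_swap Rf Sf Pal mv Pc cx mx; have ly := fan_swap Rf Sf Pal mv Pc cy my.
apply: (three_ends e_sym e_irr pf a0 c0 _ _ _ _ _ nxy lx ly);
  by rewrite ?mv ?mx ?my ?orbT 1?eq_sym.
Qed.

Definition mP f x := [set n : 'I_t.+1 | P n && mis f x n].

Lemma fan_count f al : reach f -> stuck f u v -> col f u v != 0 -> ~~ P (col f u v) ->
  P al -> mis f v al ->
  \sum_(x | connect (fr f) u x) #|mP f x| <= #|[set x | connect (fr f) u x] :\ u|.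
Proof.
move=> Rf Sf uv nPuv Pal mv.
pose D := [set q : T * 'I_t.+1 | connect (fr f) u q.1 && (q.2 \in mP f q.1)].
have -> : \sum_(x | connect (fr f) u x) #|mP f x| = #|D|.
  rewrite -sum1_card (eq_bigl (fun q : T * 'I_t.+1 => connect (fr f) u q.1 && (q.2 \in mP f q.1))).
    rewrite -(pair_big_dep _ (fun x n => n \in mP f x) (fun _ _ => 1)) /=.
    by apply: eq_bigr => x _; rewrite sum1_card.
  by move=> q; rewrite inE.
(* The default [u] does not occur on [D]: by [fan1], [v] sees every color of [P] missing in the
   fan. *)
pose nb (n : nat) := odflt u [pick x | col f v x == n].
have nbE (q : T * 'I_t.+1) : q \in D -> col f v (nb q.2) = q.2 :> nat.
  rewrite inE => /andP[cq]; rewrite inE => /andP[Pq mq].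
  have : ~~ mis f v q.2 by apply/negP => m; case/negP: (fan1 Rf Sf cq Pq m).
  case/misPn=> x vx; rewrite /nb; case: pickP => [z /eqP //|/(_ x)].
  by rewrite vx eqxx.
rewrite -(card_in_imset (f := fun q : T * 'I_t.+1 => nb q.2) (D := D)).
  apply/subset_leq_card/subsetP => _ /imsetP[q qD ->]; have E := nbE q qD.
  move: qD; rewrite inE => /andP[cq]; rewrite inE => /andP[Pq mq].
  rewrite !inE; apply/andP; split.
    by apply: contraNneq nPuv => Eu; rewrite colC -Eu E.
  by apply: connect_trans cq (connect1 _); rewrite /fr E Pq.
move=> q q' qD qD' E; have E1 := nbE q qD; rewrite E (nbE q' qD') in E1.
move: qD qD'; rewrite !inE -E1 => /andP[cq /andP[Pq mq]] /andP[cq' /andP[Pq' mq']].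
case: q q' E1 {E} cq Pq mq cq' Pq' mq' => [x n] [y m] /= Em cq Pq mq cq' Pq' mq'.
by rewrite (fan2 Rf Sf uv Pal mv Pq cq cq' mq mq') (val_inj Em).
Qed.
End Center.

Lemma fan_last v u f x : connect (fr v f) u x -> x = u \/ P (col f v x).
Proof.
case/connectP=> p pp ->; case/lastP: p pp => [|p s]; first by left.
by rewrite last_rcons rcons_path => /andP[_ /andP[Ps _]]; right.
Qed.
End Palette.

Lemma keepP_sub (P Q : pred nat) f g : (forall c, P c -> Q c) -> keepP P f g -> keepP Q f g.
Proof. by move=> sPQ [R E]; split=> // s r n nQ; apply: E; apply: contra nQ; apply: sPQ. Qed.

Variable h : coloring T.
Hypothesis ph : proper_coloring e k h.
Notation wk := (weak_at e k).

Definition P0 : pred nat := fun c => 1 < c <= t.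
Definition P1 a b : pred nat := fun c => [&& P0 c, c != a & c != b].

Lemma P0_rng c : P0 c -> 1 <= c <= t.
Proof. by case/andP=> c1 ct; rewrite (ltnW c1). Qed.

Lemma P1_P0 a b c : P1 a b c -> P0 c. Proof. by case/and3P. Qed.

Lemma P1_rng a b c : P1 a b c -> 1 <= c <= t. Proof. by move/P1_P0/P0_rng. Qed.

Definition vac f u v p a b :=
  [/\ reach f, stuck P0 f u v, P0 a /\ P0 b, mis f v a /\ mis f u b & col f u p = a].

Lemma vac_neq f u v p a b : vac f u v p a b -> [/\ a != b, u != p, v != p & u != v].
Proof.
case=> Rf Sf [Pa Pb] [mv mu] up; have [a0 _] := andP (P0_rng Pa).
have pu : col f p u = a by rewrite colC.
have nab : a != b by apply: contraTneq mu => <-; apply: col_mis up.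
split=> //; first exact (reach_neq e_sym e_irr Rf a0 up).
  exact: mis_neq mv (col_mis pu).
by apply: contraTneq mv => <-; apply: col_mis up.
Qed.

(* Otherwise u-p can be recolored with b, which frees a at u. *)
Lemma vac_b f u v p a b : vac f u v p a b -> ~~ mis f p b.
Proof.
move=> V; have [nab nup nvp nuv] := vac_neq V; case: V => Rf Sf [Pa Pb] [mv mu] up.
have [a0 _] := andP (P0_rng Pa); apply/negP => mp.
have [g Kg Eg] := keepP_recolor P0_rng Rf Pb Pa up mu mp.
have [mgu _] := rec_freed Rf a0 up mu Eg.
by apply: (Sf g a Kg Pa mgu); rewrite (rec_out Eg) // eq_sym.
Qed.

Lemma vac_keep f g u v p a b : vac f u v p a b -> keepP (P1 a b) f g -> vac g u v p a b.
Proof.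
move=> [Rf Sf [Pa Pb] [mv mu] up] K; have [Rg _] := K.
have na : ~~ P1 a b a by rewrite /P1 eqxx andbF.
have nb : ~~ P1 a b b by rewrite /P1 eqxx !andbF.
split=> //; last by apply: keepP_col K na up.
  by apply: stuck_keep Sf; apply: keepP_sub K => c; apply: P1_P0.
by rewrite !(keepP_mis _ K).
Qed.

(** A common missing color would allow to recolor [p]-[s] and free [b] at [p], against [vac_b]. The
    palette leaves out [a] and [b] so that [vac] survives all changes. *)
Lemma vac_stuck f u v p a b s : vac f u v p a b -> col f p s = b -> stuck (P1 a b) f s p.
Proof.
move=> V ps g c K Pc ms_ mp; have Vg := vac_keep V K.
have [nab nup nvp nuv] := vac_neq V.
have nb : ~~ P1 a b b by rewrite /P1 eqxx !andbF.
have gps := keepP_col K nb ps; case: (Vg) => Rg Sg [Pa Pb] [mv mu] up.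
have [P0c nca ncb] := and3P Pc.
have [g2 K2 E2] := keepP_recolor P0_rng Rg P0c Pb gps mp ms_.
have [b0 _] := andP (P0_rng Pb); have [R2 _] := K2.
have [fp _] := rec_freed Rg b0 gps mp E2.
have nus : u != s by rewrite (mis_neq mu (col_mis (etrans (colC _ _ _) gps))).
suff V2 : vac g2 u v p a b by rewrite (negbTE (vac_b V2)) in fp.
split=> //; first exact: stuck_keep Sg.
  split; last by rewrite (rec_out E2).
  by rewrite (rec_other gps E2) // eq_sym.
by apply/eqP; rewrite (rec_col gps E2) ?up ?eqxx // eq_sym.
Qed.

Section VacFan.
Variables (f : coloring T) (u v p s : T) (a b al : nat).
Hypotheses (V : vac f u v p a b) (ps : col f p s = b) (Pal : P1 a b al) (mpal : mis f p al).
Notation fan := (connect (fr (P1 a b) p f)).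

Lemma vac_adj x : fan s x -> e p x /\ x != u.
Proof.
have [nab nup nvp nuv] := vac_neq V; case: V => Rf Sf [Pa Pb] [mv mu] up; have [pf _] := Rf.
case/fan_last=> [->|Px].
  have [b0 _] := andP (P0_rng Pb); rewrite -(col_edge e_sym e_irr pf) ps b0; split=> //.
  by apply: contraNneq nab => E; rewrite -up -ps E colC.
have [P0x nx _] := and3P Px; have [x0 _] := andP (P0_rng P0x).
by rewrite -(col_edge e_sym e_irr pf) x0; split=> //; apply: contraNneq nx => ->; rewrite colC up.
Qed.

(** By [vac_b], [u] and [p] are the two ends of one chain in [b] and [al]. If [x] missed [b], it
    would be off this chain, and a swap at [x] would make it miss [al] like [p], against [fan1]. *)
Lemma vac_fan_b x : fan s x -> ~~ mis f x b.
Proof.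
move=> cx; have [epx nxu] := vac_adj cx; have [nab nup nvp nuv] := vac_neq V.
have Sf1 := vac_stuck V ps; case: (V) => Rf Sf [Pa Pb] [mv mu] up.
have [pf _] := Rf; have [P0al nala nalb] := and3P Pal.
have nxp : x != p by apply: contraTneq epx => ->; rewrite e_irr.
have [b0 _] := andP (P0_rng Pb); have [al0 _] := andP (P0_rng P0al).
have lup : connect (kr f b al) u p.
  apply/negPn/negP; rewrite kr_connect_sym => nc.
  have [g Kg swg] := keepP_swap P0_rng p Rf Pb P0al; have [Rg _] := Kg.
  have Vg : vac g u v p a b.
    split=> //; first exact: stuck_keep Sf.
      by split; [rewrite (sw_mis_other swg) // eq_sym|rewrite (sw_mis_out swg)].
    by apply: sw_keep swg _ _ up; rewrite // eq_sym.
  by case/negP: (vac_b Vg); apply: sw_mis_start' swg mpal.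
apply/negP => mx; have [g Kg swg] := keepP_swap P0_rng x Rf Pb P0al; have [Rg _] := Kg.
have out w : connect (kr f b al) u w -> ~~ connect (kr f b al) x w.
  move=> cw; apply/negP => cxw.
  have cux : connect (kr f b al) u x by apply: connect_trans cw _; rewrite kr_connect_sym.
  apply: (three_ends e_sym e_irr pf b0 al0 (x := u) (y := p) (z := x)) => //;
    by rewrite ?mu ?mpal ?mx ?orbT 1?eq_sym.
have Vg : vac g u v p a b.
  split=> //; first exact: stuck_keep Sf.
    split; first by rewrite (sw_mis_other swg) // eq_sym.
    by rewrite (sw_mis_out swg) ?out.
  by apply: sw_keep swg _ _ up; rewrite // eq_sym.
have gp r : col g p r = col f p r by rewrite (sw_out swg) ?out.
have cgx : connect (fr (P1 a b) p g) s x.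
  apply: connect_sub cx => s1 s2 /andP[Pn mn]; apply: connect1; rewrite /fr gp Pn /=.
  rewrite (sw_mis_other swg) //; first by case/and3P: Pn.
  by apply: contraTneq mpal => E; apply/misPn; exists s2.
have mgp : mis g p al by rewrite (sw_mis_out swg) ?out.
case/negP: (fan1 (@P1_rng a b) Rg (vac_stuck Vg (etrans (gp s) ps)) cgx Pal mgp).
exact: sw_mis_start swg mx.
Qed.
End VacFan.

(** [u] and [v] are the ends of one ([a], [b])-chain. If [x] missed [a], a swap at [x] would turn
    this into a missing [b], against [vac_fan_b]. *)
Lemma vac_fan_a f u v p s a b al x : vac f u v p a b -> col f p s = b -> P1 a b al ->
  mis f p al -> connect (fr (P1 a b) p f) s x -> x != v -> ~~ mis f x a.
Proof.
move=> V ps Pal mpal cx nxv; have [epx nxu] := vac_adj V ps cx.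
have [nab nup nvp nuv] := vac_neq V; case: (V) => Rf Sf [Pa Pb] [mv mu] up.
have [pf _] := Rf; have [P0al nala nalb] := and3P Pal.
have [a0 _] := andP (P0_rng Pa); have [b0 _] := andP (P0_rng Pb).
have luv : connect (kr f a b) u v.
  apply/negPn/negP => nc; have [g Kg swg] := keepP_swap P0_rng u Rf Pa Pb.
  apply: (Sf g a Kg Pa); first exact: sw_mis_start' swg mu.
  by rewrite (sw_mis_out swg).
apply/negP => mx; have [g Kg swg] := keepP_swap P0_rng x Rf Pa Pb; have [Rg _] := Kg.
have out w : connect (kr f a b) u w -> ~~ connect (kr f a b) x w.
  move=> cw; apply/negP => cxw.
  have cux : connect (kr f a b) u x by apply: connect_trans cw _; rewrite kr_connect_sym.
  apply: (three_ends e_sym e_irr pf a0 b0 (x := u) (y := v) (z := x)) => //;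
    by rewrite ?mu ?mv ?mx ?orbT 1?eq_sym.
have lup : connect (kr f a b) u p by apply: connect1; apply: kr_l.
have Vg : vac g u v p a b.
  split=> //; first exact: stuck_keep Sf.
    by rewrite !(sw_mis_out swg) // out.
  by rewrite (sw_out swg) ?out.
have gp r : col g p r = col f p r by rewrite (sw_out swg) ?out.
have cgx : connect (fr (P1 a b) p g) s x.
  apply: connect_sub cx => s1 s2 /andP[Pn mn]; apply: connect1; rewrite /fr gp Pn /=.
  by case/and3P: Pn => _ na nb; rewrite (sw_mis_other swg).
have mgp : mis g p al by rewrite (sw_mis_other swg).
by case/negP: (vac_fan_b Vg (etrans (gp s) ps) Pal mgp cgx); apply: sw_mis_start swg mx.
Qed.

(* Otherwise the fan at p rooted at its b-neighbor s, in the colors other than a and b,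
   allows to free b at p, so that u-p can be recolored. *)
Lemma vacate f u v p a b : vac f u v p a b -> ~~ wk f p ->
  ~~ e v p \/ (exists a', [/\ a' != a, P0 a' & mis f v a']) ->
  exists2 x, e p x & wk f x.
Proof.
move=> V np cond; have /misPn[s ps] := vac_b V; have Sf1 := vac_stuck V ps.
have [nab nup nvp nuv] := vac_neq V; case: (V) => Rf Sf [Pa Pb] [mv mu] up.
have wkE x := wkP e_sym e_irr ph x Rf.
have nwk x : ~~ wk f x -> exists2 c, P0 c & mis f x c.
  move=> nx; apply: NNPP => n; case/negP: nx; apply/wkE => c hc; apply/negP => m.
  by apply: n; exists c.
have [al P0al mal] := nwk p np.
have Pal : P1 a b al.
  rewrite /P1 P0al /=; apply/andP; split; first by apply: contraTneq mal => ->; apply/misPn; exists u; rewrite colC.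
  by apply: contraTneq mal => ->; apply/misPn; exists s.
have [b0 _] := andP (P0_rng Pb).
have sp : col f s p = b by rewrite colC.
have cnt := fan_count (@P1_rng a b) Rf Sf1 _ _ Pal mal; rewrite sp -lt0n b0 in cnt.
have {}cnt := cnt isT; rewrite /P1 eqxx !andbF in cnt; have {}cnt := cnt isT.
rewrite -/(P1 a b) in cnt.
(* By [fan_count] the fan has more vertices than missing palette colors. *)
have [x cx mx] : exists2 x, connect (fr (P1 a b) p f) s x & mP (P1 a b) f x = set0.
  apply: NNPP => n; move: cnt; apply/negP; rewrite -ltnNge.
  have sin : s \in [set x | connect (fr (P1 a b) p f) s x] by rewrite inE connect0.
  apply: leq_trans (_ : #|[set x | connect (fr (P1 a b) p f) s x]| <= _).
    by rewrite [X in _ < X](cardsD1 s) sin.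
  rewrite -sum1_card big_mkcond /= [X in _ <= X]big_mkcond /=.
  apply: leq_sum => x _; rewrite inE; case: ifP => // cx; rewrite card_gt0.
  by apply/eqP => E; apply: n; exists x.
have [epx nxu] := vac_adj V ps cx; exists x => //; apply: contraT => /nwk[c P0c mc].
have nP1 n : P1 a b n -> ~~ mis f x n.
  move=> Pn; apply/negP => m; have [_ nt] := andP (P1_rng Pn).
  have: inord n \in mP (P1 a b) f x by rewrite inE inordK // Pn.
  by rewrite mx inE.
have mb := vac_fan_b V ps Pal mal cx.
have Ec : c = a.
  apply/eqP/negPn/negP => na; have P1c : P1 a b c.
    by rewrite /P1 P0c na /=; apply: contraNneq mb => <-.
  by case/negP: (nP1 c P1c).
(* Since [v] misses [a] by assumption, [vac_fan_a] says nothing about it; [cond] deals with this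
   vertex. *)
rewrite Ec in mc; case: (eqVneq x v) => [E|nxv]; last by case/negP: (vac_fan_a V ps Pal mal cx nxv).
rewrite E in epx nP1 mb; case: cond => [|[a' [na' Pa' ma']]]; first by rewrite e_sym epx.
have P1a' : P1 a b a' by rewrite /P1 Pa' na' /=; apply: contraNneq mb => <-.
by case/negP: (nP1 a' P1a').
Qed.

Definition nw f v := #|[set x | e v x && wk f x]|.

Section FanWeak.
Variables (f : coloring T) (u v : T).
Hypotheses (Rf : reach f) (Sf : stuck P0 f u v) (uv : col f u v = 1).
Notation m := (fun x => #|ms t f x|).

Lemma ms_wk x : (0 < m x) || wk f x.
Proof.
case: (boolP (wk f x)) => [|nx]; first by rewrite orbT.
rewrite orbF card_gt0; apply: NNPP => n; case/negP: nx; apply/(wkP e_sym e_irr ph x Rf) => c hc.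
by apply/negP => mc; apply: n; apply: ms_of_mis hc mc.
Qed.

(** By [fan_count] the sum of [m] over the fan is at most the number of fan vertices other than [u].
    Of those outside [B], each contributes at least 1 to the sum or is a weak neighbor of [v]. *)
Lemma fan_sum (B : {set T}) : (forall x, x \in B -> x != u /\ connect (fr P0 v f) u x) ->
  m u + \sum_(x in B) m x <= #|B| + nw f v.
Proof.
move=> HB; have [al P0al mal] : exists2 al, P0 al & mis f v al.
  by apply: (covered_mis e_sym e_irr ph Rf); apply/misPn; exists u; rewrite colC.
have := fan_count P0_rng Rf Sf; rewrite uv => /(_ al isT isT P0al mal).
set W := [set x | _].
have uW : u \in W by rewrite inE connect0.
have EmP x : mP P0 f x = ms t f x.
  by apply/setP => c; have ct := ltn_ord c; rewrite ltnS in ct; rewrite !inE /P0 ct andbT.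
rewrite (eq_bigl (mem W)) => [|x]; last by rewrite /= inE.
under eq_bigr => x _ do rewrite EmP.
rewrite (big_setD1 u) //= (big_setID B) /= -(cardsID B (W :\ u)).
have -> : (W :\ u) :&: B = B.
  by apply/setIidPr/subsetP => x /HB[nx cx]; rewrite !inE nx cx.
have: #|(W :\ u) :\: B| <= \sum_(x in (W :\ u) :\: B) m x + nw f v.
  rewrite -sum1_card (eq_bigr (fun x => minn 1 (m x) + (1 - minn 1 (m x)))); last first.
    by move=> x _; rewrite subnKC ?geq_minl.
  rewrite big_split /= leq_add //; first by apply: leq_sum => x _; apply: geq_minr.
  rewrite /nw -sum1_card big_mkcond /= [X in _ <= X]big_mkcond /=; apply: leq_sum => x _.
  rewrite !inE; case: ifP => // /and3P[_ nxu cx]; have := ms_wk x.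
  case: (m x) => [|n] /=; [move=> wx|by move=> _; lia].
  case: (fan_last cx) => [E|/P0_rng/andP[x0 _]]; first by rewrite E eqxx in nxu.
  have [pf _] := Rf; by rewrite -(col_edge e_sym e_irr pf) x0 wx.
rewrite /=; set S2 := \sum_(i in W :\ u :\: B) _; set S1 := \sum_(i in B) _.
set n1 := #|_ :\: _|; set n2 := #|ms t f u|; set n3 := #|B|; set n4 := nw f v.
clearbody S1 S2 n1 n2 n3 n4; clear; lia.
Qed.

Lemma fan_weak : m u <= nw f v.
Proof.
by have := @fan_sum set0; rewrite big_set0 cards0 addn0 add0n; apply => x; rewrite inE.
Qed.

Lemma fan_weak1 p b : P0 b -> mis f u b -> col f v p = b -> m u + m p <= (nw f v).+1.
Proof.
move=> Pb mu vp; have := @fan_sum [set p]; rewrite big_set1 cards1 add1n; apply=> x /set1P->.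
split; last by apply: connect1; rewrite /fr vp Pb.
by rewrite (eq_sym p) (mis_neq mu) //; apply/misPn; exists v; rewrite colC.
Qed.
End FanWeak.

End Fan.

(** * Discharging *)

Section Forest.
Variables (T : finType) (r : rel T).
Hypotheses (r_sym : symmetric r) (r_irr : irreflexive r) (r_acyclic : acyclic r).

Definition degin (U : {set T}) x := #|[set y in U | r x y]|.

(** If all degrees in [U] were at least 2, a path could be prolonged forever without turning back,
    for a repeated vertex would close a cycle. *)
Lemma forest_leaf (U : {set T}) : U != set0 -> exists2 x, x \in U & degin U x <= 1.
Proof.
case/set0Pn=> x0 Ux0; apply: NNPP => noleaf.
have deg2 x : x \in U -> 1 < degin U x.
  by move=> Ux; rewrite ltnNge; apply/negP => d; apply: noleaf; exists x.
have long n : exists x (p : seq T), [/\ uniq (x :: p), path r x p, x \in U & size p = n].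
  elim: n => [|n [x [p [up pp Ux sp]]]]; first by exists x0, [::].
  (* [head x p] is the vertex visited just before [x]. For empty [p] it is [x], which is not its own
     neighbor. *)
  have [z Uz /andP[rxz nz]] : exists2 z, z \in U & r x z && (z != head x p).
    apply: NNPP => n2; have := deg2 x Ux; rewrite ltnNge => /negP; apply.
    rewrite -(cards1 (head x p)); apply/subset_leq_card/subsetP => z; rewrite !inE => /andP[Uz rxz].
    by apply/negPn/negP => nz; apply: n2; exists z => //; rewrite rxz.
  case: (boolP (z \in x :: p)) => zp; last first.
    by exists z, (x :: p); split=> //=; [rewrite zp|rewrite r_sym rxz|rewrite sp].
  move: zp; rewrite inE => /orP[/eqP E|zp]; first by rewrite E r_irr in rxz.
  case/splitPr: zp up pp nz {sp} => p1 p2 up pp nz; exfalso.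
  have sub : subseq (x :: rcons p1 z) (x :: p1 ++ z :: p2).
    by rewrite -cat_rcons -!cat_cons prefix_subseq.
  have sz : 2 < size (x :: rcons p1 z).
    by rewrite /= size_rcons; case: p1 nz {up pp sub} => //=; rewrite eqxx.
  case/negP: (r_acyclic (subseq_uniq sub up) sz).
  move: pp; rewrite cat_path /= => /and3P[pp1 rz _].
  by rewrite /= !rcons_path pp1 rz last_rcons r_sym rxz.
have [x [p [up _ _ sp]]] := long #|T|.
by have := max_card (mem (x :: p)); rewrite (card_uniqP up) /= sp ltnn.
Qed.

(** Twice the bound [#|U| - 1] on the number of edges, by removing leaves. *)
Lemma forest_sum (U : {set T}) : U != set0 -> \sum_(x in U) degin U x + 2 <= 2 * #|U|.
Proof.
have [n] := ubnP #|U|; elim: n U => // n IH U; rewrite ltnS => Un U0.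
have [x Ux dx] := forest_leaf U0; have cU := cardsD1 x U; rewrite Ux in cU.
have E y : degin U y = r y x + degin (U :\ x) y.
  rewrite /degin (cardsD1 x) !inE Ux; congr (_ + _).
  by apply: eq_card => z; rewrite !inE andbA.
have Ex : degin U x = degin (U :\ x) x by rewrite E r_irr.
case: (eqVneq (U :\ x) set0) => [E0|n0].
  by rewrite (big_setD1 x) //= E0 big_set0 Ex E0 /degin cU E0 cards0 (_ : [set _ in set0 | _] = set0) ?cards0 //; apply/setP => y; rewrite !inE.
rewrite cU in Un; have IHU := IH (U :\ x) Un n0.
rewrite (big_setD1 x) //= (eq_bigr _ (fun y _ => E y)) big_split /=.
have -> : \sum_(y in U :\ x) r y x = degin (U :\ x) x.
  rewrite /degin -sum1_card big_mkcond [RHS]big_mkcond /=; apply: eq_bigr => y _.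
  by rewrite !inE r_sym; case: (_ && _) => //=; case: (r x y).
move: dx IHU; rewrite -Ex cU; set S := \sum_(i in _) _; set d := degin U x; set m := #|_|.
clearbody S d m; clear; lia.
Qed.

Lemma degin_split (e : rel T) (U B : {set T}) (W : pred T) x :
  (forall y, (y \in U) = (y \in B) || W y) -> (forall y, y \in U -> r x y = e x y) ->
  (forall y, y \in B -> ~~ W y) ->
  degin U x = #|[set y in B | e x y]| + #|[set y | e x y && W y]|.
Proof.
move=> UE rE dis; rewrite -cardsUI [X in _ = _ + X](_ : _ = 0); last first.
  apply/eqP; rewrite cards_eq0; apply/eqP/setP => y; rewrite !inE.
  by case: (boolP (y \in B)) => // /dis/negbTE->; rewrite !andbF.
rewrite addn0; apply: eq_card => y; rewrite !inE UE; have := rE y; rewrite UE.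
case: (y \in B); case: (W y) => /= H; [rewrite H|rewrite H|rewrite H|by rewrite andbF] => //; by rewrite ?andbT ?andbF ?orbF ?orbb.
Qed.
End Forest.

Section LargeDegree.
Variables (T : finType) (e : rel T).
Hypotheses (e_sym : symmetric e) (e_irr : irreflexive e).
Variables (k : nat) (f0 h : coloring T).
Hypothesis ph : proper_coloring e k h.
Notation t := k.+1.
Notation reach := (reachable e k f0).
Notation good := (num_good h).
Notation wk := (weak_at e k).
Notation weak := (num_weak e k).
Notation ready := (ready_at h).
Implicit Types (g : coloring T) (x y z s r v u w p q : T).

Variable G : nat.
Hypothesis good_max : forall f, reach f -> good f <= G.
Variable f : coloring T.
Hypotheses (Rf : reach f) (Gf : good f = G).
Hypothesis weak_min : forall g v u v', reach g -> good g = G -> ready g v u v' -> weak f <= weak g.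
Hypothesis k5 : 5 <= k.
Hypothesis ge5_acyclic : acyclic (e_ge5 e).

Notation m := (fun x => #|ms t f x|).
Notation nwk := (nw e k f).

Let pf : proper_coloring e t f. Proof. by case: Rf. Qed.

Lemma ready_St v u v' : ready f v u v' -> St e k f0 h G (weak f) f v u v'.
Proof. by []. Qed.

(** Changes in the colors above 1 keep the state ready, so [St_disj] applies after each of them. *)
Lemma ready_stuck v u v' : ready f v u v' -> stuck e k f0 (P0 k) f u v.
Proof.
move=> [uv hv mv'] g c K Pc mu mv; have [Rg _] := K.
have n1 : ~~ P0 k 1 by [].
have Kg : keeps h f g by move=> s r _; apply: keepP_col K n1.
have Gg := keeps_goodG good_max Rg Gf Kg.
have Sg : St e k f0 h G (weak g) g v u v'.
  by split=> //; split=> //; [apply: keepP_col K n1 uv|rewrite (keepP_mis _ K)].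
exact (St_disj e_sym e_irr ph good_max Sg Pc mu mv).
Qed.

Lemma covered v u : col f u v = 1 -> [/\ ~~ mis f u 1, ~~ mis f v 1, 0 < m u & 0 < m v].
Proof.
move=> uv; have mu : ~~ mis f u 1 := col_mis uv.
have mv : ~~ mis f v 1 by apply: (col_mis (y := u)); rewrite colC.
split=> //; first by have := ms_wk e_sym e_irr ph Rf u; rewrite /weak_at (negbTE mu) orbF.
by have := ms_wk e_sym e_irr ph Rf v; rewrite /weak_at (negbTE mv) orbF.
Qed.

Lemma card_m x : m x + mis f x 1 + deg e x = t.
Proof. exact: card_ms. Qed.

(* Exchanging the colors on the path u, v, w covers w. *)
Lemma no_direct_weak v u v' w b : ready f v u v' -> deg e u < 5 -> P0 k b ->
  mis f u b -> col f v w = b -> wk f w -> False.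
Proof.
move=> rf du Pb mu vw ww; have Sf := ready_St rf; case: (rf) => uv hv mv'; have [mw _] := andP ww.
have vu : col f v u = 1 by rewrite colC.
have nuv' := St_nu Sf; have nvv' := St_nv Sf.
have nuw : u != w by rewrite (mis_neq mu) //; apply: (col_mis (y := v)); rewrite colC.
have [g Rg Eg] := rotate2 e_sym e_irr Rf (isT : 1 <= 1 <= t) (P0_rng Pb) uv vw mu mw.
have Kg : keeps h f g.
  move=> s r hs fs; rewrite Eg; case: ifP => [E|_]; last by case: ifP.
  by case: (St_hvu e_sym e_irr ph Sf); rewrite colC -(edg_col h E).
have Gg := keeps_goodG good_max Rg Gf Kg.
have gvw : col g v w = 1.
  by rewrite Eg [edg u v v w]edgC edgN1 ?edg1 // 1?eq_sym // eq_sym (mis_neq mw) //; apply: col_mis vu.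
case: (eqVneq w v') => [E|nwv'].
  rewrite E in gvw; exact (no_gain good_max Gf Rg Kg hv (St_vv' Sf) gvw).
have out s n : s != u -> s != v -> s != w -> mis g s n = mis f s n.
  by move=> nu nv nw; apply: eq_forallb => r; rewrite Eg !edgN1.
have rg : ready g v w v' by split; rewrite ?out 1?eq_sym // colC.
have := weak_min Rg Gg rg; rewrite leqNgt => /negP; apply.
have wg s : wk g s -> wk f s && (s != w).
  case/andP=> ms_ ds.
  have nsw : s != w by apply: contraTneq ms_ => ->; apply: (col_mis (y := v)); rewrite colC.
  have nsv : s != v by apply: contraTneq ms_ => ->; apply: col_mis gvw.
  have nsu : s != u.
    by apply: contraTneq ds => ->; rewrite neq_ltn (leq_trans du k5).
  by rewrite /weak_at -out // ms_ ds.
apply: proper_card; apply/properP; split; first by apply/subsetP => s; rewrite !inE => /wg/andP[].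
exists w; rewrite !inE //; apply/negP => /wg; by rewrite eqxx andbF.
Qed.

(* Discharging: in the forest spanned by the hubs and the weak vertices the total charge
   is less than twice the number of weak vertices, but each edge of color 1 has at
   least twice as much charge as it has ends that are matched by M to a weak vertex. *)
Definition om x := [exists y, (col h x y == 1) && wk f y].
Definition hubs := [set x | [&& ~~ wk f x, 5 <= deg e x & 0 < nwk x]].
Definition hub_deg x := #|[set y in hubs | e x y]|.
Definition charge x := if x \in hubs then 2 * nwk x + hub_deg x - 2 else 0.

Lemma omP v u : col f u v = 1 -> om v -> exists v', [/\ ready f v u v', wk f v', e v v' & 0 < nwk v].
Proof.
move=> uv /existsP[v' /andP[/eqP hv wv']]; have [mv' _] := andP wv'.
have ev : e v v' by rewrite -(col_edge e_sym e_irr ph) hv.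
exists v'; split=> //; rewrite card_gt0; apply/set0Pn; exists v'.
by rewrite inE ev.
Qed.

Section EdgeOne.
Variables (u v : T).
Hypotheses (uv : col f u v = 1) (Suv : stuck e k f0 (P0 k) f u v).
Let vu : col f v u = 1. Proof. by rewrite colC. Qed.

(** [fan_weak1] with [u] and [v] exchanged leaves [m p <= 1], and a covered vertex has degree
    [k + 1 - m p]. *)
Lemma direct_deg a p : P0 k a -> mis f v a -> col f u p = a -> ~~ mis f p 1 ->
  nwk u <= m v -> k <= deg e p.
Proof.
move=> Pa mv up cp n; have := fan_weak1 e_sym e_irr ph Rf (stuck_sym Suv) vu Pa mv up.
have := card_m p; rewrite (negbTE cp); lia.
Qed.

Lemma direct_A a p : P0 k a -> mis f v a -> col f u p = a -> ~~ mis f p 1 ->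
  nwk u <= m v -> ~~ e v p \/ (exists a', [/\ a' != a, P0 k a' & mis f v a']) -> p \in hubs.
Proof.
move=> Pa mv up cp n cond; have dp := direct_deg Pa mv up cp n.
have np : ~~ wk f p by rewrite /weak_at (negbTE cp).
have [mu1 mv1 mu0 mv0] := covered uv.
have [b Pb mub] := covered_mis e_sym e_irr ph Rf mu1.
have V : vac e k f0 f u v p a b by split.
have [x epx wx] := vacate e_sym e_irr ph V np cond.
rewrite inE np (leq_trans k5 dp) card_gt0; apply/set0Pn; exists x; by rewrite inE epx.
Qed.

Lemma edge_A : 5 <= deg e u -> 0 < nwk u -> u \in hubs.
Proof.
by move=> du nu; have [mu1 _ _ _] := covered uv; rewrite inE du nu /weak_at (negbTE mu1).
Qed.

Lemma edge_nw : m v <= nwk u.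
Proof. exact (fan_weak e_sym e_irr ph Rf (stuck_sym Suv) vu). Qed.
End EdgeOne.

Lemma no_triangle x y z : e x y -> e y z -> e x z -> 5 <= deg e x -> 5 <= deg e y -> 5 <= deg e z -> False.
Proof.
move=> xy yz xz dx dy dz; have := ge5_acyclic (s := [:: x; y; z]).
have n a b : e a b -> a != b by apply: contraTneq => ->; rewrite e_irr.
rewrite /= /e_ge5 xy yz dx dy dz !inE negb_or !n // (e_sym z) xz; by move/(_ isT isT).
Qed.

Lemma two_in_A v x y : x \in hubs -> y \in hubs -> e v x -> e v y -> x != y -> 1 < hub_deg v.
Proof.
move=> Ax Ay vx vy nxy; rewrite /hub_deg.
have <- : #|[set x; y]| = 2 by rewrite cards2 nxy.
by apply/subset_leq_card/subsetP => z /set2P[]->; rewrite inE ?Ax ?Ay.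
Qed.

Lemma one_in_A v x : x \in hubs -> e v x -> 0 < hub_deg v.
Proof. by move=> Ax vx; rewrite card_gt0; apply/set0Pn; exists x; rewrite inE Ax. Qed.

Lemma edge_uv u v : col f u v = 1 -> e u v.
Proof. by move=> uv; rewrite -(col_edge e_sym e_irr pf) uv. Qed.

(** The two hubs are [v] and the neighbor [p] of [u] along a color missing at [v]. As the forest has
    no triangle, [p] is not [v'] and not adjacent to [v], so that [direct_A] applies. *)
Lemma big_big_dA u v v' : ready f v u v' -> wk f v' -> 5 <= deg e u -> 5 <= deg e v ->
  nwk u <= 1 -> 1 < hub_deg u.
Proof.
move=> rf wv' du dv nu; have Suv := ready_stuck rf; case: (rf) => uv hv mv'.
have [mu1 mv1 mu0 mv0] := covered uv; have euv := edge_uv uv.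
have [a Pa mva] := covered_mis e_sym e_irr ph Rf mv1.
have /misPn[p up] : ~~ mis f u a by apply/negP => mu; exact (Suv f a (keepP_refl _ Rf) Pa mu mva).
have [a0 _] := andP (P0_rng Pa).
have eup : e u p by rewrite -(col_edge e_sym e_irr pf) up.
have dv' : 5 <= deg e v' by case/andP: wv' => _ /eqP ->.
have cp : ~~ mis f p 1.
  apply/negP => mp; have E := St_p_uncovered e_sym e_irr ph good_max (ready_St rf) Pa mva up mp.
  have evv' : e v v' by rewrite -(col_edge e_sym e_irr ph) hv.
  rewrite E in eup; exact (no_triangle euv evv' eup du dv dv').
have nuv : nwk u <= m v := leq_trans nu mv0.
have dp := direct_deg uv Suv Pa mva up cp nuv.
have nvp : v != p by apply: (mis_neq mva); apply: (col_mis (y := u)); rewrite colC.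
apply: (@two_in_A u v p) => //.
  have vu : col f v u = 1 by rewrite colC.
  apply: (edge_A vu dv); apply: leq_trans mu0 _; exact (edge_nw vu (stuck_sym Suv)).
apply: (direct_A uv Suv Pa mva up cp nuv); left; apply/negP => evp.
exact (no_triangle euv evp eup du dv (leq_trans k5 dp)).
Qed.

Lemma chargeE x : x \in hubs -> charge x = 2 * nwk x + hub_deg x - 2.
Proof. by rewrite /charge => ->. Qed.

Section Sides.
Variables (u v : T).
Hypotheses (uv : col f u v = 1) (Suv : stuck e k f0 (P0 k) f u v).
Let vu : col f v u = 1. Proof. by rewrite colC. Qed.

Lemma small_m : deg e u < 5 -> 2 <= m u.
Proof.
move=> du; have [mu1 _ _ _] := covered uv; have := card_m u; rewrite (negbTE mu1).
move: du k5; set m_ := #|_|; set d := deg e u; clearbody m_ d; clear; lia.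
Qed.

Lemma big_C : 5 <= deg e v -> v \in hubs /\ 2 * m u - 2 <= charge v.
Proof.
move=> dv; have [_ _ mu0 _] := covered uv; have n := edge_nw vu (stuck_sym Suv).
have Av := edge_A vu dv (leq_trans mu0 n); split=> //; rewrite chargeE //.
move: n; set a1 := #|_|; set a2 := nwk v; set d := hub_deg v; clearbody a1 a2 d; clear; lia.
Qed.
End Sides.

(** If [nwk v] exceeds [m u], it is at least 3, and [2 * 3 - 2] is 4. Otherwise two colors missing
    at [u] lead from [v] to two hubs, and [2 * 2 + 2 - 2] is 4. *)
Lemma small_C u v v' u' : ready f v u v' -> ready f u v u' -> wk f u' -> deg e u < 5 ->
  5 <= deg e v -> 4 <= charge v.
Proof.
move=> rf ru wu' du dv; have Suv := ready_stuck rf; case: (rf) => uv hv mv'.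
have vu : col f v u = 1 by rewrite colC.
have [Av _] := big_C uv Suv dv; have m2 := small_m uv du.
have n2 := edge_nw vu (stuck_sym Suv); rewrite chargeE //.
case: (leqP (nwk v) (m u)) => [nle|lt_]; last first.
  move: m2 n2 lt_; set a1 := #|_|; set a2 := nwk v; set d := hub_deg v; clearbody a1 a2 d; clear; lia.
have dir b b' : P0 k b -> mis f u b -> b' != b -> P0 k b' -> mis f u b' ->
    exists q, [/\ q \in hubs, e v q & col f v q = b].
  move=> Pb mb nb Pb' mb'; have [b0 _] := andP (P0_rng Pb).
  have /misPn[q vq] : ~~ mis f v b by apply/negP => mv; exact (Suv f b (keepP_refl _ Rf) Pb mb mv).
  have evq : e v q by rewrite -(col_edge e_sym e_irr pf) vq.
  have cq : ~~ mis f q 1.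
    apply/negP => mq; have E := St_p_uncovered e_sym e_irr ph good_max (ready_St ru) Pb mb vq mq.
    by rewrite -E in wu'; exact (no_direct_weak rf du Pb mb vq wu').
  exists q; split=> //; apply: (direct_A vu (stuck_sym Suv) Pb mb vq cq nle); right.
  by exists b'.
have [b [b' [bm b'm nbb']]] := card_gt1P m2.
have ms_P0 (c : 'I_t.+1) : c \in ms t f u -> P0 k c /\ mis f u c.
  by rewrite inE /P0 => /andP[-> ->]; rewrite -ltnS ltn_ord.
have [Pb mb] := ms_P0 _ bm; have [Pb' mb'] := ms_P0 _ b'm.
have nbb : val b' != val b by rewrite eq_sym.
have [q [Aq eq vq]] := dir _ _ Pb mb nbb Pb' mb'.
have [q' [Aq' eq' vq']] := dir _ _ Pb' mb' nbb' Pb mb.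
have nqq : q != q' by apply: col_neq vq vq'.
have dA2 := two_in_A Aq Aq' eq eq' nqq.
by move: m2 n2 dA2; set a1 := #|_|; set a2 := nwk v; set d := hub_deg v; clearbody a1 a2 d; clear; lia.
Qed.

(** [v] would have five neighbors: two weak ones by [edge_nw], then [u], and two along colors
    missing at [u], which are not weak by [no_direct_weak]. *)
Lemma not_both_small u v v' : ready f v u v' -> deg e u < 5 -> deg e v < 5 -> False.
Proof.
move=> rf du dv; have Suv := ready_stuck rf; case: (rf) => uv hv mv'.
have vu : col f v u = 1 by rewrite colC.
have m2 := small_m uv du; have n2 := leq_trans m2 (edge_nw vu (stuck_sym Suv)).
have [mu1 mv1 _ _] := covered uv.
have dir b : P0 k b -> mis f u b -> exists q, [/\ ~~ wk f q, e v q, q != u & col f v q = b].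
  move=> Pb mb; have [b0 _] := andP (P0_rng Pb).
  have /misPn[q vq] : ~~ mis f v b by apply/negP => mv; exact (Suv f b (keepP_refl _ Rf) Pb mb mv).
  exists q; split=> //.
  - by apply/negP => wq; exact (no_direct_weak rf du Pb mb vq wq).
  - by rewrite -(col_edge e_sym e_irr pf) vq.
  by apply: contraTneq Pb => E; rewrite -vq E vu.
have [b [b' [bm b'm nbb']]] := card_gt1P m2.
have ms_P0 (c : 'I_t.+1) : c \in ms t f u -> P0 k c /\ mis f u c.
  by rewrite inE /P0 => /andP[-> ->]; rewrite -ltnS ltn_ord.
have [Pb mb] := ms_P0 _ bm; have [Pb' mb'] := ms_P0 _ b'm.
have [q [wq eq nqu vq]] := dir _ Pb mb; have [q' [wq' eq' nqu' vq']] := dir _ Pb' mb'.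
have nqq : q != q' by apply: col_neq vq vq'.
have: #|[set u; q; q'] :|: [set x | e v x && wk f x]| <= deg e v.
  apply/subset_leq_card/subsetP => x; rewrite !inE => /orP[|/andP[] //].
  by rewrite -orbA => /or3P[]/eqP-> //; apply: edge_uv.
rewrite leqNgt => /negP; apply; apply: leq_trans dv _.
have wu : ~~ wk f u by rewrite /weak_at (negbTE mu1).
rewrite cardsU (_ : _ :&: _ = set0) ?cards0 ?subn0; last first.
  apply/setP => x; rewrite !inE -orbA; apply/negbTE; apply/negP => /andP[/or3P[]/eqP-> /andP[_]];
  by apply/negP.
rewrite (_ : #|[set u; q; q']| = 3); first by rewrite -[5]/(3 + 2) leq_add2l.
by rewrite -setUA cardsU1 cards2 !inE !(eq_sym u) (negbTE nqu) (negbTE nqu') nqq.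
Qed.

(** Some end has degree at least 5. Facing a small end it pays alone, 2 by [big_C] or 4 by
    [small_C]. Two big ends are adjacent hubs, so each has charge at least 1, and at least 2 by
    [big_big_dA] if both satisfy [om]. *)
Lemma edge_C u v : col f u v = 1 -> 2 * (om u + om v) <= charge u + charge v.
Proof.
wlog ov : u v / om v => [Hw|] uv.
  have vu : col f v u = 1 by rewrite colC.
  have := Hw u v ^~ uv; have := Hw v u ^~ vu; rewrite [om v + _]addnC [charge v + _]addnC.
  by case: (om u); case: (om v) => // H1 H2; [exact: H2|exact: H1|exact: H2].
have vu : col f v u = 1 by rewrite colC.
have [v' [rf wv' evv' nv0]] := omP uv ov; have Suv := ready_stuck rf; have Svu := stuck_sym Suv.
have [mu1 mv1 mu0 mv0] := covered uv.
have nu0 := leq_trans mv0 (edge_nw uv Suv).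
rewrite ov; case: (ltnP (deg e u) 5) => du; case: (ltnP (deg e v) 5) => dv.
- by case: (not_both_small rf du dv).
- have [Av Cv] := big_C uv Suv dv; have m2 := small_m uv du.
  case: (boolP (om u)) => [ou|_].
    have [u' [ru wu' _ _]] := omP vu ou; have := small_C rf ru wu' du dv.
    by move=> C4; apply: leq_trans (leq_addl _ _).
  apply: leq_trans (leq_addl _ _); apply: leq_trans Cv.
  by move: m2; set a1 := #|_|; clearbody a1; clear; lia.
- have [Au Cu] := big_C vu Svu du; have m2 := small_m vu dv.
  case: (boolP (om u)) => [ou|_].
    have [u' [ru wu' _ _]] := omP vu ou; have := small_C ru rf wv' dv du.
    by move=> C4; apply: leq_trans (leq_addr _ _).
  apply: leq_trans (leq_addr _ _); apply: leq_trans Cu.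
  by move: m2; set a1 := #|_|; clearbody a1; clear; lia.
have Au := edge_A uv du nu0; have Av := edge_A vu dv nv0.
have euv := edge_uv uv; have evu := edge_uv vu.
have dAu := one_in_A Av euv; have dAv := one_in_A Au evu; rewrite !chargeE //.
case: (boolP (om u)) => [ou|_]; last first.
  move: nu0 nv0 dAu dAv; set a1 := nwk u; set a2 := nwk v; set d1 := hub_deg u; set d2 := hub_deg v.
  by clearbody a1 a2 d1 d2; clear; lia.
have [u' [ru wu' _ _]] := omP vu ou.
have Du := big_big_dA rf wv' du dv; have Dv := big_big_dA ru wu' dv du.
move: nu0 nv0 dAu dAv Du Dv; set a1 := nwk u; set a2 := nwk v; set d1 := hub_deg u; set d2 := hub_deg v.
by clearbody a1 a2 d1 d2; clear; lia.
Qed.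

(** An uncovered vertex is its own mate, which makes [mate] an involution. *)
Definition mate x := odflt x [pick y | col f x y == 1].

Lemma mateP x : mis f x 1 /\ mate x = x \/ col f x (mate x) = 1.
Proof.
rewrite /mate; case: pickP => [y /eqP|n]; first by right.
by left; split=> //; apply/forallP => y; rewrite n.
Qed.

Lemma mateK : involutive mate.
Proof.
move=> x; case: (mateP x) => [[mx E]|xy]; first by rewrite !E.
case: (mateP (mate x)) => [[my _]|yz]; first by case: (misF (y := x) _ my); rewrite colC.
by apply: (reach_inj e_sym e_irr Rf (ltn0Sn 0) yz); rewrite colC.
Qed.

Definition weaks := [set x | wk f x].

(** Summing [edge_C] over the covered vertices counts each edge of color 1 twice on both sides. A
    weak vertex is counted at its partner in M, which is covered and satisfies [om]. *)
Lemma sum_C : 2 * #|weaks| <= \sum_(x in hubs) charge x.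
Proof.
pose X := [set x | ~~ mis f x 1].
have XM x : (mate x \in X) = (x \in X).
  rewrite !inE; case: (mateP x) => [[mx ->] //|xy].
  rewrite (col_mis xy); apply: (col_mis (y := x)); by rewrite colC.
have ge : \sum_(x in X) 2 * (om x + om (mate x)) <= \sum_(x in X) (charge x + charge (mate x)).
  apply: leq_sum => x; rewrite inE => nx; case: (mateP x) => [[mx _]|xy]; first by rewrite mx in nx.
  rewrite addnC [_ + charge _]addnC; apply: edge_C; by rewrite colC.
have inv (F : T -> nat) : \sum_(x in X) F (mate x) = \sum_(x in X) F x.
  rewrite [RHS](reindex_inj (inv_inj mateK)) /=; apply: eq_bigl => x; by rewrite XM.
rewrite -big_distrr /= !big_split /= (inv (fun x => charge x)) (inv (fun x => nat_of_bool (om x))) in ge.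
have Yom : #|weaks| <= \sum_(x in X) om x.
  pose w' x := odflt x [pick y | col h x y == 1].
  have w'E x : x \in weaks -> col h x (w' x) = 1.
    rewrite inE => wx; have [|z hz] := wk_partner e_sym e_irr ph _ wx; first exact: leq_trans k5.
    by rewrite /w'; case: pickP => [y /eqP //|/(_ z)]; rewrite hz.
  rewrite -(card_in_imset (f := w') (D := weaks)); last first.
    move=> x y Yx Yy E; have := w'E x Yx; rewrite E colC => hx; have := w'E y Yy; rewrite colC => hy.
    exact (col_inj e_sym e_irr ph (ltn0Sn 0) hx hy).
  rewrite -sum1_card big_mkcond [X in _ <= X]big_mkcond /=; apply: leq_sum => x _.
  case: ifP => // /imsetP[y Yy Ex]; have hy := w'E y Yy; rewrite -Ex in hy.
  have wy : wk f y by move: Yy; rewrite inE.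
  have [|w2 [u [uw hw _]]] := weak_ready e_sym e_irr ph good_max _ Rf Gf wy; first exact: leq_trans k5.
  have E2 : w2 = x by apply: (col_inj e_sym e_irr ph (ltn0Sn 0) _ hy); rewrite colC.
  rewrite inE; have [_ n1 _ _] := covered uw; rewrite E2 in n1; rewrite n1.
  have -> // : om x; apply/existsP; exists y; by rewrite colC hy wy.
have XA : \sum_(x in X) charge x <= \sum_(x in hubs) charge x.
  rewrite big_mkcond [X in _ <= X]big_mkcond /=; apply: leq_sum => x _.
  by rewrite /charge; case: (x \in hubs); case: (x \in X).
move: ge Yom XA; set s1 := \sum_(x in X) charge x; set s2 := \sum_(x in hubs) charge x.
set s3 := \sum_(x in X) _; set s4 := #|weaks|; clearbody s1 s2 s3 s4; clear; lia.
Qed.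

(** In the degree sum of the forest a hub accounts for [hub_deg + nwk], and the weak vertices
    together for at least the sum of [nwk] once more. Subtracting 2 for each hub leaves its
    [charge]. *)
Lemma sum_forest : weaks != set0 -> \sum_(x in hubs) charge x + 2 <= 2 * #|weaks|.
Proof.
move=> Y0; have dis : [disjoint hubs & weaks].
  by rewrite disjoint_subset; apply/subsetP => x; rewrite !inE => /and3P[].
have U0 : hubs :|: weaks != set0 by rewrite setU_eq0 negb_and Y0 orbT.
have r_sym : symmetric (e_ge5 e) by move=> x y; rewrite /e_ge5 e_sym [X in _ && X]andbC.
have r_irr : irreflexive (e_ge5 e) by move=> x; rewrite /e_ge5 e_irr.
have := forest_sum r_sym r_irr ge5_acyclic U0.
have UE x y : x \in hubs :|: weaks -> y \in hubs :|: weaks -> e_ge5 e x y = e x y.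
  have d z : z \in hubs :|: weaks -> 5 <= deg e z.
    by case/setUP; rewrite inE; [case/and3P|case/andP=> _ /eqP ->].
  by move=> /d dx /d dy; rewrite /e_ge5 dx dy !andbT.
have cU : #|hubs :|: weaks| = #|hubs| + #|weaks| by rewrite cardsU (disjoint_setI0 dis) cards0 subn0.
rewrite cU; have -> (F : T -> nat) : \sum_(x in hubs :|: weaks) F x = \sum_(x in hubs) F x + \sum_(x in weaks) F x.
  by rewrite -bigU //=; apply: eq_bigl => x; rewrite in_setU.
have sA : \sum_(x in hubs) degin (e_ge5 e) (hubs :|: weaks) x = \sum_(x in hubs) (hub_deg x + nwk x).
  apply: eq_bigr => x Ax; apply: degin_split => y.
  - by rewrite in_setU [y \in weaks]inE.
  - by apply: UE; rewrite in_setU Ax.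
  by rewrite inE => /andP[].
have sY : \sum_(x in hubs) nwk x <= \sum_(y in weaks) degin (e_ge5 e) (hubs :|: weaks) y.
  rewrite (eq_bigr (fun x => \sum_(y in weaks) (e x y : nat))) => [|x _]; last first.
    rewrite /nw -sum1_card big_mkcond [RHS]big_mkcond /=; apply: eq_bigr => y _.
    by rewrite !inE; case: (e x y); case: (wk f y).
  rewrite exchange_big /=; apply: leq_sum => y Yy.
  rewrite /degin -sum1_card big_mkcond [X in _ <= X]big_mkcond /=; apply: leq_sum => x _.
  case: ifP => // Ax; rewrite inE in_setU Ax /= UE ?in_setU ?Ax ?Yy ?orbT // e_sym.
  by case: (e y x).
(* Hubs have [0 < nwk x], so the subtraction in [charge] is not truncated. *)
have CA : \sum_(x in hubs) (hub_deg x + nwk x) + \sum_(x in hubs) nwk x = \sum_(x in hubs) charge x + 2 * #|hubs|.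
  rewrite -big_split /= -sum1_card big_distrr -big_split /=; apply: eq_bigr => x Ax.
  rewrite chargeE //; move: Ax; rewrite inE => /and3P[_ _]; set n := nwk x; set d := hub_deg x.
  clearbody n d; clear; lia.
move: sY CA; rewrite sA; set s1 := \sum_(x in hubs) nwk x; set s2 := \sum_(x in weaks) _.
set s3 := \sum_(x in hubs) _; set s4 := \sum_(x in hubs) _; set a1 := #|hubs|; set a2 := #|weaks|.
clearbody s1 s2 s3 s4 a1 a2; clear; lia.
Qed.

Lemma no_ready v u v' : ~ ready f v u v'.
Proof.
move=> rf; case: (eqVneq weaks set0) => [Y0|n0]; last first.
  have := leq_trans (sum_forest n0) sum_C; by rewrite addn2 ltnNge leqnSn.
have Suv := ready_stuck rf; case: (rf) => uv hv mv'; have [_ _ mu0 _] := covered uv.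
have vu : col f v u = 1 by rewrite colC.
have := leq_trans mu0 (edge_nw vu (stuck_sym Suv)); rewrite card_gt0 => /set0Pn[x].
rewrite inE => /andP[_ wx]; have: x \in weaks by rewrite inE.
by rewrite Y0 inE.
Qed.

End LargeDegree.

(** * Agreement on a color class and induction *)

Lemma ex_min (P : nat -> Prop) : (exists n, P n) -> exists2 n, P n & forall j, P j -> n <= j.
Proof.
case=> n; have [j] := ubnP n; elim: j n => // j IH n; rewrite ltnS => nj Pn.
case: (classic (exists2 i, P i & i < n)) => [[i Pi lt_in]|no].
  by apply: (IH i) => //; apply: leq_trans lt_in nj.
by exists n => // i Pi; rewrite leqNgt; apply/negP => lt_in; apply: no; exists i.
Qed.

Section Agree.
Variables (T : finType) (e : rel T).
Hypotheses (e_sym : symmetric e) (e_irr : irreflexive e).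
Variables (k : nat) (f0 h : coloring T).
Hypothesis ph : proper_coloring e k h.
Hypothesis pf0 : proper_coloring e k.+1 f0.
Hypothesis k0 : 0 < k.
Hypothesis ge5_acyclic : acyclic (e_ge5 e).
Notation t := k.+1.
Notation reach := (reachable e k f0).
Notation good := (num_good h).
Notation wk := (weak_at e k).
Notation weak := (num_weak e k).
Notation ready := (ready_at h).
Implicit Types (f g : coloring T) (x y z s r v u w p q : T).

Lemma ex_good_max : exists2 f, reach f & forall g, reach g -> good g <= good f.
Proof.
have [|n [f Rf Ef] minn] := @ex_min (fun n => exists2 f, reach f & n = #|{: T * T}| - good f).
  by exists (#|{: T * T}| - good f0), f0 => //; split=> //; apply: kempe_refl.
exists f => // g Rg; have := minn _ (ex_intro2 _ _ g Rg erefl); rewrite Ef.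
have := max_card (mem [set p : T * T | (col h p.1 p.2 == 1) && (col f p.1 p.2 == 1)]).
have := max_card (mem [set p : T * T | (col h p.1 p.2 == 1) && (col g p.1 p.2 == 1)]).
rewrite -/(num_good h f) -/(num_good h g).
by set a := #|_|; set b := num_good _ _; set c := num_good _ _; clearbody a b c; clear; lia.
Qed.

Variable G : nat.
Hypothesis good_max : forall f, reach f -> good f <= G.

Lemma not_ready f v u v' : reach f -> good f = G -> ready f v u v' -> False.
Proof.
move=> Rf Gf rf.
have [|n [g [v1 [u1 [v1' [Rg Gg rg En]]]]] minn] := @ex_min (fun n => exists g v u v',
    [/\ reach g, good g = G, ready g v u v' & n = weak g]).
  by exists (weak f), f, v, u, v'.
have wmin g' v2 u2 v2' : reach g' -> good g' = G -> ready g' v2 u2 v2' -> weak g <= weak g'.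
  by move=> R' G' r'; rewrite -En; apply: minn; exists g', v2, u2, v2'.
have Sg : St e k f0 h G (weak g) g v1 u1 v1' by [].
have := St_k4 e_sym e_irr ph good_max Sg; rewrite leq_eqVlt => /orP[/eqP E|k5].
  exact (St_false5 e_sym e_irr ph good_max wmin (esym E) Sg).
exact (no_ready e_sym e_irr ph good_max Rg Gg wmin k5 ge5_acyclic rg).
Qed.

Lemma not_weak f x : reach f -> good f = G -> ~~ wk f x.
Proof.
move=> Rf Gf; apply/negP => wx.
have [v [u rf]] := weak_ready e_sym e_irr ph good_max k0 Rf Gf wx.
exact (not_ready Rf Gf rf).
Qed.

(** If both ends were uncovered, the edge could get color 1; if only [v] were, the state would be
    ready. *)
Lemma matched_covered f v v' : reach f -> good f = G -> col h v v' = 1 -> ~~ mis f v 1.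
Proof.
move=> Rf Gf hv; apply/negP => mv; case: (boolP (mis f v' 1)) => [mv'|/misPn[u v'u]].
  by apply: (no_gain2 e_sym e_irr ph good_max Gf Rf _ hv mv mv') => // E; exact (misF E mv).
by apply: (not_ready (v := v') (u := u) (v' := v) Rf Gf); split; rewrite // colC.
Qed.

Definition ones f := #|[set p : T * T | col f p.1 p.2 == 1]|.

(** If [u] and [v] were stuck, [fan_weak] would give a weak vertex, and there is none. So after
    changes in the colors above 1, [u]-[v] can leave the class 1. *)
Lemma drop_one f u v : reach f -> good f = G -> col f u v = 1 -> col h u v <> 1 ->
  exists g, [/\ reach g, good g = G & ones g < ones f].
Proof.
move=> Rf Gf uv nh.
have [g [c [K Pc mu mv]]] : exists g c, [/\ keepP e k f0 (P0 k) f g, P0 k c, mis g u c & mis g v c].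
  apply: NNPP => no; have Suv : stuck e k f0 (P0 k) f u v.
    by move=> g c K Pc mu mv; apply: no; exists g, c.
  have n := fan_weak e_sym e_irr ph Rf Suv uv.
  have := ms_wk e_sym e_irr ph Rf u; rewrite (negbTE (not_weak u Rf Gf)) orbF => m0.
  have := leq_trans m0 n; rewrite card_gt0 => /set0Pn[x]; rewrite inE => /andP[_].
  by rewrite (negbTE (not_weak x Rf Gf)).
have [Rg _] := K; have n1 : ~~ P0 k 1 by [].
have guv := keepP_col K n1 uv.
have [g2 R2 E2] := recolor e_sym e_irr Rg (P0_rng Pc) (ltn0Sn 0) guv mu mv.
have c1 : c != 1 by apply: contraTneq Pc => ->.
have K1 s r : (col g s r == 1) = (col f s r == 1) by case: K => _; apply.
have S s r : (col g2 s r == 1) = (col f s r == 1) && ~~ edg u v s r.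
  by rewrite E2 -K1; case: ifP; rewrite ?andbT ?andbF ?(negbTE c1).
exists g2; split=> //.
  apply: (keeps_goodG good_max R2 Gf) => s r hs fs; apply/eqP; rewrite S fs eqxx /=.
  by apply/negP => E; apply: nh; rewrite -(edg_col h E).
apply: proper_card; apply/properP; split.
  by apply/subsetP => p; rewrite !inE S => /andP[].
by exists (u, v); rewrite !inE ?S /= uv ?edg1.
Qed.
End Agree.

(** Take the fewest edges of color 1. By [drop_one] all of them are in M, and since every vertex of
    M is covered, they are all of M. *)
Lemma agree (T : finType) (e : rel T) (e_sym : symmetric e) (e_irr : irreflexive e) k
    (f0 h : coloring T) : proper_coloring e k h -> proper_coloring e k.+1 f0 -> 0 < k ->
  acyclic (e_ge5 e) ->
  exists2 f, reachable e k f0 f & forall x y, (col f x y == 1) = (col h x y == 1).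
Proof.
move=> ph pf0 k0 ac; have [f1 R1 mx] := ex_good_max h pf0.
have [|n [f [Rf Gf En]] minn] := @ex_min (fun n => exists f,
    [/\ reachable e k f0 f, num_good h f = num_good h f1 & n = ones f]); first by exists (ones f1), f1.
have one x y : col f x y = 1 -> col h x y = 1.
  move=> xy; apply: NNPP => nh; have [g [Rg Gg]] := drop_one e_sym e_irr ph k0 ac mx Rf Gf xy nh.
  by rewrite ltnNge -En => /negP; apply; apply: minn; exists g.
exists f => // x y; apply/eqP/eqP => [|hxy]; first exact: one.
have /misPn[z xz] := matched_covered e_sym e_irr ph ac mx Rf Gf hxy.
by rewrite -xz (col_inj e_sym e_irr ph (ltn0Sn 0) hxy (one _ _ xz)).
Qed.

(** * Reversing interchanges *)

Section Symmetry.
Variables (T : finType) (e : rel T).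

(** An interchange preserves the set of edges colored [a] or [b], hence the component of [A0];
    repeating it restores [f]. *)
Lemma kempe_step_sym t (f g : coloring T) : kempe_step e t f g -> kempe_step e t g f.
Proof.
case=> a [b [A0 [ha hb eA0 fA0 ->]]]; set g' := Defs.interchange _ _ _ _ _.
have swE n : (swap_col a b n == a) || (swap_col a b n == b) = (n == a) || (n == b).
  rewrite /swap_col; case: (eqVneq n a) => [_|na]; first by rewrite eqxx orbT.
  by case: (eqVneq n b) => [_|nb]; rewrite ?eqxx ?orbT // (negbTE na) (negbTE nb).
have gE A : (g' A == a) || (g' A == b) = (f A == a) || (f A == b).
  by rewrite ffunE; case: ifP => // _; rewrite swE.
have kE : kadj e g' a b =2 kadj e f a b.
  by move=> A B; rewrite /kadj; congr [&& _, _ & _]; rewrite [RHS]andbA [LHS]andbA !gE.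
exists a, b, A0; split=> //; first by rewrite gE.
apply/ffunP => A; rewrite ffunE (eq_connect kE) ffunE.
by case: (connect _ _ _) => //; rewrite swap_colK.
Qed.

Lemma kempe_equiv_sym t (f g : coloring T) : kempe_equiv e t f g -> kempe_equiv e t g f.
Proof.
elim=> [f1|f1 g1 h1 st _ IH]; first exact: kempe_refl.
apply: kequiv_trans IH _; apply: kempe_trans (kempe_step_sym st) (kempe_refl _ _ _).
Qed.
End Symmetry.

(** * Removing a color class *)

Section Peel.
Variables (T : finType) (e : rel T).
Hypotheses (e_sym : symmetric e) (e_irr : irreflexive e).
Variables (k : nat) (h : coloring T).
Hypothesis ph : proper_coloring e k h.

Definition peel : rel T := fun x y => e x y && (col h x y != 1).

Lemma peel_sym : symmetric peel. Proof. by move=> x y; rewrite /peel e_sym colC. Qed.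
Lemma peel_irr : irreflexive peel. Proof. by move=> x; rewrite /peel e_irr. Qed.

Lemma peel_edgeset A : (A \in edgeset peel) = (A \in edgeset e) && (h A != 1).
Proof.
apply/edgesetP/andP => [[x [y [/andP[exy nh] ->]]]|[/edgesetP[x [y [exy ->]]] nh]].
  by rewrite mem_edgeset.
by exists x, y; rewrite /peel exy.
Qed.

Lemma peel_out A : A \notin edgeset peel -> h A = (A \in edgeset e).
Proof.
case: ph => _ h0 _; rewrite peel_edgeset negb_and.
by case: (boolP (A \in _)) => [_ /negPn/eqP|/h0].
Qed.

Definition lower (g : coloring T) : coloring T := [ffun A => (g A).-1].
(** Off the edges of [peel], [h] is 1 on the removed edges and 0 elsewhere, which is what [lower]
    has erased. *)
Definition lift (g : coloring T) : coloring T :=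
  [ffun A => if A \in edgeset peel then (g A).+1 else h A].

Lemma lower_proper t g : proper_coloring e t.+1 g -> (forall x y, (col g x y == 1) = (col h x y == 1)) ->
  proper_coloring peel t (lower g).
Proof.
move=> [g1 g0 gp] E.
have gE A : A \in edgeset e -> (g A == 1) = (h A == 1) by case/edgesetP=> x [y [_ ->]]; apply: E.
have rng A : A \in edgeset peel -> 1 < g A <= t.+1.
  rewrite peel_edgeset => /andP[eA]; rewrite -gE // => n1.
  by have := g1 A eA; move: n1; case: (g A) => [|[|n]].
split=> [A /rng|A nA|A B pA pB nAB dAB].
- by rewrite ffunE; case: (g A) => [|[|n]].
- rewrite ffunE; have := nA; rewrite peel_edgeset negb_and => /orP[/g0 -> //|/negPn hA].
  case: (boolP (A \in edgeset e)) => [eA|/g0 -> //].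
  by move: hA; rewrite -gE // => /eqP->.
have eA : A \in edgeset e by move: pA; rewrite peel_edgeset => /andP[].
have eB : B \in edgeset e by move: pB; rewrite peel_edgeset => /andP[].
have := gp A B eA eB nAB dAB; rewrite !ffunE; have := rng A pA; have := rng B pB.
by case: (g A) => [|[|n]] //; case: (g B) => [|[|m]].
Qed.

Lemma lift_lower t g : proper_coloring e t g -> (forall x y, (col g x y == 1) = (col h x y == 1)) ->
  lift (lower g) = g.
Proof.
move=> [g1 g0 gp] E; apply/ffunP => A; rewrite !ffunE; case: ifP => [|/negbT nA].
  by rewrite peel_edgeset => /andP[/g1]; case: (g A).
rewrite (peel_out nA); case: (boolP (A \in edgeset e)) => [eA|/g0 -> //].
have hA := peel_out nA; rewrite eA in hA; case/edgesetP: eA hA => x [y [_ ->]] hA.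
by apply/esym/eqP; rewrite -/(col g x y) E /col hA.
Qed.

(** The shifted colors are at least 2, so the removed edges, of color 1, lie in no chain, and both
    graphs have the same components. *)
Lemma lift_step t g g' : kempe_step peel t g g' -> kempe_step e t.+1 (lift g) (lift g').
Proof.
case=> a [b [A0 [/andP[a0 ha] /andP[b0 hb] pA0 gA0 ->]]].
have liftE A n : 0 < n -> (lift g A == n.+1) = (A \in edgeset peel) && (g A == n).
  move=> n0; rewrite ffunE; case: ifP => // /negbT /peel_out ->.
  by case: (A \in _) n n0 => [] [].
have kE : kadj e (lift g) a.+1 b.+1 =2 kadj peel g a b.
  move=> A B; rewrite /kadj !liftE // -!andb_orr.
  have sub D : D \in edgeset peel -> D \in edgeset e by rewrite peel_edgeset => /andP[].
  case: (boolP (A \in edgeset peel)) => [pA|_] /=; last by rewrite !andbF.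
  case: (boolP (B \in edgeset peel)) => [pB|_] /=; last by rewrite !andbF.
  by rewrite !sub.
exists a.+1, b.+1, A0; rewrite !liftE // pA0; split=> //.
  by move: pA0; rewrite peel_edgeset => /andP[].
apply/ffunP => A; rewrite [RHS]ffunE (eq_connect kE) !ffunE; case: (boolP (A \in _)) => [_|/peel_out hA].
  by rewrite /swap_col !eqSS; do !case: ifP => //.
rewrite hA; case: ifP => // _; rewrite /swap_col.
by case: (A \in _); rewrite /= ?eqSS ?(ltn_eqF a0) ?(ltn_eqF b0).
Qed.

Lemma lift_equiv t g g' : kempe_equiv peel t g g' -> kempe_equiv e t.+1 (lift g) (lift g').
Proof.
elim=> [f|f f1 f2 st _ IH]; first exact: kempe_refl.
exact: kempe_trans (lift_step st) IH.
Qed.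

Lemma peel_deg x : deg peel x <= deg e x.
Proof. by apply/subset_leq_card/subsetP => y; rewrite !inE => /andP[]. Qed.

Lemma peel_acyclic : acyclic (e_ge5 e) -> acyclic (e_ge5 peel).
Proof.
move=> ac s us ss; apply: contra (ac s us ss); apply: sub_cycle => x y.
rewrite /e_ge5 => /and3P[/andP[-> _] dx dy] /=.
by rewrite (leq_trans dx (peel_deg x)) (leq_trans dy (peel_deg y)).
Qed.
End Peel.

(** The induction runs over all graphs, since peeling changes [e]. The peeled graph inherits
    acyclicity because degrees only drop. *)
Lemma equiv_to_optimal (T : finType) (k : nat) (e : rel T) (f h : coloring T) :
  symmetric e -> irreflexive e -> acyclic (e_ge5 e) ->
  proper_coloring e k.+1 f -> proper_coloring e k h -> kempe_equiv e k.+1 f h.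
Proof.
elim: k e f h => [|k IH] e f h e_sym e_irr ac pf ph.
  suff -> : f = h by apply: kempe_refl.
  case: pf ph => _ f0 _ [h1 h0 _]; apply/ffunP => A.
  case: (boolP (A \in edgeset e)) => [/h1|nA]; first by case: (h A).
  by rewrite f0 ?h0.
have [g [pg fg] E] := agree e_sym e_irr ph pf (ltn0Sn k) ac.
apply: kequiv_trans fg _.
have refl x y : (col h x y == 1) = (col h x y == 1) by [].
suff: kempe_equiv e k.+2 (lift e h (lower g)) (lift e h (lower h)).
  by rewrite (lift_lower e_sym e_irr ph pg E) (lift_lower e_sym e_irr ph ph refl).
apply: (lift_equiv e_sym e_irr ph); apply: IH.
- exact: peel_sym.
- exact: peel_irr.
- exact: peel_acyclic.
- exact (lower_proper e_sym e_irr pg E).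
exact (lower_proper e_sym e_irr ph refl).
Qed.

Theorem theorem1p6 (T : finType) (e : rel T)
  (e_sym : symmetric e) (e_irr : irreflexive e)
  (hD : 5 <= maxdeg e)
  (hacyc : acyclic (e_ge5 e))
  (k : nat) (hk : chromatic_index e k) :
  forall f g : coloring T,
    proper_coloring e k.+1 f -> proper_coloring e k.+1 g ->
    kempe_equiv e k.+1 f g.
Proof.
move=> f g pf pg; case: hk => [[h ph] _].
apply: kequiv_trans (equiv_to_optimal e_sym e_irr hacyc pf ph) _.
exact: kempe_equiv_sym (equiv_to_optimal e_sym e_irr hacyc pg ph).
Qed.
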